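(* MB Dom Game is fixed-parameter tractable (FPT) when parameterized by the $P_4$-fewness of the input graph.
   Context: All graphs are finite, simple and undirected. The Maker-Breaker domination game on a graph $G$ is played by Dominator and Staller, who alternately claim one unclaimed vertex of $G$. Dominator wins if the vertices she claims contain a dominating set of $G$; otherwise Staller wins. MB Dom Game is the problem: given a graph $G$ and the first player (Dominator or Staller), decide which player has a winning strategy in the Maker-Breaker domination game on $G$ with the given player moving first. FPT with parameter $p$ means solvable in time $f(p)\cdot |V(G)|^{O(1)}$ for some computable function $f$. $P_4$ is the path on four vertices. A graph is a $(q,t)$-graph if no set of at most $q$ vertices induces more than $t$ distinct $P_4$'s (i.e. contains more than $t$ distinct $4$-subsets inducing a $P_4$). The $P_4$-fewness of $G$ is the smallest integer $q$ such that $G$ is a $(q,q-4)$-graph. *)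

(* Defs.v *)
From HB Require Import structures.
From mathcomp Require Import all_boot all_order all_algebra.

Set Implicit Arguments.
Unset Strict Implicit.
Unset Printing Implicit Defensive.

Import Order.TTheory GRing.Theory Num.Theory.

(* Every finite simple graph is isomorphic to one on {0, ..., n-1}. *)
Record sgraph := SGraph {
  nverts : nat;
  adj : rel 'I_nverts;
  adj_sym : symmetric adj;
  adj_irr : irreflexive adj
}.

Section Fewness.
Variables (T : finType) (e : rel T).

Definition induces_P4 (A : {set T}) : bool :=
  (#|A| == 4) &&
  [exists a, exists b, exists c, exists d,
     [&& A == [set a; b; c; d],
         e a b, e b c, e c d, ~~ e a c, ~~ e b d & ~~ e a d]].

Definition num_P4 (S : {set T}) : nat :=
  #|[set A : {set T} | (A \subset S) && induces_P4 A]|.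

(* t is an integer, so that q - 4 below is not truncated: no graph is a
   (q, q - 4)-graph for q < 4, because of the empty set of vertices. *)
Definition qt_graph (q : nat) (t : int) : bool :=
  [forall S : {set T}, (#|S| <= q) ==> ~~ (t < (num_P4 S)%:Z)%R].

Lemma P4_fewness_exists : exists q : nat, qt_graph q (q%:Z - 4)%R.
Proof.
exists (#|{: {set T}}| + 4); apply/forallP => S; apply/implyP => _.
by rewrite PoszD addrK -leNgt lez_nat max_card.
Qed.

Definition P4_fewness : nat := ex_minn P4_fewness_exists.

End Fewness.

Inductive player := Dominator | Staller.

Definition is_dominator (P : player) : bool :=
  if P is Dominator then true else false.

Lemma is_dominator_inj : injective is_dominator.
Proof. by do 2!case. Qed.

HB.instance Definition _ := Equality.copy player (inj_type is_dominator_inj).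

Definition opponent (P : player) : player :=
  if P is Dominator then Staller else Dominator.

(* Moves are numbered from 0; F is the first player. *)
Definition mover (F : player) (k : nat) : player :=
  if odd k then opponent F else F.

Section Game.
Variables (T : finType) (e : rel T).

Definition dominating (D : {set T}) : bool :=
  [forall v, (v \in D) || [exists u in D, e u v]].

(* A position is the sequence of vertices claimed so far, in order; a play
   ends when all the vertices have been claimed. *)
Definition position (h : seq T) : bool := uniq h.
Definition complete_play (s : seq T) : bool := uniq s && (size s == #|T|).

Definition claimed (F P : player) (s : seq T) : {set T} :=
  [set v in s | mover F (index v s) == P].

Definition winner (F : player) (s : seq T) : player :=
  if [exists D : {set T}, (D \subset claimed F Dominator s) && dominating D]
  then Dominator else Staller.

(* The value None is needed only when T has no vertex left to claim (in
   particular when T is empty). *)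
Definition strategy := seq T -> option T.

Definition legal_strategy (F P : player) (sigma : strategy) : Prop :=
  forall h, position h -> size h < #|T| -> mover F (size h) = P ->
  exists2 v, sigma h = Some v & v \notin h.

Definition follows (F P : player) (sigma : strategy) (s : seq T) : Prop :=
  forall k, k < size s -> mover F k = P -> onth s k = sigma (take k s).

Definition has_winning_strategy (F P : player) : Prop :=
  exists sigma : strategy, legal_strategy F P sigma /\
    forall s, complete_play s -> follows F P sigma s -> winner F s = P.

End Game.

(* A machine has directly addressed registers and an indirectly addressed
   memory, both holding natural numbers.  The arithmetic is restricted to
   addition and (truncated) subtraction, so that unit cost is polynomially
   related to Turing machine time.  Programs have structured control flow. *)
Record state := State { reg : nat -> nat; memory : nat -> nat }.

Definition upd (m : nat -> nat) (a v : nat) : nat -> nat :=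
  fun b => if b == a then v else m b.

Inductive op :=
  | Const of nat & nat        (* r_i := c *)
  | Move of nat & nat         (* r_i := r_j *)
  | Add of nat & nat & nat    (* r_i := r_j + r_k *)
  | Sub of nat & nat & nat    (* r_i := max(0, r_j - r_k) *)
  | Read of nat & nat         (* r_i := memory[r_j] *)
  | Write of nat & nat.       (* memory[r_i] := r_j *)

Definition step (o : op) (s : state) : state :=
  let: State r m := s in
  match o with
  | Const i c => State (upd r i c) m
  | Move i j => State (upd r i (r j)) m
  | Add i j k => State (upd r i (r j + r k)) m
  | Sub i j k => State (upd r i (r j - r k)) m
  | Read i j => State (upd r i (m (r j))) m
  | Write i j => State r (upd m (r i) (r j))
  end.

Inductive program :=
  | Skip
  | Op of op
  | Seq of program & program
  | If of nat & program & program  (* branches on r_i != 0 *)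
  | While of nat & program.        (* loops as long as r_i != 0 *)

(* [exec p s t s']: started in s, p halts in s' after t time units, where
   every operation and every evaluation of a test takes one unit. *)
Inductive exec : program -> state -> nat -> state -> Prop :=
  | exec_skip s : exec Skip s 0 s
  | exec_op o s : exec (Op o) s 1 (step o s)
  | exec_seq p1 p2 s s1 s2 t1 t2 :
      exec p1 s t1 s1 -> exec p2 s1 t2 s2 ->
      exec (Seq p1 p2) s (t1 + t2) s2
  | exec_if_true i p1 p2 s s' t :
      reg s i != 0 -> exec p1 s t s' -> exec (If i p1 p2) s t.+1 s'
  | exec_if_false i p1 p2 s s' t :
      reg s i = 0 -> exec p2 s t s' -> exec (If i p1 p2) s t.+1 s'
  | exec_while_true i p s s1 s2 t1 t2 :
      reg s i != 0 -> exec p s t1 s1 -> exec (While i p) s1 t2 s2 ->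
      exec (While i p) s (t1 + t2).+1 s2
  | exec_while_false i p s :
      reg s i = 0 -> exec (While i p) s 1 s.

(* Inputs and outputs of numerical functions are in register 0. *)
Definition computable (f : nat -> nat) : Prop :=
  exists p : program, forall k, exists t s',
    exec p (State (upd (fun=> 0) 0 k) (fun=> 0)) t s' /\ reg s' 0 = f k.

(* [answer x b] means that b is a correct answer on the instance x; the
   answer is read in register 0, as 1 (true) or 0 (false). *)
Record problem := Problem {
  instance : Type;
  input : instance -> state;
  input_size : instance -> nat;
  answer : instance -> bool -> Prop
}.

(* The running time is f(k) * n^O(1), where k is the parameter and n the
   size of the instance.  Using n + 1 instead of n is immaterial for n > 0
   (take 2 ^ c * f for f), and gives a meaningful bound for n = 0. *)
Definition FPT (Q : problem) (param : instance Q -> nat) : Prop :=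
  exists (p : program) (f : nat -> nat) (c : nat), computable f /\
    forall x : instance Q, exists t s' b,
      [/\ exec p (input x) t s',
          t <= f (param x) * (input_size x).+1 ^ c,
          reg s' 0 = nat_of_bool b &
          answer x b].

(* Memory cell i * n + j tells whether i and j are adjacent; register 0 holds
   n, and register 1 tells whether Dominator is the first player.  All the
   other cells and registers hold 0. *)
Definition MB_input (x : sgraph * player) : state :=
  let: (G, F) := x in
  State
    (upd (upd (fun=> 0) 0 (nverts G)) 1 (is_dominator F))
    (fun a => [exists i : 'I_(nverts G), exists j : 'I_(nverts G),
                 (a == i * nverts G + j) && adj i j]).

(* An answer names a player who has a winning strategy. *)
Definition MB_answer (x : sgraph * player) (b : bool) : Prop :=
  has_winning_strategy (@adj x.1) x.2 (if b then Dominator else Staller).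

Definition MB_Dom_Game : problem :=
  {| instance := (sgraph * player)%type;
     input := MB_input;
     input_size := fun x => nverts x.1;
     answer := MB_answer |}.

(* Main.v *)
(* Dominator's chances on a graph depend on a module R only through the outcomes
   of the game on R with either player moving first: R may be replaced by any
   subset of at least two vertices with the same two outcomes (out_subst), and
   some subset of at most three vertices always qualifies (out_three).  So the
   graph can be shrunk, one smallest module R with at least four vertices at a
   time, until three vertices are left.

   Let q be the P4-fewness.  If R or its complement is disconnected, then R has
   at most six vertices by minimality.  Otherwise R contains a P4 (Seinsche).
   Extend it, inside R, by vertices that create new P4s, one or two at a time,
   keeping at least |S| - 3 P4s in the current set S; this stops while |S| < q.
   The vertices of R outside S are then adjacent to all of S, to none of S, or
   exactly to the "midpoints" of S.  Either S together with the vertices of the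
   last kind is a module, hence all of R, which bounds |R| by q + 2; or R contains
   a spider with three legs or its complement.  In that case either |R| <= q + 2
   again, or two legs of the spider are interchangeable in R and one of them can
   be deleted (out_legs), or R has two vertices that each dominate all
   but one vertex of R, and Dominator wins on R (out_nearly_universal).

   The outcomes of a module with at most q + 6 vertices are computed by dynamic
   programming over its at most 3 ^ (q + 6) positions.  The algorithm is written
   in a language of loops and arrays, with a compiler to the machine. *)

Require Import Defs.
From mathcomp Require Import all_boot all_order all_algebra.
From mathcomp Require Import zify.

Set Implicit Arguments.
Unset Strict Implicit.
Unset Printing Implicit Defensive.

(** * The game on a graph and on its modules *)

(** A module [R] meets the rest only through its outside neighbours [S1]: a claim in [R] dominates
    all of [S1], and a claim in [S1] dominates all of [R]. Moving first never hurts, so only three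
    pairs of outcomes occur. If the player who starts on [R] wins there, the first move in [R]
    decides, and [R] acts like a single vertex that both players may claim. Two vertices never have
    this mixed pair of outcomes, three can; hence replacements by up to three vertices and the
    threshold of four. A smallest module with at least four vertices may still contain proper
    modules of up to three, whence 6 = 3 + 3 and, as the extension stops with |S| <= q - 1, q + 2 =
    (q - 1) + 3. The exponent q + 6 covers both.

    The obstacle: when |S| = q - 1, a pair of vertices that creates two P4s no longer fits into q
    vertices, and fewness says nothing about it. Such a leftover pair forms with the starting P4 a
    spider or its complement. For q >= 8, restarting from a denser configuration leaves room for
    pairs; q = 6 excludes the spider; the deletion of legs is for q = 5 and q = 7. *)

Section MakerBreaker.
Variable T : finType.
Implicit Types (U D X Y : {set T}) (win : {set T} -> bool).

Fixpoint val_rec win (k : nat) U D (t : bool) : bool :=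
  if k is k'.+1 then
    if t then [exists x in U, val_rec win k' (U :\ x) (x |: D) false]
    else [forall x in U, val_rec win k' (U :\ x) D true]
  else win D.

(* D has been claimed by Dominator, the vertices of U are unclaimed, t tells
   whether Dominator is on the move, and win is her goal. *)
Definition mb_val win U D t := val_rec win #|U| U D t.

Definition mono win := forall X Y, X \subset Y -> win X -> win Y.

Lemma val0 win D t : mb_val win set0 D t = win D.
Proof. by rewrite /mb_val cards0. Qed.

Lemma valD win U D : U != set0 ->
  mb_val win U D true = [exists x in U, mb_val win (U :\ x) (x |: D) false].
Proof.
move=> U0; rewrite /mb_val; case E: #|U| => [|k]; first by rewrite (cards0_eq E) eqxx in U0.
apply: eq_existsb => x; case xU: (x \in U) => //=.
by have := cardsD1 x U; rewrite xU E add1n => -[->].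
Qed.

Lemma valS win U D : U != set0 ->
  mb_val win U D false = [forall x in U, mb_val win (U :\ x) D true].
Proof.
move=> U0; rewrite /mb_val; case E: #|U| => [|k]; first by rewrite (cards0_eq E) eqxx in U0.
apply: eq_forallb => x; case xU: (x \in U) => //=.
by have := cardsD1 x U; rewrite xU E add1n => -[->].
Qed.

Lemma valD_intro win U D x : x \in U -> mb_val win (U :\ x) (x |: D) false -> mb_val win U D true.
Proof.
move=> xU H; rewrite valD; last by apply/set0Pn; exists x.
by apply/existsP; exists x; rewrite xU.
Qed.

Lemma valD_elim win U D : mb_val win U D true -> 
  win D /\ U = set0 \/ exists2 x, x \in U & mb_val win (U :\ x) (x |: D) false.
Proof.
case: (eqVneq U set0) => [->|U0]; first by rewrite val0; left.
by rewrite valD // => /existsP [x /andP [xU H]]; right; exists x.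
Qed.

Lemma valS_elim win U D x : x \in U -> mb_val win U D false -> mb_val win (U :\ x) D true.
Proof.
move=> xU; rewrite valS; last by apply/set0Pn; exists x.
by move=> /forall_inP; apply.
Qed.

Lemma valS_intro win U D : (U = set0 -> win D) ->
  (forall x, x \in U -> mb_val win (U :\ x) D true) -> mb_val win U D false.
Proof.
case: (eqVneq U set0) => [->|U0] H0 H; first by rewrite val0 H0.
by rewrite valS //; apply/forall_inP.
Qed.

Lemma set_ind (P : {set T} -> Prop) :
  (forall U, (forall x, x \in U -> P (U :\ x)) -> P U) -> forall U, P U.
Proof.
move=> H U; move: {2}#|U|.+1 (ltnSn #|U|) => k; elim: k U => // k IH U lt.
apply: H => x xU; apply: IH; have := cardsD1 x U; rewrite xU; lia.
Qed.

(** Dominator repeats the same moves in the second game; [X] is what she goes on to claim. *)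
Lemma val_le win win' U D D' t :
  (forall X, X \subset U -> win (D :|: X) -> win' (D' :|: X)) ->
  mb_val win U D t -> mb_val win' U D' t.
Proof.
elim/set_ind: U D D' t => U IH D D' t H.
have H0 : win D -> win' D' by have := H set0 (sub0set _); rewrite !setU0.
have HD x : x \in U -> forall X, X \subset U :\ x -> win ((x |: D) :|: X) -> win' ((x |: D') :|: X).
  move=> xU X XU; rewrite -!setUA !(setUCA [set x]); apply: H.
  by rewrite subUset sub1set xU (subset_trans XU) ?subD1set.
have HS x X : X \subset U :\ x -> win (D :|: X) -> win' (D' :|: X).
  by move=> XU; apply: H; rewrite (subset_trans XU) ?subD1set.
case: t.
  move=> /valD_elim [[/H0 w U0]|[x xU v]]; first by rewrite U0 val0.
  by apply: (valD_intro xU); apply: IH v => //; exact: HD.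
move=> v; apply: valS_intro => [U0|x xU].
  by move: v; rewrite U0 val0.
by apply: IH (valS_elim xU v) => //; exact: HS.
Qed.

Lemma val_win_eq win win' U D t :
  (forall X, X \subset U -> win (D :|: X) = win' (D :|: X)) ->
  mb_val win U D t = mb_val win' U D t.
Proof. by move=> H; apply/idP/idP; apply: val_le => X XU; rewrite (H X XU). Qed.

Lemma val_sure win U D t : (forall X, X \subset U -> win (D :|: X)) -> mb_val win U D t.
Proof.
elim/set_ind: U D t => U IH D t H.
have H0 : win D by have := H set0 (sub0set _); rewrite setU0.
case: t; last first.
  apply: valS_intro => // x xU; apply: IH => // X XU; apply: H.
  by rewrite (subset_trans XU) ?subD1set.
case: (eqVneq U set0) => [->|/set0Pn [x xU]]; first by rewrite val0.
apply: (valD_intro xU); apply: IH => // X XU.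
rewrite -setUA setUCA; apply: H.
by rewrite subUset sub1set xU (subset_trans XU) ?subD1set.
Qed.

Lemma val_hope win U D t : mono win -> mb_val win U D t -> win (D :|: U).
Proof.
move=> mw; elim/set_ind: U D t => U IH D t.
case: t.
  move=> /valD_elim [[w ->]|[x xU v]]; first by rewrite setU0.
  by have := IH _ xU _ _ v; rewrite -setUA setUCA setD1K.
case: (eqVneq U set0) => [->|/set0Pn [x xU]]; first by rewrite val0 setU0.
move=> /(valS_elim xU) /(IH _ xU); apply: mw.
by rewrite setUS ?subD1set.
Qed.

Lemma setD1_diff U x y : x \in U -> y \in U :\ x -> x \in U :\ y.
Proof. by move=> xU; rewrite !inE eq_sym xU => /andP [->]. Qed.

Lemma setD1AC U x y : U :\ x :\ y = U :\ y :\ x.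
Proof. by rewrite !setDDl setUC. Qed.

(** Dominator plays as if [x] were still free. When her strategy asks for [x], she claims any other
    vertex, which takes over the role of the gift. *)
Lemma val_gift win U D t x : mono win -> x \in U ->
  mb_val win U D t -> mb_val win (U :\ x) (x |: D) t.
Proof.
move=> mw; elim/set_ind: U D t x => U IH D t x xU.
case: t => v.
  case/valD_elim: v => [[_ U0]|[y yU v]]; first by rewrite U0 inE in xU.
  case: (eqVneq y x) => [yx|ne].
    rewrite yx in v; case: (eqVneq (U :\ x) set0) => [U0|/set0Pn [z zU]].
      by rewrite U0 !val0 in v *.
    by apply: (valD_intro zU); exact: IH v.
  have yU' : y \in U :\ x by rewrite !inE ne.
  apply: (valD_intro yU'); rewrite setD1AC setUCA; apply: IH v => //.
  by rewrite !inE eq_sym ne.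
apply: valS_intro => [U0|y yU].
  have := valS_elim xU v; rewrite U0 val0; apply: mw; exact: subsetUr.
rewrite setD1AC; have yU0 : y \in U by case/setD1P: yU.
apply: IH => //; first exact: setD1_diff yU.
exact: valS_elim v.
Qed.

Lemma val_extra win U D : mono win -> mb_val win U D false -> mb_val win U D true.
Proof.
move=> mw; case: (eqVneq U set0) => [->|/set0Pn [x xU]]; first by rewrite !val0.
by move=> v; apply: (valD_intro xU); apply: val_gift.
Qed.

Lemma val_turn win U D t : mono win -> mb_val win U D false -> mb_val win U D t.
Proof. by case: t => // mw; exact: val_extra. Qed.

Lemma setD1_setUl (A B : {set T}) x : x \notin B -> (A :|: B) :\ x = A :\ x :|: B.
Proof. by move=> xB; apply/setP => y; rewrite !inE; case: eqVneq => // ->; rewrite (negPf xB). Qed.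

Lemma setD1_setUr (A B : {set T}) x : x \notin A -> (A :|: B) :\ x = A :|: B :\ x.
Proof. by move=> xA; rewrite setUC setD1_setUl // setUC. Qed.

(** Dominator plays the two boards separately and answers Staller on the board where he moved. On
    the second board she wins as second player; when no answer is left there, a spare move on the
    first board does no harm. *)
Lemma val_sum (ZH ZR HU HD RU RD : {set T}) winH winR win t :
  mono winH -> mono winR ->
  (forall A B : {set T}, A \subset ZH -> B \subset ZR -> winH A -> winR B -> win (A :|: B)) ->
  [disjoint HU & RU] -> HU :|: HD \subset ZH -> RU :|: RD \subset ZR ->
  mb_val winH HU HD t -> mb_val winR RU RD false -> mb_val win (HU :|: RU) (HD :|: RD) t.
Proof.
move=> mH mR W.
have [m lem] : {m | (#|HU| + #|RU|).*2 + t < m} by exists ((#|HU| + #|RU|).*2 + t).+1.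
elim: m HU HD RU RD t lem => // m IH HU HD RU RD t lem dis sH sR vH vR.
have notR x : x \in HU -> x \notin RU by move=> xH; rewrite (disjointFr dis).
have notH x : x \in RU -> x \notin HU by move=> xH; rewrite (disjointFl dis).
have sub1 (A B Z : {set T}) x : x \in A -> A :|: B \subset Z -> A :\ x :|: (x |: B) \subset Z.
  by move=> xA; rewrite setUCA setUA setD1K.
have sub2 (A B Z : {set T}) x : A :|: B \subset Z -> A :\ x :|: B \subset Z.
  by apply: subset_trans; rewrite setSU ?subD1set.
have disH x : [disjoint HU :\ x & RU] by apply: disjointWl dis; exact: subD1set.
have disR x : [disjoint HU & RU :\ x] by apply: disjointWr dis; exact: subD1set.
have cH x : x \in HU -> #|HU| = #|HU :\ x|.+1 by move=> xH; rewrite (cardsD1 x HU) xH.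
have cR x : x \in RU -> #|RU| = #|RU :\ x|.+1 by move=> xH; rewrite (cardsD1 x RU) xH.
case: t lem vH => lem vH.
  case/valD_elim: vH => [[w H0]|[x xH vH]].
    rewrite H0 !set0U in sH *; case/valD_elim: (val_extra mR vR) => [[w' R0]|[x xR vR']].
      rewrite R0 val0; apply: W => //; rewrite R0 set0U in sR; exact: sR.
    apply: (valD_intro xR); rewrite setUCA -[RU :\ x]set0U.
    apply: IH vR' => //; rewrite ?set0U ?disjoints_subset ?sub0set ?sub1 ?val0 //.
    by rewrite cards0; move: lem; rewrite H0 cards0 (cR x xR); lia.
  apply: (valD_intro (x := x)); first by rewrite inE xH.
  rewrite (setD1_setUl _ (notR _ xH)) setUA; apply: IH vH vR; rewrite ?sub1 //.
  by move: lem; rewrite (cH x xH); lia.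
apply: valS_intro => [/eqP|x /setUP [xH|xR]].
- rewrite setU_eq0 => /andP [/eqP H0 /eqP R0]; rewrite H0 R0 !val0 in vH vR.
  by apply: W => //; [move: sH; rewrite H0 set0U|move: sR; rewrite R0 set0U].
- rewrite (setD1_setUl _ (notR _ xH)); apply: IH (valS_elim xH vH) vR => //; last exact: sub2.
  by move: lem; rewrite (cH x xH); lia.
rewrite (setD1_setUr _ (notH _ xR)).
case/valD_elim: (valS_elim xR vR) => [[w R0]|[y yR vR']].
  rewrite R0; apply: IH (val_extra mH vH) _ => //; last by rewrite val0.
  - by rewrite cards0; move: lem; rewrite (cR x xR); lia.
  - by rewrite disjoint_sym disjoints_subset sub0set.
  - by rewrite -R0; exact: sub2.
have yH : y \notin HU by apply: notH; case/setD1P: yR.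
apply: (valD_intro (x := y)); first by rewrite inE yR orbT.
rewrite (setD1_setUr _ yH) setUCA; apply: IH vH vR' => //.
- move: lem; rewrite (cR x xR) (cardsD1 y (RU :\ x)) yR; lia.
- by apply: disjointWr dis; rewrite !(subset_trans (subD1set _ _)) ?subD1set.
- by apply: sub1 => //; exact: sub2.
Qed.

Lemma val_dual (Z U D : {set T}) win t :
  U \subset Z -> D \subset Z -> [disjoint U & D] ->
  mb_val win U D t = ~~ mb_val (fun S => ~~ win (Z :\: S)) U (Z :\: (U :|: D)) (~~ t).
Proof.
elim/set_ind: U D t => U IH D t sU sD dis.
case: (eqVneq U set0) => [->|U0].
  by rewrite !val0 negbK set0U setDDr setDv set0U (setIidPr sD).
have E x : x \in U -> U :\ x :|: (x |: D) = U :|: D.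
  by move=> xU; rewrite setUCA setUA setD1K.
have F x : x \in U -> Z :\: (U :\ x :|: D) = x |: Z :\: (U :|: D).
  move=> xU; apply/setP => y; rewrite !inE; case: eqVneq => //= ->.
  by rewrite (subsetP sU) // (disjointFr dis).
have H1 x : U :\ x \subset Z by rewrite (subset_trans _ sU) ?subD1set.
case: t => /=.
  rewrite valD // valS // negb_forall; apply: eq_existsb => x; rewrite negb_imply.
  case xU: (x \in U) => //=; rewrite IH // ?E //.
    by rewrite subUset sub1set (subsetP sU).
  apply/pred0Pn => -[y]; rewrite !inE => /andP [/andP [ne yU]].
  by rewrite (negPf ne) (disjointFr dis yU).
rewrite valS // valD // negb_exists; apply: eq_forallb => x; rewrite negb_and.
case xU: (x \in U) => //=; rewrite IH // ?F //.
by apply: disjointWl dis; exact: subD1set.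
Qed.

(** This is [val_sum] with the roles exchanged by [val_dual]; the value [true] on the second board
    makes Staller the second player there. *)
Lemma val_sum_Staller (ZH ZR HU HD RU RD : {set T}) winH winR win t :
  mono winH -> mono winR -> [disjoint ZH & ZR] ->
  (forall A B : {set T}, A \subset ZH -> B \subset ZR -> win (A :|: B) -> winH A || winR B) ->
  [disjoint HU & HD] -> [disjoint RU & RD] -> HU :|: HD \subset ZH -> RU :|: RD \subset ZR ->
  ~~ mb_val winH HU HD t -> ~~ mb_val winR RU RD true -> ~~ mb_val win (HU :|: RU) (HD :|: RD) t.
Proof.
move=> mH mR dZ W dH dR; rewrite !subUset => /andP [HUZ HDZ] /andP [RUZ RDZ].
rewrite (val_dual winH t HUZ HDZ dH) (val_dual winR true RUZ RDZ dR) !negbK => vH vR.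
have out1 x : x \in ZH -> x \notin ZR by move=> xH; rewrite (disjointFr dZ).
have out2 x : x \in ZR -> x \notin ZH by move=> xH; rewrite (disjointFl dZ).
rewrite (@val_dual (ZH :|: ZR)); first last.
- apply/pred0Pn => -[x]; rewrite !inE => /andP [/orP [xU|xU] /orP [xD|xD]].
  + by rewrite (disjointFr dH xU) in xD.
  + by have := out1 _ (subsetP HUZ _ xU); rewrite (subsetP RDZ).
  + by have := out2 _ (subsetP RUZ _ xU); rewrite (subsetP HDZ).
  + by rewrite (disjointFr dR xU) in xD.
- exact: setUSS.
- exact: setUSS.
rewrite negbK.
have -> : (ZH :|: ZR) :\: (HU :|: RU :|: (HD :|: RD)) =
    (ZH :\: (HU :|: HD)) :|: (ZR :\: (RU :|: RD)).
  apply/setP => x; rewrite !inE.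
  case xH: (x \in ZH) => /=; last first.
    have -> : (x \in HU) = false by apply: contraFF xH; exact: (subsetP HUZ).
    have -> : (x \in HD) = false by apply: contraFF xH; exact: (subsetP HDZ).
    by [].
  have xR := negPf (out1 _ xH); rewrite xR !andbF orbF andbT.
  have -> : (x \in RU) = false by apply: contraFF xR; exact: (subsetP RUZ).
  have -> : (x \in RD) = false by apply: contraFF xR; exact: (subsetP RDZ).
  by rewrite !orbF andbT.
have anti (Z : {set T}) w : mono w -> mono (fun S => ~~ w (Z :\: S)).
  by move=> mw X Y XY; apply: contra; apply: mw; exact: setDS.
apply: (@val_sum ZH ZR) vH vR; rewrite ?subUset ?HUZ ?RUZ ?subsetDl //; try exact: anti.
- move=> A B AZ BZ nH nR; apply/negP.
  have -> : (ZH :|: ZR) :\: (A :|: B) = (ZH :\: A) :|: (ZR :\: B).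
    apply/setP => x; rewrite !inE.
    case xH: (x \in ZH) => /=; last first.
      have -> : (x \in A) = false by apply: contraFF xH; exact: (subsetP AZ).
      by [].
    have xR := negPf (out1 _ xH); rewrite xR !andbF orbF andbT.
    have -> : (x \in B) = false by apply: contraFF xR; exact: (subsetP BZ).
    by rewrite orbF andbT.
  move=> /(W _ _ (subsetDl _ _) (subsetDl _ _)).
  by rewrite (negPf nH) (negPf nR).
- by apply: disjointWl HUZ _; apply: disjointWr RUZ _.
Qed.

(** Staller's move takes at most one vertex of [Y], and Dominator takes another. *)
Lemma val_hit win U D (Y : {set T}) : Y \subset U -> 1 < #|Y| ->
  (forall X, X :&: Y != set0 -> win (D :|: X)) -> mb_val win U D false.
Proof.
move=> YU Y2 H; apply: valS_intro => [U0|x xU].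
  by move: Y2; move: YU; rewrite U0 subset0 => /eqP ->; rewrite cards0.
have /card_gt0P [y] : 0 < #|Y :\ x| by move: Y2; rewrite (cardsD1 x Y); case: (_ \in _); lia.
rewrite !inE => /andP [ne yY].
have yU : y \in U :\ x by rewrite !inE ne (subsetP YU).
apply: (valD_intro yU); apply: val_sure => X _; rewrite -setUA setUCA; apply: H.
by apply/set0Pn; exists y; rewrite !inE eqxx yY.
Qed.

Lemma val_iso (p : T -> T) win win' U D t : injective p ->
  (forall X, X \subset D :|: U -> win X = win' (p @: X)) ->
  mb_val win U D t = mb_val win' (p @: U) (p @: D) t.
Proof.
move=> pI; elim/set_ind: U D t => U IH D t H.
have pD x : p @: (U :\ x) = p @: U :\ p x.
  apply/setP => y; rewrite !inE; apply/imsetP/andP => [[w]|[ne /imsetP [w wU E]]].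
    by rewrite !inE => /andP [ne wU] ->; rewrite (inj_eq pI) imset_f.
  by exists w; rewrite // !inE wU -(inj_eq pI) -E ne.
have pU x : p @: (x |: D) = p x |: p @: D by rewrite imsetU imset_set1.
have HD x : x \in U -> forall X, X \subset (x |: D) :|: U :\ x -> win X = win' (p @: X).
  by move=> xU X XU; apply: H; move: XU; rewrite -setUA setUCA setD1K.
have HS x X : X \subset D :|: U :\ x -> win X = win' (p @: X).
  by move=> XU; apply: H; apply: subset_trans XU _; rewrite setUS ?subD1set.
case: (eqVneq U set0) => [U0|U0]; first by rewrite U0 imset0 !val0 H // subsetUl.
have U0' : p @: U != set0 by rewrite imset_eq0.
case: t.
  rewrite !valD //; apply/exists_inP/exists_inP => [[x xU v]|[_ /imsetP [x xU ->] v]].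
    by exists (p x); rewrite ?imset_f // -pD -pU -IH //; exact: HD.
  by exists x => //; rewrite IH // ?pD ?pU //; exact: HD.
rewrite !valS //; apply/forall_inP/forall_inP => v x; last first.
  by move=> xU; rewrite IH // ?pD; [apply: v; rewrite imset_f|exact: HS].
by move=> /imsetP [y yU ->]; rewrite -pD -IH //; [exact: v|exact: HS].
Qed.

End MakerBreaker.

Lemma disjoint_0 (T : finType) (A : {set T}) : [disjoint A & (set0 : {set T})].
Proof. by rewrite disjoint_sym disjoints_subset sub0set. Qed.

Section Domination.
Variables (T : finType) (e : rel T).
Hypotheses (esym : symmetric e) (eirr : irreflexive e).
Implicit Types (U R D A B X : {set T}).

(** Only [A] has to be dominated, possibly from outside: once a module is split off, parts of the
    graph are dominated separately. *)
Definition dom A D : bool := [forall v in A, [exists u in D, (u == v) || e u v]].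

Lemma domP A D : reflect (forall v, v \in A -> exists2 u, u \in D & (u == v) || e u v) (dom A D).
Proof. by apply: (iffP forall_inP) => H v vA; apply/exists_inP; exact: H. Qed.

Lemma mono_dom A : mono (dom A).
Proof.
move=> X Y XY /domP H; apply/domP => v /H [u uX uv]; exists u => //; exact: (subsetP XY).
Qed.

Definition hits X D := D :&: X != set0.

Lemma hitsP X D : reflect (exists2 x, x \in D & x \in X) (hits X D).
Proof.
rewrite /hits; apply: (iffP (set0Pn _)) => [[x]|[x xD xX]]; first by rewrite inE => /andP []; exists x.
by exists x; rewrite inE xD.
Qed.

Lemma mono_hits X : mono (hits X).
Proof. by move=> A B AB /hitsP [x /(subsetP AB) xB xX]; apply/hitsP; exists x. Qed.

Lemma mono_and win win' : @mono T win -> mono win' -> mono (fun D => win D && win' D).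
Proof. by move=> m m' X Y XY /andP [/(m _ _ XY) -> /(m' _ _ XY)]. Qed.

Definition out U t := mb_val (dom U) U set0 t.

Definition module U R := R \subset U /\
  forall x u v, x \in U -> x \notin R -> u \in R -> v \in R -> e u x = e v x.

(** Dominator needs one of two adjacent vertices, but both of two nonadjacent ones. It does not
    matter who starts, so outcomes that depend on the first player take at least three vertices. *)
Lemma out_pair u v t : u != v -> out [set u; v] t = e u v.
Proof.
move=> ne; case euv: (e u v).
  apply: val_turn; first exact: mono_dom.
  apply: (val_hit (Y := [set u; v])) => //; first by rewrite cards2 ne.
  move=> X /set0Pn [x]; rewrite !inE => /andP [xX xuv]; apply/domP => w; rewrite !inE => wuv.
  exists x; first by rewrite inE xX orbT.
  by case/orP: wuv xuv => /eqP -> /orP [] /eqP ->; rewrite ?eqxx ?euv ?orbT // esym euv orbT.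
apply/negP => v0; have {v0} : out [set u; v] true.
  by case: t v0 => //; apply: val_extra; exact: mono_dom.
case/valD_elim => [[_ /setP /(_ u)]|[x xuv vS]]; first by rewrite !inE eqxx.
pose y := if x == u then v else u.
have yuv : y \in [set u; v] :\ x.
  by rewrite /y !inE; case: (eqVneq x u) => [->|nx]; rewrite ?eqxx ?orbT ?andbT // eq_sym.
have := val_hope (@mono_dom _) (valS_elim yuv vS) => /domP /(_ y).
have -> : x |: set0 :|: [set u; v] :\ x :\ y = [set x].
  apply/setP => w; rewrite !inE orbF /y; move: xuv; rewrite !inE.
  case: (eqVneq x u) => [->|nx] /=; first by case: (w == u); case: (w == v).
  by move=> /eqP ->; case: (w == u); case: (w == v).
case; first by case/setD1P: yuv.
move=> w; rewrite !inE => /eqP ->; case/setD1P: yuv => /negPf yx _; rewrite eq_sym yx /=.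
rewrite /y; move: xuv; rewrite !inE; case: (eqVneq x u) => [->|nx] /=; first by rewrite euv.
by move=> /eqP ->; rewrite esym euv.
Qed.

(** * Replacing a module by a subset with the same outcomes *)

Section Substitution.
Variables (U R : {set T}) (z : T).
Hypotheses (mR : module U R) (zR : z \in R) (R2 : 1 < #|R|).

(** The vertices outside [R] fall into [S1], adjacent to all of [R], and [S2], adjacent to none. In
    each of the three cases for the outcomes of [R], the game on [U] is described by [H], [S1], [S2]
    and the vertex [z] alone. *)
Let H := U :\: R.
Let S1 := [set x in H | e z x].
Let S2 := [set x in H | ~~ e z x].

Lemma module_adj x u : x \in H -> u \in R -> e u x = e z x.
Proof. by rewrite inE => /andP [xR xU] uR; case: mR => _; apply. Qed.

Lemma disjoint_HR : [disjoint H & R].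
Proof. by rewrite disjoint_sym; apply/pred0Pn => -[x]; rewrite !inE => /andP [->]. Qed.

Lemma setU_HR : H :|: R = U.
Proof.
case: mR => RU _; apply/setP => x; rewrite !inE; case xR: (x \in R); rewrite /= ?orbF //.
by rewrite (subsetP RU).
Qed.

Lemma dom_S2 A B : B \subset R -> dom U (A :|: B) -> dom S2 A.
Proof.
move=> BR /domP W; apply/domP => v; rewrite inE => /andP [vH nzv].
have vU : v \in U by move: vH; rewrite inE => /andP [].
case: (W v vU) => u; rewrite inE => /orP [uA|/(subsetP BR) uR] uv; first by exists u.
move: uv; rewrite (module_adj vH uR) (negPf nzv) orbF => /eqP uv.
by move: vH; rewrite -uv inE uR.
Qed.

Lemma dom_U A B : A \subset H -> B \subset R -> B != set0 -> dom S2 A ->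
  dom R B || hits S1 A -> dom U (A :|: B).
Proof.
move=> AH BR /set0Pn [b bB] W WR; apply/domP => v vU.
case vR: (v \in R).
  case/orP: WR => [/domP /(_ v vR) [u uB uv]|/hitsP [u uA]].
    by exists u => //; rewrite inE uB orbT.
  rewrite inE => /andP [uH zu]; exists u; first by rewrite inE uA.
  by rewrite esym (module_adj uH vR) zu orbT.
have vH : v \in H by rewrite inE vR.
case zv: (e z v).
  exists b; first by rewrite inE bB orbT.
  by rewrite (module_adj vH (subsetP BR _ bB)) zv orbT.
have vS : v \in S2 by rewrite inE vH zv.
by have /domP /(_ v vS) [u uA uv] := W; exists u => //; rewrite inE uA.
Qed.

Lemma dom_R A B : A \subset H -> dom U (A :|: B) -> dom R B || hits S1 A.
Proof.
move=> AH /domP W; apply/orP; case: (boolP (hits S1 A)) => hA; [by right|left].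
apply/domP => v vR; case: mR => RU _; case: (W v (subsetP RU _ vR)) => u.
rewrite inE => /orP [uA|uB uv]; last by exists u.
have uH := subsetP AH _ uA => /orP [/eqP uv|uv].
  by move: uH; rewrite uv inE vR.
case/negP: hA; apply/hitsP; exists u => //.
by rewrite inE uH -(module_adj uH vR) esym.
Qed.

Definition goal Y D := dom S2 D && hits Y D.

Lemma mono_goal Y : mono (goal Y).
Proof. by apply: mono_and; [exact: mono_dom|exact: mono_hits]. Qed.

Lemma R_neq0 : R != set0.
Proof. by apply/set0Pn; exists z. Qed.

(** Dominator wins on [R] as second player, and her claims there dominate [S1] too; only [S2] is
    left to the game on [H]. For the converse the goal on [R] is taken to be false, as vertices of
    [R] never help with [S2]. *)
Lemma out_module0 t : out R false -> out U t = mb_val (dom S2) H set0 t.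
Proof.
move=> oR; apply/idP/idP; last first.
  move=> v; rewrite /out -setU_HR -[set0]setU0; apply: (@val_sum _ H R) v oR;
    rewrite ?setU0 ?disjoint_HR //; try exact: mono_dom.
  move=> A B AH BR wA wB; rewrite setU_HR; apply: dom_U; rewrite ?wB //.
  by have /domP /(_ z zR) [u uB _] := wB; apply/set0Pn; exists u.
apply: contraTT => v; rewrite /out -setU_HR -[set0]setU0.
apply: (@val_sum_Staller _ H R _ _ _ _ _ (fun=> false)) v _;
  rewrite ?setU0 ?disjoint_HR ?disjoint_0 //; try exact: mono_dom.
- by move=> A B AH BR; rewrite orbF setU_HR; exact: dom_S2.
- by apply/negP => v'; move: (@val_hope _ xpred0 _ _ _ (fun _ _ _ => id) v').
Qed.

(** Staller wins on [R] itself, so [R] has to be dominated from [S1]. On the other hand [R] has two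
    vertices, so Dominator gets one of them even as second player, and it dominates [S1]. *)
Lemma out_module2 t : ~~ out R true -> out U t = mb_val (goal S1) H set0 t.
Proof.
move=> oR; apply/idP/idP; last first.
  move=> v; rewrite /out -setU_HR -[set0]setU0.
  apply: (@val_sum _ H R _ _ _ _ _ (hits R)) v _;
    rewrite ?setU0 ?disjoint_HR //; try exact: mono_goal; try exact: mono_hits.
    move=> A B AH BR /andP [wA hA] wB; rewrite setU_HR; apply: dom_U; rewrite ?hA ?orbT //.
    by case/hitsP: wB => u uB _; apply/set0Pn; exists u.
  by apply: (val_hit (Y := R)) => // X; rewrite set0U.
apply: contraTT => v; rewrite /out -setU_HR -[set0]setU0.
apply: (@val_sum_Staller _ H R) v oR;
  rewrite ?setU0 ?disjoint_HR ?disjoint_0 //; try exact: mono_dom; try exact: mono_goal.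
by move=> A B AH BR; rewrite setU_HR => w; rewrite /goal (dom_S2 BR w) /= orbC; exact: dom_R.
Qed.

Lemma z_notin_H : z \notin H.
Proof. by rewrite inE zR. Qed.

Lemma dom_S2_z D : dom S2 (z |: D) = dom S2 D.
Proof.
apply/idP/idP => [/domP W|]; last by apply: mono_dom; exact: subsetUr.
apply/domP => v vS; case: (W v vS) => u; rewrite !inE => /orP [/eqP ->|uD]; last by exists u.
move: vS; rewrite inE => /andP [vH /negPf ->]; rewrite orbF => /eqP vz.
by move: z_notin_H; rewrite vz vH.
Qed.

(* z stands for the first vertex of R to be claimed. *)
Lemma out_module1 t : out R true -> ~~ out R false ->
  out U t = mb_val (goal (z |: S1)) (z |: H) set0 t.
Proof.
move=> oT oF.
(* With three vertices, two remain in [R] after Staller's first claim there, and Dominator gets one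
   of them. *)
have R3 : 2 < #|R|.
  rewrite ltn_neqAle R2 andbT eq_sym; apply/negP => /cards2P [u [v [ne RE]]].
  by move: oT oF; rewrite RE !out_pair // => euv; rewrite euv.
(* A winning first move on [R] for Dominator, and then [r1], one for Staller. *)
have [r0 r0R v0] : exists2 r, r \in R & mb_val (dom R) (R :\ r) [set r] false.
  case/valD_elim: oT => [[_ /eqP R0]|[r rR v]]; first by rewrite (negPf R_neq0) in R0.
  by exists r => //; rewrite setU0 in v.
have [r1 r1R v1] : exists2 r, r \in R & ~~ mb_val (dom R) (R :\ r) set0 true.
  move: oF; rewrite /out valS ?R_neq0 // negb_forall => /existsP [r].
  by rewrite negb_imply => /andP [rR v]; exists r.
have RD1 r : r \in R -> 1 < #|R :\ r| by move=> rR; move: R3; rewrite (cardsD1 r R) rR; lia.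
have zH := z_notin_H.
have notS1 X : X \subset H -> goal (z |: S1) X = goal S1 X.
  move=> XH; congr (_ && _); apply/hitsP/hitsP => -[x xX]; rewrite !inE; last first.
    by move=> H1; exists x; rewrite // !inE H1 orbT.
  case/orP => [/eqP xz|H1]; last by exists x; rewrite // !inE H1.
  by case/negP: zH; rewrite -xz (subsetP XH).
(* The two games run in parallel as long as [R] and [z] are untouched. The first claim in [R]
   matches a claim of [z] by the same player, after which the game on [R] separates from the one on
   [H]. *)
suff A HU HD t' : HU :|: HD \subset H -> [disjoint HU & HD] ->
    mb_val (dom U) (HU :|: R) HD t' = mb_val (goal (z |: S1)) (z |: HU) HD t'.
  by rewrite /out -{2}setU_HR A ?setU0 ?disjoint_0.
elim/set_ind: HU HD t' => HU IH HD t' sH dis.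
have /andP [HUH HDH] : (HU \subset H) && (HD \subset H) by rewrite -subUset.
have zHU : z \notin HU by apply: contra zH; exact: (subsetP HUH).
have zHD : z \notin HD by apply: contra zH; exact: (subsetP HDH).
have zK : (z |: HU) :\ z = HU by rewrite setU1K.
have sH1 x : x \in HU -> HU :\ x :|: (x |: HD) \subset H.
  by move=> xU; rewrite setUCA setUA setD1K.
have sH2 x : HU :\ x :|: HD \subset H.
  by apply: subset_trans sH; rewrite setSU ?subD1set.
have dis2 x : [disjoint HU :\ x & HD] by apply: disjointWl dis; exact: subD1set.
have dis1 x : [disjoint HU :\ x & x |: HD].
  apply/pred0Pn => -[y]; rewrite !inE => /andP [/andP [ne yU]].
  by rewrite (negPf ne) (disjointFr dis yU).
have xR x : x \in HU -> x \notin R.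
  by move=> /(subsetP HUH); rewrite inE => /andP [].
have RH x : x \in R -> x \notin HU by move=> xr; apply/negP => /xR; rewrite xr.
have zx x : x \in HU -> z \notin [set x] by move=> xU; apply: contra zHU; rewrite inE => /eqP ->.
have zne x : x \in HU -> (z |: HU) :\ x = z |: HU :\ x.
  by move=> xU; rewrite setD1_setUr // inE; apply: contra zHU => /eqP <-.
have disHR r : [disjoint HU & R :\ r].
  by apply: disjointWl HUH _; apply: disjointWr (subD1set _ _) _; exact: disjoint_HR.
have goal_z X : goal (z |: S1) (z |: X) = dom S2 X.
  rewrite /goal dom_S2_z; apply/andb_idr => _; apply/hitsP; exists z; rewrite !inE eqxx //.
have val_z t1 : mb_val (goal (z |: S1)) HU (z |: HD) t1 = mb_val (dom S2) HU HD t1.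
  by apply/idP/idP; apply: val_le => X _; rewrite -setUA goal_z.
have val_nz t1 : mb_val (goal (z |: S1)) HU HD t1 = mb_val (goal S1) HU HD t1.
  by apply: val_win_eq => X XU; rewrite notS1 // subUset HDH (subset_trans XU).
have UE : dom U = dom (H :|: R) by rewrite setU_HR.
case: t'.
  apply/idP/idP.
    case/valD_elim => [[_ /eqP]|[x]].
      by rewrite setU_eq0 (negPf R_neq0) andbF.
    rewrite inE => /orP [xU|xr].
      rewrite setD1_setUl ?xR // IH ?sH1 ?dis1 // => v.
      by apply: (valD_intro (x := x)); rewrite ?zne // !inE xU orbT.
    rewrite setD1_setUr ?RH // => v; apply: (valD_intro (x := z)); rewrite ?zK ?inE ?eqxx //.
    rewrite val_z; apply: contraTT v => v.
    rewrite -[x |: HD]setUC; apply: (@val_sum_Staller _ H R _ _ _ _ _ (fun=> false)) v _;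
      rewrite ?disjoint_HR //; try exact: mono_dom.
    - by move=> A B AH BR; rewrite orbF; exact: dom_S2.
    - by apply/pred0Pn => -[y]; rewrite !inE andbC => /andP [/eqP ->]; rewrite eqxx.
    - by rewrite setUC setD1K.
    - by apply/negP => v'; move: (@val_hope _ xpred0 _ _ _ (fun _ _ _ => id) v').
  case/valD_elim => [[_ /setP /(_ z)]|[x]]; first by rewrite !inE eqxx.
  case: (eqVneq x z) => [-> _|ne].
    rewrite zK val_z => v; apply: (valD_intro (x := r0)); first by rewrite inE r0R orbT.
    rewrite setD1_setUr ?RH // setUC [X in mb_val _ X]setUC [r0 |: HD]setUC.
    apply: (@val_sum _ H R) v v0; rewrite ?disHR //; try exact: mono_dom.
    - move=> A B AH BR wA wB; apply: dom_U; rewrite ?wB //.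
      by have /domP /(_ z zR) [u uB _] := wB; apply/set0Pn; exists u.
    - by rewrite setUC setD1K.
  rewrite !inE (negPf ne) => /= xU; rewrite zne // -IH ?sH1 ?dis1 // => v.
  by apply: (valD_intro (x := x)); rewrite ?setD1_setUl ?xR // inE xU.
apply/idP/idP => v.
  apply: valS_intro => [/setP /(_ z)|x]; first by rewrite !inE eqxx.
  case: (eqVneq x z) => [-> _|ne].
    rewrite zK val_nz; have := valS_elim (x := r1) _ v; rewrite inE r1R orbT => /(_ isT).
    rewrite setD1_setUr ?RH //; apply: contraTT => v'.
    rewrite -[HD]setU0; apply: (@val_sum_Staller _ H R) v' v1;
      rewrite ?disjoint_HR ?disjoint_0 ?setU0 ?subD1set //; try exact: mono_dom; try exact: mono_goal.
    move=> A B AH BR w; rewrite /goal (dom_S2 BR w) /= orbC; exact: dom_R.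
  rewrite !inE (negPf ne) => /= xU; rewrite zne // -IH //.
  by rewrite -setD1_setUl ?xR //; apply: valS_elim v; rewrite inE xU.
apply: valS_intro => [/eqP|x].
  by rewrite setU_eq0 (negPf R_neq0) andbF.
rewrite inE => /orP [xU|xr].
  rewrite setD1_setUl ?xR // IH // -zne //; apply: valS_elim v.
  by rewrite !inE xU orbT.
have := valS_elim (x := z) _ v; rewrite inE inE eqxx zK val_nz => /(_ isT) v'.
rewrite setD1_setUr ?RH // -[HD]setU0; apply: (@val_sum _ H R _ _ _ _ _ (hits R)) v' _;
  rewrite ?disHR ?setU0 ?subD1set //; try exact: mono_goal; try exact: mono_hits.
  move=> A B AH BR /andP [wA hA] wB; apply: dom_U; rewrite ?hA ?orbT //.
  by case/hitsP: wB => u uB _; apply/set0Pn; exists u.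
apply: (val_hit (Y := R :\ x)); rewrite ?RD1 // => X; rewrite set0U => /set0Pn [y].
by rewrite !inE => /andP [yX /andP [_ yr]]; apply/hitsP; exists y.
Qed.

End Substitution.

(** With [z] taken in [R'], each of the three cases describes the games on both sets by the same
    expression: the outside is unchanged, and the outcomes decide which case applies. *)
Lemma out_subst U R R' t : module U R -> R' \subset R -> 1 < #|R'| ->
  (forall t', out R' t' = out R t') -> out ((U :\: R) :|: R') t = out U t.
Proof.
move=> mR R'R R'2 oR.
have /card_gt0P [z zR'] : 0 < #|R'| by lia.
have zR := subsetP R'R _ zR'.
have R2 : 1 < #|R| by apply: leq_trans R'2 _; exact: subset_leq_card.
set U' := _ :|: _.
have mR' : module U' R'.
  split; first exact: subsetUr.
  move=> x u v; rewrite !inE => /orP [/andP [xR xU]|->] // _ uR vR.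
  by case: mR => _ /(_ x u v xU xR) -> //; exact: (subsetP R'R).
have HE : U' :\: R' = U :\: R.
  apply/setP => x; rewrite !inE; case xR': (x \in R') => /=.
    by rewrite (subsetP R'R _ xR').
  by rewrite orbF.
case oF: (out R false).
  by rewrite (out_module0 mR zR t oF) (out_module0 mR' zR' t) ?oR // HE.
case oT: (out R true).
  by rewrite (out_module1 mR zR R2 t) ?oF // (out_module1 mR' zR' R'2 t) ?oR ?oF // /goal HE.
by rewrite (out_module2 mR zR R2 t) ?oT // (out_module2 mR' zR' R'2 t) ?oR ?oT // /goal HE.
Qed.

(** Staller would win by claiming [s], so Dominator has to claim it at once. *)
Lemma val_forced (win : {set T} -> bool) U D s : mono win -> s \in U -> ~~ win (D :|: U :\ s) ->
  mb_val win U D true -> mb_val win (U :\ s) (s |: D) false.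
Proof.
move=> mw sU nw /valD_elim [[_ U0]|[x xU v]]; first by rewrite U0 inE in sU.
case: (eqVneq s x) => [->|ne] //; case/negP: nw.
have sU' : s \in U :\ x by rewrite !inE ne.
have := val_hope mw (valS_elim sU' v).
by rewrite -setUA setUCA setD1AC setD1K // !inE eq_sym ne.
Qed.

(** * Interchangeable legs *)

Definition leaf R k s := [&& k \in R, s \in R, e k s & [forall w in R, e s w ==> (w == k)]].

(** Two pendant edges whose inner vertices have the same neighbours among the other vertices of [R];
    exchanging the edges is an automorphism of [R]. *)
Definition legs R k1 s1 k2 s2 :=
  [&& uniq [:: k1; s1; k2; s2], leaf R k1 s1, leaf R k2 s2 &
      [forall w in R, (w \notin [:: k1; s1; k2; s2]) ==> (e w k1 == e w k2)]].

Lemma leafP R k s : leaf R k s -> [/\ k \in R, s \in R, e k s & forall w, w \in R -> e s w -> w = k].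
Proof.
move=> /and4P [kR sR ks /forall_inP H]; split=> // w /H /implyP H' /H' /eqP //.
Qed.

(** Staller claims [k]. Only [s] can now dominate [s], so Dominator has to claim it, which helps
    with no vertex outside the leg, and Staller is on the move again. *)
Lemma out_leaf_step R k s U D : leaf R k s -> k \in U -> s \in U -> k \notin D -> s \notin D ->
  U \subset R -> D \subset R ->
  mb_val (dom R) U D false -> mb_val (dom (R :\ k :\ s)) (U :\ k :\ s) D false.
Proof.
move=> /leafP [kR sR ks sk] kU sU kD sD UR DR v.
have ne : s != k by apply: contraTneq ks => ->; rewrite eirr.
have sU' : s \in U :\ k by rewrite !inE ne.
have := val_forced (@mono_dom _) sU' _ (valS_elim kU v).
have -> : ~~ dom R (D :|: U :\ k :\ s).
  apply/negP => /domP /(_ s sR) [u]; rewrite !inE => H.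
  have uR : u \in R by case/orP: H => [/(subsetP DR)|/and3P [_ _ /(subsetP UR)]].
  case/orP => [/eqP us|us]; first by move: H; rewrite us (negPf sD) eqxx.
  by move: H; rewrite (sk u uR) ?(negPf kD) ?eqxx ?andbF // esym.
move=> /(_ isT); apply: val_le => X XU /domP W; apply/domP => w; rewrite !inE => /and3P [ws wk wR].
case: (W w wR) => u; rewrite !inE -orbA => /orP [/eqP ->|uDX] uw; last by exists u; rewrite // inE.
case/orP: uw => [/eqP E|sw]; first by rewrite E eqxx in ws.
by rewrite (sk w wR sw) eqxx in wk.
Qed.

Section Legs.
Variables (R : {set T}) (k1 s1 k2 s2 : T).
Hypothesis L : legs R k1 s1 k2 s2.

Definition swap_legs x :=
  if x == k1 then k2 else if x == k2 then k1 else
  if x == s1 then s2 else if x == s2 then s1 else x.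

Lemma swap_legsK : involutive swap_legs.
Proof.
case/and4P: L; rewrite /= !inE !negb_or => /and4P [/and3P [a1 a2 a3] /andP [a4 a5] a6 _] _ _ _ x.
rewrite /swap_legs.
case: (eqVneq x k1) => [->|n1]; first by rewrite eqxx eq_sym (negPf a2).
case: (eqVneq x k2) => [->|n2]; first by rewrite eqxx.
case: (eqVneq x s1) => [->|n3].
  by rewrite eq_sym (negPf a3) eq_sym (negPf a6) eq_sym (negPf a5) eqxx.
case: (eqVneq x s2) => [->|n4].
  by rewrite eq_sym (negPf a1) (negPf a4) eqxx.
by rewrite (negPf n1) (negPf n2) (negPf n3) (negPf n4).
Qed.

Lemma swap_legs_adj x y : x \in R -> y \in R -> e x y -> e (swap_legs x) (swap_legs y).
Proof.
case/and4P: L; rewrite /= !inE !negb_or => /and4P [/and3P [a1 a2 a3] /andP [a4 a5] a6 _].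
move=> /leafP [k1R s1R ks1 sk1] /leafP [k2R s2R ks2 sk2] /forall_inP H xR yR.
have H' w : w \in R -> w != k1 -> w != s1 -> w != k2 -> w != s2 -> e w k1 = e w k2.
  by move=> wR n1 n2 n3 n4; apply/eqP; have := H w wR; rewrite !inE !negb_or n1 n2 n3 n4.
have key u w : u \in R -> w \in R -> e u w -> u != s1 -> u != s2 -> w != s1 -> w != s2 ->
    e (swap_legs u) (swap_legs w).
  move=> uR wR; rewrite /swap_legs.
  case: (eqVneq u k1) => [->|n1]; case: (eqVneq w k1) => [->|m1];
  rewrite ?eirr //.
  - case: (eqVneq w k2) => [->|m2 H1 n3 n4 m3 m4]; first by rewrite esym.
    by rewrite (negPf m3) (negPf m4) esym -H' // esym.
  - case: (eqVneq u k2) => [->|n2 H1 n3 n4 m3 m4]; first by rewrite esym.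
    by rewrite (negPf n3) (negPf n4) -H'.
  case: (eqVneq u k2) => [->|n2]; case: (eqVneq w k2) => [->|m2]; rewrite ?eirr //.
  - move=> H1 n3 n4 m3 m4.
    by rewrite (negPf m3) (negPf m4) esym H' // esym.
  - move=> H1 n3 n4 m3 m4.
    by rewrite (negPf n3) (negPf n4) H'.
  by move=> H1 /negPf -> /negPf -> /negPf -> /negPf ->.
have S1 : swap_legs s1 = s2 by rewrite /swap_legs eq_sym (negPf a1) (negPf a4) eqxx.
have S2 : swap_legs s2 = s1 by rewrite -S1 swap_legsK.
have K1 : swap_legs k1 = k2 by rewrite /swap_legs eqxx.
have K2 : swap_legs k2 = k1 by rewrite -K1 swap_legsK.
move=> xy.
case: (eqVneq x s1) xy => [->|n1] xy; first by rewrite (sk1 y yR xy) S1 K1 esym.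
case: (eqVneq x s2) xy => [->|n2] xy; first by rewrite (sk2 y yR xy) S2 K2 esym.
case: (eqVneq y s1) xy => [->|m1] xy; first by rewrite esym in xy; rewrite (sk1 x xR xy) S1 K1.
case: (eqVneq y s2) xy => [->|m2] xy; first by rewrite esym in xy; rewrite (sk2 x xR xy) S2 K2.
exact: key.
Qed.

Lemma swap_legs_R x : x \in R -> swap_legs x \in R.
Proof.
case/and4P: L => _ /leafP [k1R s1R _ _] /leafP [k2R s2R _ _] _ xR.
by rewrite /swap_legs; do 4?case: ifP => // _.
Qed.

Lemma dom_swap_legs A X : A \subset R -> X \subset R ->
  dom A X = dom (swap_legs @: A) (swap_legs @: X).
Proof.
have half (B Y : {set T}) : B \subset R -> Y \subset R -> dom B Y -> dom (swap_legs @: B) (swap_legs @: Y).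
  move=> BR YR /domP W; apply/domP => _ /imsetP [v vB ->]; case: (W v vB) => u uY uv.
  exists (swap_legs u); first exact: imset_f.
  rewrite (inj_eq (inv_inj swap_legsK)); case/orP: uv => [->//|uv].
  by rewrite swap_legs_adj ?orbT //; [exact: (subsetP YR)|exact: (subsetP BR)].
have swapS (B : {set T}) : B \subset R -> swap_legs @: B \subset R.
  by move=> BR; apply/subsetP => _ /imsetP [v vB ->]; apply: swap_legs_R; exact: (subsetP BR).
have swapK (B : {set T}) : swap_legs @: (swap_legs @: B) = B.
  by rewrite -imset_comp -[RHS]imset_id; apply: eq_imset; exact: swap_legsK.
move=> AR XR; apply/idP/idP; first exact: half.
by move=> H; rewrite -[A]swapK -[X]swapK; apply: half => //; exact: swapS.
Qed.

(** From the smaller set to the larger one, Dominator pairs [k2] with [s2]. In the other direction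
    Staller forces the exchange of [out_leaf_step] on a leg that Dominator's opening move has not
    touched; if this is the first leg, the automorphism turns what remains into the set without the
    second. *)
Lemma out_legs t : out (R :\ k2 :\ s2) t = out R t.
Proof.
have lL := L; case/and4P: lL; rewrite /= !inE !negb_or.
move=> /and4P [/and3P [a1 a2 a3] /andP [a4 a5] a6 _] l1 l2 _.
have [k1R s1R ks1 sk1] := leafP l1; have [k2R s2R ks2 sk2] := leafP l2.
set R' := R :\ k2 :\ s2; have R'R : R' \subset R by rewrite !(subset_trans (subD1set _ _)) ?subD1set.
apply/idP/idP => [v|].
  have RE : R = R' :|: [set k2; s2].
    apply/setP => x; rewrite !inE; case: (eqVneq x s2) => [->|_]; first by rewrite s2R orbT.
    by case: (eqVneq x k2) => [->|_] /=; rewrite ?orbF.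
  rewrite /out [X in mb_val _ X]RE -[set0]setU0.
  apply: (@val_sum _ R' [set k2; s2] _ _ _ _ _ (hits [set k2; s2])) v _; rewrite ?setU0 //.
  - exact: mono_dom.
  - exact: mono_hits.
  - move=> A B AR BR /domP wA /hitsP [b bB]; rewrite !inE => bks.
    apply/domP => x; rewrite {1}RE inE => /orP [xR|].
      by case: (wA x xR) => u uA ux; exists u; rewrite // inE uA.
    rewrite !inE => xks; exists b; first by rewrite inE bB orbT.
    by case/orP: xks bks => /eqP -> /orP [] /eqP ->; rewrite ?eqxx ?ks2 ?orbT // esym ks2 orbT.
  - apply/pred0Pn => -[x]; rewrite !inE => /andP [/and3P [/negPf -> /negPf ->]] //.
  - apply: (val_hit (Y := [set k2; s2])); rewrite ?cards2 ?a6 // => X.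
    by rewrite set0U.
case: t; last first.
  by apply: out_leaf_step; rewrite ?inE ?sub0set.
have nin x (a b : T) : x \in R -> a != x -> b != x -> (a \notin x |: set0) * (b \notin x |: set0).
  by move=> _ n1 n2; rewrite !inE !orbF.
case/valD_elim => [[_ R0]|[x xR]]; first by rewrite R0 inE in k1R.
case/boolP: (x \in [set k2; s2]) => [xks|]; last first.
  rewrite !inE negb_or => /andP [n1 n2] v.
  have xR' : x \in R' by rewrite !inE n1 n2.
  apply: (valD_intro xR'); have -> : R' :\ x = R :\ x :\ k2 :\ s2.
    by rewrite /R' [X in _ = X :\ _]setD1AC [RHS]setD1AC.
  by apply: out_leaf_step v => //; rewrite ?inE ?orbF ?(eq_sym k2) ?(eq_sym s2) ?n1 ?n2 ?subD1set ?sub1set ?setU0 ?sub1set.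
have [n1 n2] : x != k1 /\ x != s1.
  by case/setU1P: xks => [->|/set1P ->]; split; rewrite // eq_sym.
move=> v; set R'' := R :\ k1 :\ s1.
have xR'' : x \in R'' by rewrite !inE n1 n2.
have v'' : out R'' true.
  apply: (valD_intro xR''); have -> : R'' :\ x = R :\ x :\ k1 :\ s1.
    by rewrite /R'' [X in _ = X :\ _]setD1AC [RHS]setD1AC.
  by apply: out_leaf_step v => //; rewrite ?inE ?orbF ?(eq_sym k1) ?(eq_sym s1) ?n1 ?n2 ?subD1set ?sub1set ?setU0 ?sub1set.
have R''R : R'' \subset R by rewrite !(subset_trans (subD1set _ _)) ?subD1set.
have pR : swap_legs @: R'' = R'.
  have pD (A : {set T}) x0 : swap_legs @: (A :\ x0) = (swap_legs @: A) :\ swap_legs x0.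
    apply/setP => y; rewrite !inE; apply/imsetP/andP => [[w]|[ne /imsetP [w wU E]]].
      by rewrite !inE => /andP [ne wU] ->; rewrite (inj_eq (inv_inj swap_legsK)) imset_f.
    by exists w; rewrite // !inE wU -(inj_eq (inv_inj swap_legsK)) -E ne.
  rewrite /R'' !pD.
  have -> : swap_legs k1 = k2 by rewrite /swap_legs eqxx.
  have -> : swap_legs s1 = s2 by rewrite /swap_legs eq_sym (negPf a1) (negPf a4) eqxx.
  congr (_ :\ _ :\ _); apply/setP => y; apply/imsetP/idP => [[w wR ->]|yR].
    exact: swap_legs_R.
  by exists (swap_legs y); rewrite ?swap_legsK ?swap_legs_R.
rewrite /out -pR -[set0](imset0 swap_legs).
rewrite -(@val_iso _ swap_legs (dom R'')) //; first exact: (inv_inj swap_legsK).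
by move=> X; rewrite set0U => XR; apply: dom_swap_legs => //; exact: subset_trans R''R.
Qed.

End Legs.

(** * Modules won by Dominator, and the outcomes realised by two or three vertices *)

Definition nearly_universal R k s :=
  [&& k \in R, s \in R, s != k, [forall w in R, (w != s) ==> ((w == k) || e k w)],
      ~~ e k s & 1 < #|[set w in R | e s w]|].

(** Staller, moving first, leaves one of [k1] and [k2] free, and Dominator claims it. Only the one
    vertex it misses is still undominated; its closed neighbourhood had three vertices, and two of
    them are still free. *)
Lemma out_nearly_universal R k1 s1 k2 s2 t : k1 != k2 ->
  nearly_universal R k1 s1 -> nearly_universal R k2 s2 -> out R t.
Proof.
move=> ne N1 N2; apply: val_turn; first exact: mono_dom.
apply: valS_intro => [R0|x xR]; first by case/andP: N1; rewrite R0 inE.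
have [k [s [nx]]] : exists k s, x != k /\ nearly_universal R k s.
  case: (eqVneq x k1) => [->|nx]; first by exists k2, s2.
  by exists k1, s1.
case/and5P => kR sR sk /forall_inP H /andP [ks deg].
have kx : k \in R :\ x by rewrite !inE eq_sym nx.
apply: (valD_intro kx).
apply: (val_hit (Y := (s |: [set w in R | e s w]) :\ x)).
- apply/subsetP => y; rewrite !inE => /andP [-> yy] /=.
  case/orP: yy => [/eqP ->|/andP [-> sy]]; first by rewrite sk sR.
  by rewrite andbT; apply: contraNneq ks => <-; rewrite esym.
- have := cardsU1 s [set w in R | e s w]; rewrite !inE eirr andbF /=.
  have := cardsD1 x (s |: [set w in R | e s w]); case: (x \in _) => /=; lia.
move=> X /set0Pn [y]; rewrite !inE => /andP [yX /andP [_ ysw]].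
apply/domP => w wR; case: (eqVneq w s) => [->|nw].
  exists y; first by rewrite inE yX orbT.
  by case/orP: ysw => [->//|/andP [_]]; rewrite esym => ->; rewrite orbT.
exists k; first by rewrite !inE eqxx.
by have := H w wR; rewrite nw /= eq_sym.
Qed.

Lemma out_edgeless R t : 1 < #|R| -> (forall u v, u \in R -> v \in R -> ~~ e u v) -> out R t = false.
Proof.
move=> R2 H; apply/negP => v0; have {v0} : out R true.
  by case: t v0 => //; apply: val_extra; exact: mono_dom.
case/valD_elim => [[_ R0]|[x xR v]]; first by rewrite R0 cards0 in R2.
have /card_gt0P [y yR] : 0 < #|R :\ x| by move: R2; rewrite (cardsD1 x R) xR; lia.
have yR' : y \in R by case/setD1P: yR.
have := val_hope (@mono_dom _) (valS_elim yR v) => /domP /(_ y yR') [u].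
rewrite !inE orbF => H1 /orP [/eqP uy|uy].
  by move: H1 yR; rewrite uy !inE eqxx /= orbF => ->.
have uR : u \in R by case/orP: H1 => [/eqP ->|/and3P []].
by move: (H u y uR yR'); rewrite uy.
Qed.

Lemma out_complete R t : 1 < #|R| -> (forall u v, u \in R -> v \in R -> u != v -> e u v) -> out R t.
Proof.
move=> R2 H; apply: val_turn; first exact: mono_dom.
apply: (val_hit (Y := R)) => // X /set0Pn [x]; rewrite inE => /andP [xX xR].
apply/domP => w wR; exists x; first by rewrite inE xX orbT.
by case: eqVneq => //= ne; exact: H.
Qed.

(** The graph is a path with centre [v], or an edge and the isolated vertex [w]. Whoever moves first
    wins by claiming [v] or [w], respectively. *)
Lemma out_mixed u v w : e u v -> ~~ e u w -> u != w ->
  out [set u; v; w] true /\ ~~ out [set u; v; w] false.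
Proof.
move=> uv uw nuw.
have nuv : u != v by apply: contraTneq uv => ->; rewrite eirr.
have nvw : v != w by apply: contraTneq uv => ->.
have vu : e v u by rewrite esym.
have wu : ~~ e w u by rewrite esym.
case vw: (e v w); split.
- apply: (valD_intro (x := v)); first by rewrite !inE eqxx orbT.
  apply: val_sure => X _; apply/domP => y; rewrite !inE => H.
  by exists v; rewrite ?inE ?eqxx //; case/orP: H => [/orP [] /eqP ->|/eqP ->]; rewrite ?vu ?vw ?eqxx ?orbT.
- apply/negP => H; have vU : v \in [set u; v; w] by rewrite !inE eqxx orbT.
  have := valS_elim vU H; have -> : [set u; v; w] :\ v = [set u; w].
    apply/setP => y; rewrite !inE; case: (eqVneq y v) => [->|] //=; last by rewrite orbF.
    by rewrite eq_sym (negPf nuv) (negPf nvw).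
  have dv X : dom [set u; v; w] X -> dom [set u; w] X.
    by move=> /domP W; apply/domP => y; rewrite !inE => yuw; apply: W; rewrite !inE; case/orP: yuw => ->; rewrite ?orbT.
  move=> /(val_le (win' := dom [set u; w]) (D' := set0) (fun X _ => @dv _)).
  by rewrite -/(out _ _) out_pair // (negPf uw).
- apply: (valD_intro (x := w)); first by rewrite !inE eqxx !orbT.
  apply: (val_hit (Y := [set u; v])); rewrite ?cards2 ?nuv //.
    by apply/subsetP => y; rewrite !inE => /orP [] /eqP ->; rewrite ?nuw ?nvw ?eqxx ?orbT.
  move=> X /set0Pn [y]; rewrite !inE => /andP [yX yuv]; apply/domP => x; rewrite !inE.
  case/orP => [xuv|/eqP ->]; last by exists w; rewrite ?inE ?eqxx.
  exists y; first by rewrite inE yX orbT.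
  by case/orP: xuv yuv => /eqP -> /orP [] /eqP ->; rewrite ?eqxx ?uv ?vu ?orbT.
- apply/negP => H; have wU : w \in [set u; v; w] by rewrite !inE eqxx orbT.
  have := val_hope (@mono_dom _) (valS_elim wU H) => /domP /(_ w wU) [y].
  rewrite !inE /=; case: (eqVneq y w) => //= _.
  by rewrite ?orbF => /orP [] /eqP ->; rewrite ?(negPf uw) ?vw.
Qed.

(** Either [a] has a non-neighbour, or [a] is universal, and then [c] has the neighbour [a] and the
    non-neighbour [d]. *)
Lemma mixed_vertex R a b c d : a \in R -> b \in R -> c \in R -> d \in R ->
  e a b -> c != d -> ~~ e c d ->
  exists u v w, [/\ u \in R, v \in R & w \in R] /\ [/\ e u v, ~~ e u w & u != w].
Proof.
move=> aR bR cR dR ab ncd cd.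
case: (boolP [exists w in R, ~~ e a w && (a != w)]) => [/exists_inP [w wR /andP [aw nw]]|].
  by exists a, b, w.
rewrite negb_exists => /forallP H.
have full w : w \in R -> a != w -> e a w.
  by move=> wR nw; have := H w; rewrite wR nw andbT negbK.
have nac : a != c by apply: contraNneq cd => E; rewrite -E; apply: full => //; rewrite E.
by exists c, a, d; split; split=> //; rewrite esym full.
Qed.

(** An edge represents the outcomes won both ways, a non-edge those lost both ways (with [w] = [v]).
    If the first player decides, [R] is neither complete nor edgeless, and a mixed triple will
    do. *)
Lemma out_three R : 1 < #|R| -> exists u v w,
  [/\ u \in R, v \in R, w \in R, u != v & forall t, out [set u; v; w] t = out R t].
Proof.
move=> R2.
have edge_or : (exists u v, [/\ u \in R, v \in R & e u v]) \/
    forall u v, u \in R -> v \in R -> ~~ e u v.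
  case: (boolP [exists u in R, [exists v in R, e u v]]) => [/exists_inP [u uR /exists_inP [v vR uv]]|].
    by left; exists u, v.
  rewrite negb_exists => /forallP H; right => u v uR vR; have := H u.
  by rewrite uR negb_exists => /forallP /(_ v); rewrite vR.
have nonedge_or : (exists u v, [/\ u \in R, v \in R, u != v & ~~ e u v]) \/
    forall u v, u \in R -> v \in R -> u != v -> e u v.
  case: (boolP [exists u in R, [exists v in R, (u != v) && ~~ e u v]]) => [/exists_inP [u uR /exists_inP [v vR /andP [ne uv]]]|].
    by left; exists u, v.
  rewrite negb_exists => /forallP H; right => u v uR vR ne; have := H u.
  by rewrite uR negb_exists => /forallP /(_ v); rewrite vR ne negbK.
have pairE u v t : u != v -> out [set u; v; v] t = e u v.
  by move=> ne; rewrite -(out_pair t ne) -setUA setUid.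
have ext t : out R false -> out R t by apply: val_turn; exact: mono_dom.
case oF: (out R false).
  case: edge_or => [[u [v [uR vR uv]]]|H]; last by rewrite out_edgeless in oF.
  have ne : u != v by apply: contraTneq uv => ->; rewrite eirr.
  by exists u, v, v; split=> // t; rewrite pairE // uv ext.
case oT: (out R true); last first.
  case: nonedge_or => [[u [v [uR vR ne uv]]]|H]; last by rewrite out_complete in oT.
  by exists u, v, v; split=> // t; rewrite pairE // (negPf uv); case: t.
case: edge_or => [[a [b [aR bR ab]]]|H]; last by rewrite out_edgeless in oT.
case: nonedge_or => [[c [d [cR dR ncd cd]]]|H]; last by rewrite out_complete in oF.
have [u [v [w [[uR vR wR] [uv uw nuw]]]]] := mixed_vertex aR bR cR dR ab ncd cd.
have nuv : u != v by apply: contraTneq uv => ->; rewrite eirr.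
have [o1 o2] := out_mixed uv uw nuw.
by exists u, v, w; split=> // -[]; rewrite ?o1 ?oT // (negPf o2).
Qed.

End Domination.

(** * From outcomes to strategies *)

Section Strategies.
Variables (T : finType) (e : rel T) (F : player).
Implicit Types (h s : seq T).

Lemma dominatingE D : dominating e D = dom e setT D.
Proof.
apply/forallP/forall_inP => H v; last first.
  case/exists_inP: (H v (in_setT v)) => u uD /orP [/eqP <-|uv]; first by rewrite uD.
  by apply/orP; right; apply/exists_inP; exists u.
move=> _; apply/exists_inP; case/orP: (H v) => [vD|/exists_inP [u uD uv]].
  by exists v; rewrite // eqxx.
by exists u; rewrite // uv orbT.
Qed.

Lemma winnerE s : winner e F s = if dominating e (claimed F Dominator s) then Dominator else Staller.
Proof.
rewrite /winner; congr (if _ then _ else _); apply/existsP/idP => [[D /andP [DC dD]]|H].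
  by move: dD; rewrite !dominatingE; apply: mono_dom.
by exists (claimed F Dominator s); rewrite subxx.
Qed.

Lemma moverS k : mover F k.+1 = opponent (mover F k).
Proof. by rewrite /mover /=; case: (odd k) F => -[]. Qed.

Lemma claimed_rcons P h v : v \notin h ->
  claimed F P (rcons h v) = if mover F (size h) == P then v |: claimed F P h else claimed F P h.
Proof.
move=> vh; apply/setP => x; rewrite inE -cats1 mem_cat mem_seq1 index_cat.
case: (eqVneq x v) => [->|ne].
  rewrite (negPf vh) /= eqxx addn0; case: ifP => H; rewrite ?inE ?eqxx //.
  by rewrite (negPf vh).
rewrite orbF; case: ifP => xh; case: ifP => _; rewrite !inE ?(negPf ne) xh //=.
Qed.

Definition pos_val h :=
  mb_val (dom e setT) (~: [set x in h]) (claimed F Dominator h) (mover F (size h) == Dominator).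

Lemma unclaimed_rcons h v : ~: [set x in rcons h v] = ~: [set x in h] :\ v.
Proof. by apply/setP => x; rewrite !inE mem_rcons inE negb_or. Qed.

Lemma pos_val_rcons h v : v \notin h -> pos_val (rcons h v) =
  if mover F (size h) == Dominator
  then mb_val (dom e setT) (~: [set x in h] :\ v) (v |: claimed F Dominator h) false
  else mb_val (dom e setT) (~: [set x in h] :\ v) (claimed F Dominator h) true.
Proof.
move=> vh; rewrite /pos_val size_rcons moverS unclaimed_rcons claimed_rcons //.
by case: (mover F (size h)).
Qed.

Lemma unclaimed_neq0 h : size h < #|T| -> ~: [set x in h] != set0.
Proof.
move=> lt; apply: contraTneq lt => /(congr1 (@setC _)); rewrite setCK setC0 => E.
rewrite -leqNgt -cardsT -E; apply: leq_trans (card_size h).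
by apply: subset_leq_card; apply/subsetP => x; rewrite inE.
Qed.

Variable P : player.

Definition winning h := pos_val h == (P == Dominator).

Lemma winning_mover h : size h < #|T| -> mover F (size h) = P -> winning h ->
  exists2 v, v \notin h & winning (rcons h v).
Proof.
move=> /unclaimed_neq0 U0 mP; rewrite {1}/winning /pos_val mP.
case: (P =P Dominator) => [PD|nP].
  rewrite valD // => /eqP /existsP [v]; rewrite !inE => /andP [vh H].
  by exists v => //; rewrite /winning pos_val_rcons // mP PD /= H.
rewrite valS // eqbF_neg negb_forall => /existsP [v].
rewrite !inE negb_imply => /andP [vh H]; exists v => //.
have PS : P = Staller by case: (P) nP.
by rewrite /winning pos_val_rcons // mP PS /= eqbF_neg.
Qed.

Lemma winning_opponent h v : v \notin h -> mover F (size h) <> P -> winning h -> winning (rcons h v).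
Proof.
move=> vh mP; have vU : v \in ~: [set x in h] by rewrite !inE.
have U0 : ~: [set x in h] != set0 by apply/set0Pn; exists v.
rewrite /winning pos_val_rcons // /pos_val; move: mP; case: (mover F (size h)); case: (P) => //= _.
  by rewrite valD // !eqbF_neg negb_exists => /forallP /(_ v); rewrite vU.
by move=> /eqP /(valS_elim vU) ->.
Qed.

(** The fallback to an arbitrary free vertex makes the strategy legal in lost positions as well. *)
Definition best_strategy : strategy T := fun h =>
  if [pick v | (v \notin h) && winning (rcons h v)] is Some v then Some v else [pick v | v \notin h].

Lemma best_strategy_legal : legal_strategy F P best_strategy.
Proof.
move=> h _ /unclaimed_neq0 /set0Pn [v]; rewrite !inE => vh _; rewrite /best_strategy.
case: pickP => [w /andP [wh _]|_]; first by exists w.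
by case: pickP => [w wh|/(_ v)]; [exists w|rewrite vh].
Qed.

Lemma best_strategy_wins : winning [::] ->
  forall s, complete_play s -> follows F P best_strategy s -> winner e F s = P.
Proof.
move=> g0 s /andP [us /eqP ss] fs.
have gk k : k <= size s -> winning (take k s).
  elim: k => [|k IH] lek; first by rewrite take0.
  have {IH} gk := IH (ltnW lek).
  have sk : size (take k s) = k by rewrite size_takel // ltnW.
  have [x0 _] : exists x0 : T, true by case: (s) lek => // x ? _; exists x.
  have nx : nth x0 s k \notin take k s.
    by move: us; rewrite -{1}(cat_take_drop k s) cat_uniq (drop_nth x0) //= negb_or => /and3P [_ /andP []].
  rewrite (take_nth x0) //.
  have [mP|/eqP mP] := eqVneq (mover F k) P; last by apply: winning_opponent; rewrite ?sk.
  have := fs k lek mP; rewrite (onthE s k) => E.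
  have {E} E : Some (nth x0 s k) = best_strategy (take k s).
    by rewrite -E (nth_map x0).
  move: E; rewrite /best_strategy; case: pickP => [w /andP [_ gw] [->] //|H].
  case: (@winning_mover (take k s)) => //; rewrite ?sk ?(leq_trans lek) ?ss //.
  by move=> v vk gv; have := H v; rewrite vk gv.
have := gk (size s) (leqnn _); rewrite take_size /winning /pos_val.
have -> : ~: [set x in s] = set0.
  apply/eqP; rewrite -cards_eq0 -(eqn_add2l #|[set x in s]|) cardsC addn0.
  by rewrite cardsE (card_uniqP us) ss.
by rewrite val0 winnerE dominatingE; case: (dom _ _ _); case: (P).
Qed.

End Strategies.

Lemma claimed_nil (T : finType) F P : claimed F P ([::] : seq T) = set0.
Proof. by apply/setP => x; rewrite !inE in_nil. Qed.

(** Determinacy: the player named by the value wins by staying in winning positions. *)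
Lemma outcome_strategy (T : finType) (e : rel T) F :
  has_winning_strategy e F
    (if out e setT (is_dominator F) then Dominator else Staller).
Proof.
set P := if _ then _ else _; exists (best_strategy e F P); split.
  exact: best_strategy_legal.
apply: best_strategy_wins; rewrite /winning /pos_val claimed_nil.
have -> : ~: [set x in ([::] : seq T)] = setT by apply/setP => x; rewrite !inE in_nil.
rewrite /P /out; have -> : (mover F (size ([::] : seq T)) == Dominator) = is_dominator F.
  by rewrite /mover /=; case: (F).
by case: (mb_val _ _ _ _).
Qed.

(** * Graphs with few P4s *)

Section Paths.
Variables (T : finType) (e : rel T).
Hypotheses (esym : symmetric e) (eirr : irreflexive e).
Implicit Types (R S X A : {set T}).

Definition path4 a b c d := [&& e a b, e b c, e c d, ~~ e a c, ~~ e b d & ~~ e a d].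

Lemma path4_uniq a b c d : path4 a b c d -> uniq [:: a; b; c; d].
Proof.
case/and5P => ab bc cd ac /andP [bd ad]; rewrite /= !inE !negb_or !andbT.
apply/and3P; split; [apply/and3P; split| apply/andP; split |].
- by apply: contraTneq ab => ->; rewrite eirr.
- by apply: contraNneq ad => ->.
- by apply: contraNneq bd => <-; rewrite esym.
- by apply: contraTneq bc => ->; rewrite eirr.
- by apply: contraNneq ad => <-.
- by apply: contraTneq cd => ->; rewrite eirr.
Qed.

Lemma path4_induces a b c d : path4 a b c d -> induces_P4 e [set a; b; c; d].
Proof.
move=> p; have := path4_uniq p; case/and5P: (p) => ab bc cd ac /andP [bd ad] U.
apply/andP; split.
  have -> : [set a; b; c; d] = [set x in [:: a; b; c; d]] by apply/setP => x; rewrite !inE -!orbA.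
  by rewrite cardsE (card_uniqP U).
apply/existsP; exists a; apply/existsP; exists b; apply/existsP; exists c; apply/existsP; exists d.
by rewrite eqxx ab bc cd ac bd ad.
Qed.

Lemma induces_path4 A : induces_P4 e A ->
  exists a b c d, A = [set a; b; c; d] /\ path4 a b c d.
Proof.
case/andP => _ /existsP [a /existsP [b /existsP [c /existsP [d /andP [/eqP AE p]]]]].
by exists a, b, c, d.
Qed.

Lemma num_P4_family S (L : {set {set T}}) :
  (forall A, A \in L -> A \subset S /\ induces_P4 e A) -> #|L| <= num_P4 e S.
Proof.
move=> H; apply: subset_leq_card; apply/subsetP => A /H [AS p].
by rewrite inE AS.
Qed.

Lemma num_P4_grow S S' (L : {set {set T}}) : S \subset S' ->
  (forall A, A \in L -> [/\ A \subset S', induces_P4 e A & ~~ (A \subset S)]) ->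
  num_P4 e S + #|L| <= num_P4 e S'.
Proof.
move=> SS H; set P := [set A : {set T} | (A \subset S) && induces_P4 e A].
have -> : num_P4 e S = #|P| by [].
have d : [disjoint P & L].
  by apply/pred0Pn => -[A /andP [/=]]; rewrite inE => /andP [AS _] /H [_ _]; rewrite AS.
rewrite -cardsUI; move: d; rewrite -setI_eq0 => /eqP ->; rewrite cards0 addn0.
apply: num_P4_family => A; rewrite !inE => /orP [/andP [AS p]|/H [AS p _]] //.
by split=> //; apply: subset_trans SS.
Qed.

(** The P4s of an explicit configuration are given by lists of indices into a duplicate-free list of
    vertices. That they are well formed and have distinct vertex sets is then decided by
    computation; sorting gives the normal form of a set of indices. *)
Lemma num_P4_index (vs : seq T) (L : seq (seq nat)) x0 : uniq vs ->
  all (fun l => [&& size l == 4, uniq l & all (fun i => i < size vs) l]) L ->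
  uniq [seq sort leq l | l <- L] ->
  all (fun l => path4 (nth x0 vs (nth 0 l 0)) (nth x0 vs (nth 0 l 1))
                      (nth x0 vs (nth 0 l 2)) (nth x0 vs (nth 0 l 3))) L ->
  size L <= #|[set A in [seq [set x in [seq nth x0 vs i | i <- l]] | l <- L]]| /\
  forall A, A \in [set A in [seq [set x in [seq nth x0 vs i | i <- l]] | l <- L]] ->
    induces_P4 e A.
Proof.
move=> U /allP wf uL /allP pL; split; last first.
  move=> A; rewrite inE => /mapP [l lL ->].
  have [i [j [k [m lE]]]] : exists i j k m, l = [:: i; j; k; m].
    case/and3P: (wf l lL) => /eqP; clear; case: l => [|i [|j [|k [|m [|? ?]]]]] // _ _ _.
    by exists i, j, k, m.
  have := path4_induces (pL l lL); rewrite lE; set A1 := [set _; _; _; _]; set A2 := [set _ in _].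
  suff -> : A2 = A1 by [].
  by apply/setP => x; rewrite !inE -!orbA.
rewrite cardsE (card_uniqP _) ?size_map // map_inj_in_uniq; first by move/map_uniq: uL.
move=> l l' lL lL' /setP E.
have : sort leq l = sort leq l' -> l = l'.
  move=> S; have /uniqP := uL => /(_ [::]).
  have [i Hi Ei] := nthP [::] lL; have [j Hj Ej] := nthP [::] lL'.
  move=> /(_ i j); rewrite !inE size_map => /(_ Hi Hj).
  rewrite !(nth_map [::]) // Ei Ej => /(_ S) ij.
  by rewrite -Ei -Ej ij.
apply; apply/perm_sortP; [exact: leq_total|exact: leq_trans|exact: anti_leq|].
case/and3P: (wf l lL) => _ ul /allP bl; case/and3P: (wf l' lL') => _ ul' /allP bl'.
apply: uniq_perm => // i.
have sub (l1 l2 : seq nat) : (forall i, i \in l1 -> i < size vs) -> (forall i, i \in l2 -> i < size vs) ->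
    (forall x, x \in [seq nth x0 vs i | i <- l1] -> x \in [seq nth x0 vs i | i <- l2]) -> {subset l1 <= l2}.
  move=> b1 b2 H j jl; have /mapP [k kl] := H _ (map_f _ jl).
  by move/eqP; rewrite (nth_uniq _ (b1 _ jl) (b2 _ kl) U) => /eqP ->.
by apply/idP/idP; apply: sub => // x xl; have := E x; rewrite !inE xl => // <-.
Qed.

(* X = N(x) has this property when x creates no new P4 with vertices of S.  If S
   is rigid, X is then determined by the adjacency of x to the two vertices a0
   and b0, so that there are at most three possibilities for it. *)
Definition sep S X := X \subset S /\
  forall a b c d, path4 a b c d -> [set a; b; c; d] \subset S ->
    [/\ (b \in X) = (c \in X), (a \in X) = (d \in X) & a \in X -> b \in X].

Definition rigid a0 b0 S := forall X X', sep S X -> sep S X' ->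
  (a0 \in X) = (a0 \in X') -> (b0 \in X) = (b0 \in X') -> X = X'.

Lemma sub4 (a b c d : T) S : ([set a; b; c; d] \subset S) = [&& a \in S, b \in S, c \in S & d \in S].
Proof. by rewrite !subUset !sub1set -!andbA. Qed.

Lemma sep_sub S S' X : S' \subset S -> sep S X -> sep S' (X :&: S').
Proof.
move=> SS [XS H]; split; first exact: subsetIr.
move=> a b c d p abcd; have := H _ _ _ _ p (subset_trans abcd SS).
by move: abcd; rewrite sub4 !inE => /and4P [-> -> -> ->]; rewrite !andbT.
Qed.

Lemma rigid_path4 a b c d : path4 a b c d -> rigid a b [set a; b; c; d].
Proof.
move=> p X X' [XS H] [XS' H'] Ea Eb.
have [E1 E2 _] := H _ _ _ _ p (subxx _); have [E3 E4 _] := H' _ _ _ _ p (subxx _).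
apply/setP => x; apply/idP/idP => xX.
  by have := subsetP XS x xX; rewrite !inE -!orbA => /or4P [] /eqP E; move: xX; rewrite E; congruence.
by have := subsetP XS' x xX; rewrite !inE -!orbA => /or4P [] /eqP E; move: xX; rewrite E; congruence.
Qed.

Lemma rigid_ext a0 b0 S S' : a0 \in S -> b0 \in S -> rigid a0 b0 S -> S \subset S' ->
  (forall x, x \in S' -> x \notin S -> exists2 y, y \in S &
     forall X, sep S' X -> (x \in X) = (y \in X)) ->
  rigid a0 b0 S'.
Proof.
move=> aS bS rS SS H X X' sX sX' Ea Eb.
have E : X :&: S = X' :&: S.
  by apply: rS; [exact: sep_sub sX|exact: sep_sub sX'| |]; rewrite !inE ?aS ?bS ?Ea ?Eb.
have ES y : y \in S -> (y \in X) = (y \in X').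
  by move=> yS; have := congr1 (fun Z : {set T} => y \in Z) E; rewrite !inE yS !andbT.
apply/setP => x; case: (boolP (x \in S')) => [xS'|nx]; last first.
  have /negPf -> : x \notin X by apply: contra nx; case: sX => /subsetP XS _; exact: XS.
  by symmetry; apply/negbTE; apply: contra nx; case: sX' => /subsetP XS _; exact: XS.
case: (boolP (x \in S)) => [|nx]; first exact: ES.
by have [y yS Hy] := H x xS' nx; rewrite !Hy // ES.
Qed.

Definition ext1 S x := [exists A : {set T}, [&& induces_P4 e A, x \in A & A \subset x |: S]].

Lemma ext1_intro S x a b c d : path4 a b c d -> x \in [set a; b; c; d] ->
  [set a; b; c; d] \subset x |: S -> ext1 S x.
Proof.
by move=> p xp pS; apply/existsP; exists [set a; b; c; d]; rewrite path4_induces // xp.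
Qed.

Lemma ext1_sub S S' x : S \subset S' -> ext1 S x -> ext1 S' x.
Proof.
move=> SS /existsP [A /and3P [p xA AS]]; apply/existsP; exists A; rewrite p xA /=.
by apply: subset_trans AS _; exact: setUS.
Qed.

Lemma ext1_num S x : x \notin S -> ext1 S x -> num_P4 e S < num_P4 e (x |: S).
Proof.
move=> xS /existsP [A /and3P [p xA AS]].
have := @num_P4_grow S (x |: S) [set A] (subsetUr _ _); rewrite cards1 addn1; apply.
move=> B; rewrite inE => /eqP ->; split=> //.
by apply: contra xS => /subsetP; apply.
Qed.

(** A separating set does not distinguish the two midpoints of the new P4, nor its two ends; so [x]
    goes with its partner, which lies in [S]. *)
Lemma ext1_rigid a0 b0 S x : a0 \in S -> b0 \in S -> x \notin S -> ext1 S x ->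
  rigid a0 b0 S -> rigid a0 b0 (x |: S).
Proof.
move=> aS bS xS /existsP [_ /and3P [/induces_path4 [a [b [c [d [-> p]]]]] xA AS]] rS.
apply: (rigid_ext aS bS rS (subsetUr _ _)) => y; rewrite inE => /orP [/set1P ->|->] // _.
have := path4_uniq p; rewrite /= !inE !negb_or => /and4P [/and3P [ab ac ad] /andP [bc bd] cd _].
have inS z : z \in [set a; b; c; d] -> z != x -> z \in S.
  by move=> zA nz; move: (subsetP AS z zA); rewrite !inE (negPf nz).
move: xA; rewrite !inE -!orbA => /or4P [] /eqP E; move: inS; rewrite E => inS.
- exists d; first by apply: inS; rewrite ?inE ?eqxx ?orbT // eq_sym.
  by move=> X [_ /(_ _ _ _ _ p)]; rewrite -{2}E => /(_ AS) [].
- exists c; first by apply: inS; rewrite ?inE ?eqxx ?orbT // eq_sym.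
  by move=> X [_ /(_ _ _ _ _ p)]; rewrite -{2}E => /(_ AS) [].
- exists b; first by apply: inS; rewrite ?inE ?eqxx ?orbT // eq_sym.
  by move=> X [_ /(_ _ _ _ _ p)]; rewrite -{2}E => /(_ AS) [].
- exists a; first by apply: inS; rewrite ?inE ?eqxx ?orbT // eq_sym.
  by move=> X [_ /(_ _ _ _ _ p)]; rewrite -{2}E => /(_ AS) [].
Qed.

(** Of the 16 possible neighbourhoods of [x] on the path, all but three create a P4: the empty one,
    the two midpoints and the whole path. *)
Lemma ext1_adj a b c d x S : path4 a b c d -> [set a; b; c; d] \subset S -> ~~ ext1 S x ->
  [/\ e x b = e x c, e x a = e x d & e x a -> e x b].
Proof.
move=> p; rewrite sub4 => /and4P [aS bS cS dS] nx.
have no u v w : path4 x u v w -> u \in S -> v \in S -> w \in S -> False.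
  move=> p' uS vS wS; case/negP: nx; apply: (ext1_intro p'); first by rewrite !inE eqxx.
  by rewrite sub4 !inE uS vS wS eqxx !orbT.
have no' u v w : path4 u x v w -> u \in S -> v \in S -> w \in S -> False.
  move=> p' uS vS wS; case/negP: nx; apply: (ext1_intro p'); first by rewrite !inE eqxx ?orbT.
  by rewrite sub4 !inE uS vS wS eqxx !orbT.
case/and5P: p => ab bc cd ac /andP [bd ad].
have ba : e b a by rewrite esym. have cb : e c b by rewrite esym.
have dc : e d c by rewrite esym. have ca : ~~ e c a by rewrite esym.
have db : ~~ e d b by rewrite esym. have da : ~~ e d a by rewrite esym.
have n1 := no a b c; have n2 := no d c b; have n3 := no b c d; have n4 := no c b a.
have n5 := no' a c d; have n6 := no' d b a.
have n7 := no' a d c; have n8 := no' d a b.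
move: n1 n2 n3 n4 n5 n6 n7 n8; rewrite /path4 !(esym _ x).
rewrite ab ba bc cb cd dc (negPf ac) (negPf ca) (negPf bd) (negPf db) (negPf ad) (negPf da).
rewrite aS bS cS dS.
case: (e x a); case: (e x b); case: (e x c); case: (e x d) => //= *; exfalso; auto.
Qed.

Lemma ext1_sep S x : ~~ ext1 S x -> sep S [set u in S | e x u].
Proof.
move=> nx; split; first by apply/subsetP => u; rewrite inE => /andP [].
move=> a b c d p abcd; have [E1 E2 E3] := ext1_adj p abcd nx.
by move: abcd; rewrite sub4 !inE => /and4P [-> -> -> ->] /=.
Qed.

End Paths.

(** * Extending a P4 inside a minimal module *)

Section Growth.
Variables (T : finType) (e : rel T).
Hypotheses (esym : symmetric e) (eirr : irreflexive e).
Variables (R : {set T}) (q : nat).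
Hypothesis few : forall S : {set T}, #|S| <= q -> num_P4 e S + 4 <= q.
Hypothesis minimal : forall M, module e R M -> 3 < #|M| -> M = R.
Implicit Types (S X M : {set T}).

Section Base.
Variables (a0 b0 c0 d0 : T).
Hypotheses (p0 : path4 e a0 b0 c0 d0) (pR : [set a0; b0; c0; d0] \subset R).
Let Q0 := [set a0; b0; c0; d0].

(** The deficit [k] is 3 for a single P4, and 2 for the eight vertices with six P4s from which
    [spider_big] restarts. With [few] it gives |S| <= q - 4 + k. *)
Definition good k S := [/\ Q0 \subset S, S \subset R, rigid e a0 b0 S,
  #|S| <= q & #|S| <= num_P4 e S + k].

Definition closed1 S := forall x, x \in R -> x \notin S -> ~~ ext1 e S x.

(** If [x] creates no P4 with vertices of a rigid [S], these two adjacencies determine its whole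
    neighbourhood in [S]. *)
Definition partial x := e x b0 && ~~ e x a0.

(* If S is closed1, the pair creates two new P4s, although neither vertex alone creates any. *)
Definition badpair S x y := [&& x \in R, x \notin S, y \in R, y \notin S, partial y &
  (~~ e x b0 && e x y) || (e x a0 && ~~ e x y)].

Lemma good_size k S : good k S -> #|S| + 4 <= q + k.
Proof. by case=> _ _ _ /few H1 H2; clear -H1 H2; lia. Qed.

Lemma Q0_mem S : Q0 \subset S -> [/\ a0 \in S, b0 \in S, c0 \in S & d0 \in S].
Proof. by rewrite sub4 => /and4P. Qed.

Section Classes.
Variable S : {set T}.
Hypotheses (QS : Q0 \subset S) (rS : rigid e a0 b0 S).

Lemma nbr_sep x : ~~ ext1 e S x -> sep e S [set u in S | e x u].
Proof. exact: ext1_sep. Qed.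

Lemma sep0 : sep e S set0.
Proof. by split=> [|a b c d _ _]; rewrite ?sub0set ?inE. Qed.

Lemma sepT : sep e S S.
Proof. by split=> // a b c d _; rewrite sub4 => /and4P [-> -> -> ->]. Qed.

(** The neighbourhood of [x] in [S] is separating and agrees with the empty set on [a0] and [b0]; by
    rigidity they are equal. The next two lemmas compare it in the same way with [S] and with the
    neighbourhood of another vertex. *)
Lemma class_none x : ~~ ext1 e S x -> ~~ e x b0 -> forall u, u \in S -> ~~ e x u.
Proof.
move=> nx xb u uS; have [aS bS _ _] := Q0_mem QS.
have xa : ~~ e x a0 by have [_ _ H] := ext1_adj esym eirr p0 QS nx; apply: contra xb.
have := rS (nbr_sep nx) sep0; rewrite !inE aS bS (negPf xa) (negPf xb) => /(_ erefl erefl).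
by move/setP/(_ u); rewrite !inE uS /= => ->.
Qed.

Lemma class_all x : ~~ ext1 e S x -> e x a0 -> forall u, u \in S -> e x u.
Proof.
move=> nx xa u uS; have [aS bS _ _] := Q0_mem QS.
have xb : e x b0 by have [_ _ H] := ext1_adj esym eirr p0 QS nx; apply: H.
have := rS (nbr_sep nx) sepT; rewrite !inE aS bS xa xb => /(_ erefl erefl).
by move/setP/(_ u); rewrite !inE uS.
Qed.

Lemma class_partial x y : ~~ ext1 e S x -> ~~ ext1 e S y -> partial x -> partial y ->
  forall u, u \in S -> e x u = e y u.
Proof.
move=> nx ny /andP [xb xa] /andP [yb ya] u uS; have [aS bS _ _] := Q0_mem QS.
have := rS (nbr_sep nx) (nbr_sep ny); rewrite !inE aS bS xb yb (negPf xa) (negPf ya) => /(_ erefl erefl).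
by move/setP/(_ u); rewrite !inE uS.
Qed.

Lemma path_none x y u v : ~~ ext1 e S x -> ~~ e x b0 -> e x y ->
  u \in S -> v \in S -> e y u -> ~~ e y v -> e u v -> path4 e x y u v.
Proof.
move=> nx xb xy uS vS yu yv uv.
by rewrite /path4 xy yu uv yv !(class_none nx xb).
Qed.

Lemma path_all x y u v : ~~ ext1 e S x -> e x a0 -> ~~ e x y ->
  u \in S -> v \in S -> e y u -> ~~ e y v -> ~~ e u v -> path4 e v x u y.
Proof.
move=> nx xa xy uS vS yu yv uv.
by rewrite /path4 (esym v x) (esym u y) yu (esym v u) (esym v y) yv xy uv !(class_all nx xa).
Qed.

End Classes.

(** Without bad pairs no outside vertex distinguishes members of [S] and partial vertices, so
    together they form a module, which is [R]. The partial vertices alone are then a module too,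
    without [a0]; so there are at most three. *)
Lemma closed_bound k S : good k S -> closed1 S -> (forall x y, ~~ badpair S x y) -> #|R| <= #|S| + 3.
Proof.
move=> gS clS nb; have [QS SR rS _ _] := gS.
have [aS bS _ _] := Q0_mem QS.
set P := [set x in R :\: S | partial x].
have M : module e R (S :|: P).
  split; first by rewrite subUset SR; apply/subsetP => x; rewrite !inE => /andP [/andP []].
  move=> x u v xR; rewrite !inE negb_or => /andP [xS]; rewrite xS xR /= => np.
  have nx := clS x xR xS.
  have cl w : (w \in S) || (w \notin S) && (w \in R) && partial w -> e w x = e a0 x.
    rewrite !(esym _ x); move: np; rewrite negb_and negbK => /orP [xb|xa].
      have xa : ~~ e x a0 by apply: (class_none QS rS nx xb).
      case/orP => [wS|/andP [/andP [wS wR] wp]].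
        by rewrite (negPf (class_none QS rS nx xb wS)) (negPf xa).
      by have := nb x w; rewrite /badpair xR xS wR wS wp xb (negPf xa) /= orbF => /negPf ->.
    have xb : e x b0 by apply: (class_all QS rS nx xa).
    case/orP => [wS|/andP [/andP [wS wR] wp]]; first by rewrite (class_all QS rS nx xa wS) xa.
    by have := nb x w; rewrite /badpair xR xS wR wS wp xb xa /= negbK => ->.
  by move=> uM vM; rewrite !cl.
have Q4 : 3 < #|Q0|.
  have U := path4_uniq esym eirr p0.
  have -> : Q0 = [set x in [:: a0; b0; c0; d0]] by apply/setP => x; rewrite !inE -!orbA.
  by rewrite cardsE (card_uniqP U).
have RE : S :|: P = R.
  apply: minimal => //; apply: leq_trans Q4 _.
  by apply: subset_leq_card; apply: subset_trans QS (subsetUl _ _).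
suff : #|P| <= 3 by have := leq_card_setU S P; rewrite RE; case=> /=; lia.
rewrite leqNgt; apply/negP => P4.
have /setP /(_ a0) : P = R.
  apply: minimal => //; split; first by rewrite -RE subsetUr.
  move=> x u v; rewrite -{1}RE inE => /orP [xS _|-> //].
  rewrite !inE => /andP [/andP [uS uR] up] /andP [/andP [vS vR] vp].
  by apply: (class_partial QS rS) => //; apply: clS.
by rewrite !inE aS (subsetP SR).
Qed.

Lemma good_ext1 k S x : k <= 3 -> good k S -> x \in R -> x \notin S -> ext1 e S x -> good k (x |: S).
Proof.
move=> k3 gS xR xS ex; have [QS SR rS Sq Sn] := gS; have [aS bS _ _] := Q0_mem QS.
have := good_size gS; have := ext1_num xS ex; split.
- by apply: subset_trans QS (subsetUr _ _).
- by rewrite subUset sub1set xR.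
- exact: ext1_rigid.
- by rewrite cardsU1 xS; lia.
- by rewrite cardsU1 xS; lia.
Qed.

(** If [x] is adjacent to none of [S], the new P4s are x y b0 a0 and x y c0 d0; if to all of [S],
    they are d0 x b0 y and a0 x c0 y. In both cases the first of them pairs [x] and [y] with
    vertices of [S], which keeps the set rigid. *)
Lemma badpair_rigid S x y : Q0 \subset S -> S \subset R -> rigid e a0 b0 S -> closed1 S ->
  badpair S x y -> [/\ [set x; y] :|: S \subset R, #|[set x; y] :|: S| = #|S| + 2,
    rigid e a0 b0 ([set x; y] :|: S) & num_P4 e S + 2 <= num_P4 e ([set x; y] :|: S)].
Proof.
move=> QS SR rS clS /and5P [xR xS yR yS /andP [yp H]].
have [aS bS cS dS] := Q0_mem QS.
have nx := clS x xR xS; have ny := clS y yR yS.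
have [Ebc Ead _] := ext1_adj esym eirr p0 QS ny.
have /andP [yb ya] := yp; have yc : e y c0 by rewrite -Ebc.
have yd : ~~ e y d0 by rewrite -Ead.
have nxy : x != y by apply: contraTneq H => ->; rewrite yb (negPf ya).
have := path4_uniq esym eirr p0; rewrite /= !inE !negb_or => /and4P [_ /andP [nbc nbd] _ _].
case/and5P: (p0) => ab bc cd ac /andP [bd ad].
have inU z : z \in S -> z \in [set x; y] :|: S by move=> zS; rewrite inE zS orbT.
have xU : x \in [set x; y] :|: S by rewrite !inE eqxx.
have yU : y \in [set x; y] :|: S by rewrite !inE eqxx orbT.
have neS z w : z \notin S -> w \in S -> (w == z) = false by move=> zS wS; apply: contraNF zS => /eqP <-.
have [A1 [A2 [[i1 i2 A12] [xA1 xA2] [S1 S2] link]]] : exists A1 A2 : {set T},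
    [/\ [/\ induces_P4 e A1, induces_P4 e A2 & A1 != A2], x \in A1 /\ x \in A2,
    (A1 \subset [set x; y] :|: S) /\ (A2 \subset [set x; y] :|: S) &
    exists u v, [/\ u \in S, v \in S & forall X, sep e ([set x; y] :|: S) X ->
      (x \in X) = (u \in X) /\ (y \in X) = (v \in X)]].
  case/orP: H => /andP [H1 H2].
    have q1 : path4 e x y b0 a0 by apply: (path_none QS rS nx) => //; rewrite esym.
    have q2 : path4 e x y c0 d0 by apply: (path_none QS rS nx).
    exists [set x; y; b0; a0], [set x; y; c0; d0]; split.
    - split; [exact: path4_induces|exact: path4_induces|].
      apply/eqP => /setP /(_ b0); rewrite !inE eqxx !orbT (neS x b0) // (neS y b0) //=.
      by rewrite (negPf nbc) (negPf nbd).
    - by rewrite !inE eqxx.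
    - by rewrite !sub4 xU yU !inU.
    - exists a0, b0; split=> // X [_ /(_ _ _ _ _ q1)]; rewrite sub4 xU yU !inU // => /(_ isT) [E1 E2 _].
      by rewrite E1 E2.
  have q1 : path4 e d0 x b0 y by apply: (path_all QS rS nx).
  have q2 : path4 e a0 x c0 y by apply: (path_all QS rS nx) => //; rewrite esym.
  exists [set d0; x; b0; y], [set a0; x; c0; y]; split.
  - split; [exact: path4_induces|exact: path4_induces|].
    apply/eqP => /setP /(_ b0); rewrite !inE eqxx !orbT (neS x b0) // (neS y b0) //=.
    rewrite (negPf nbc) !orbF /=; by case: (eqVneq b0 a0) ab => [->|//]; rewrite eirr.
  - by rewrite !inE eqxx !orbT.
  - by rewrite !sub4 xU yU !inU.
  - exists b0, d0; split=> // X [_ /(_ _ _ _ _ q1)]; rewrite sub4 xU yU !inU // => /(_ isT) [E1 E2 _].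
    by rewrite E1 E2.
split.
- by rewrite !subUset !sub1set xR yR SR.
- rewrite cardsU cards2 nxy (_ : _ :&: S = set0) ?cards0; first by rewrite subn0 addnC.
  apply/setP => z; rewrite !inE; apply/negbTE/negP => /andP [/orP [] /eqP -> zS].
    by rewrite zS in xS.
  by rewrite zS in yS.
- case: link => u [v [uS vS link]].
  apply: (rigid_ext aS bS rS (subsetUr _ _)) => z zU zS.
  have {zU} : z \in [set x; y] by move: zU; rewrite inE (negPf zS) orbF.
  by rewrite !inE => /orP [] /eqP ->; [exists u|exists v] => // X /link [].
- have <- : #|[set A1; A2]| = 2 by rewrite cards2 A12.
  apply: num_P4_grow; first exact: subsetUr.
  move=> A; rewrite !inE => /orP [] /eqP ->; split=> //.
    by apply: contra xS => /subsetP; apply.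
  by apply: contra xS => /subsetP; apply.
Qed.

Lemma good_badpair k S x y : good k S -> closed1 S -> #|S| + 2 <= q -> badpair S x y ->
  good k ([set x; y] :|: S).
Proof.
move=> gS clS Sq bad; have [QS SR rS _ Sn] := gS.
have [UR Uc rU Un] := badpair_rigid QS SR rS clS bad.
by split=> //; [apply: subset_trans QS (subsetUr _ _)|lia|lia].
Qed.

(** A single vertex always fits, by [good_size]. A bad pair is added only if two more vertices fit
    into q, whence the condition in the conclusion. *)
Lemma grow k S0 : k <= 3 -> good k S0 -> exists S,
  [/\ S0 \subset S, good k S, closed1 S & #|S| + 2 <= q -> forall x y, ~~ badpair S x y].
Proof.
move=> k3; move: {2}(q - #|S0|) (leqnn (q - #|S0|)) => m; elim: m S0 => [|m IH] S0 lem g0.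
  by have := good_size g0; case: g0 => _ _ _; lia.
case: (boolP [exists x in R, (x \notin S0) && ext1 e S0 x]) => [/exists_inP [x xR /andP [xS ex]]|no1].
  have g1 := good_ext1 k3 g0 xR xS ex.
  case: (IH (x |: S0)) => //; first by rewrite cardsU1 xS; have := good_size g0; lia.
  by move=> S [SS ? ? ?]; exists S; split=> //; apply: subset_trans SS; exact: subsetUr.
have cl0 : closed1 S0.
  move=> x xR xS; apply: contraNN no1 => ex; apply/exists_inP; exists x; rewrite ?xS //.
case: (boolP (#|S0| + 2 <= q)) => S0q; last by exists S0; split=> //; rewrite (negPf S0q).
case: (boolP [exists x, exists y, badpair S0 x y]) => [/existsP [x /existsP [y bad]]|no2].
  have g1 := good_badpair g0 cl0 S0q bad.
  have [QS SR rS _ Sn] := g0; have [_ Uc _ _] := badpair_rigid QS SR rS cl0 bad.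
  case: (IH ([set x; y] :|: S0)) => //; first by rewrite Uc; lia.
  by move=> S [SS ? ? ?]; exists S; split=> //; apply: subset_trans SS; exact: subsetUr.
exists S0; split=> // _ x y; apply: contraNN no2 => bad.
by apply/existsP; exists x; apply/existsP; exists y.
Qed.

Lemma good_path4 : 3 < q -> good 3 Q0.
Proof.
move=> q3; have U := path4_uniq esym eirr p0.
have C : #|Q0| = 4.
  have -> : Q0 = [set x in [:: a0; b0; c0; d0]] by apply/setP => x; rewrite !inE -!orbA.
  by rewrite cardsE (card_uniqP U).
split=> //; rewrite ?C //; first exact: rigid_path4.
have n1 : 0 < num_P4 e Q0.
  by rewrite /num_P4 card_gt0; apply/set0Pn; exists Q0; rewrite inE subxx path4_induces.
by rewrite -(addn1 3) addnC leq_add2r.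
Qed.

End Base.

Lemma num_P4_config (x0 : T) (vs : seq T) (I : seq nat) (L : seq (seq nat)) : uniq vs ->
  all (fun l => [&& size l == 4, uniq l & all (fun i => i < size vs) l]) L &&
    all (all (mem I)) L && uniq [seq sort leq l | l <- L] ->
  all (fun l => path4 e (nth x0 vs (nth 0 l 0)) (nth x0 vs (nth 0 l 1))
                      (nth x0 vs (nth 0 l 2)) (nth x0 vs (nth 0 l 3))) L ->
  size L <= num_P4 e [set x in [seq nth x0 vs i | i <- I]].
Proof.
move=> U /andP [/andP [wf /allP sub] uL] pL.
have [le iF] := num_P4_index esym eirr U wf uL pL.
apply: leq_trans le _; apply: num_P4_family => A AF; split; last exact: iF.
move: AF; rewrite inE => /mapP [l lL ->]; apply/subsetP => x; rewrite !inE => /mapP [i il ->].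
by apply: map_f; exact: (allP (sub l lL)).
Qed.

(** Used to refute configurations: five vertices with two P4s contradict q = 5, seven with four
    contradict q = 7. *)
Lemma few_config (x0 : T) (vs : seq T) (I : seq nat) (L : seq (seq nat)) : uniq vs ->
  all (fun l => [&& size l == 4, uniq l & all (fun i => i < size vs) l]) L &&
    all (all (mem I)) L && uniq [seq sort leq l | l <- L] ->
  all (fun l => path4 e (nth x0 vs (nth 0 l 0)) (nth x0 vs (nth 0 l 1))
                      (nth x0 vs (nth 0 l 2)) (nth x0 vs (nth 0 l 3))) L ->
  size I <= q -> size L + 4 <= q.
Proof.
move=> U wf pL sI; have le := num_P4_config U wf pL.
suff : num_P4 e [set x in [seq nth x0 vs i | i <- I]] + 4 <= q.
  by apply: leq_trans; rewrite leq_add2r.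
by apply: few; rewrite cardsE (leq_trans (card_size _)) // size_map.
Qed.

Lemma ext1_few S x : x \notin S -> ext1 e S x -> #|S| < q -> num_P4 e S + 5 <= q.
Proof.
move=> xS ex Sq; have := @few (x |: S); rewrite cardsU1 xS => /(_ Sq).
by apply: leq_trans; rewrite -[5]/(1 + 4) addnA leq_add2r addn1; exact: ext1_num.
Qed.

(** * Minimal modules that contain a spider with three legs *)

Definition spider3 k1 s1 k2 s2 k3 s3 := [&& uniq [:: k1; s1; k2; s2; k3; s3],
  e k1 k2, e k1 k3, e k2 k3, e k1 s1, e k2 s2, e k3 s3,
  ~~ e k1 s2, ~~ e k1 s3, ~~ e k2 s1, ~~ e k2 s3, ~~ e k3 s1, ~~ e k3 s2,
  ~~ e s1 s2, ~~ e s1 s3 & ~~ e s2 s3].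

Ltac adj := first [assumption | rewrite esym; assumption].
Ltac paths := cbv [all nth]; rewrite /path4 ?andbT; repeat (apply/andP; split); adj.

Section Spider.
Variables (k1 s1 k2 s2 k3 s3 : T).
Hypotheses (sp : spider3 k1 s1 k2 s2 k3 s3).
Let vs0 := [:: k1; s1; k2; s2; k3; s3].
Let S0 := [set x in vs0].
Hypothesis S0R : S0 \subset R.

Lemma spider_uniq : uniq vs0.
Proof. by case/andP: sp. Qed.

Lemma spider_paths : [/\ path4 e s1 k1 k2 s2, path4 e s1 k1 k3 s3 & path4 e s2 k2 k3 s3].
Proof.
move: sp => /and5P [U h12 h13 h23 /and5P [h11 h22 h33 n12 /and5P [n13 n21 n23 n31 /and4P [n32 m12 m13 m23]]]].
by split; rewrite /path4; repeat (apply/andP; split); adj.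
Qed.

Lemma path4_spider_sub :
  [/\ [set s1; k1; k2; s2] \subset S0, [set s1; k1; k3; s3] \subset S0 &
      [set s2; k2; k3; s3] \subset S0].
Proof. by rewrite !sub4 !inE !eqxx !orbT. Qed.

Lemma spider_card : #|S0| = 6.
Proof. by rewrite cardsE (card_uniqP spider_uniq). Qed.

Lemma spider_num : 3 <= num_P4 e S0.
Proof.
have [p12 p13 p23] := spider_paths.
have := @num_P4_config k1 vs0 (iota 0 6) [:: [:: 1; 0; 2; 3]; [:: 1; 0; 4; 5]; [:: 3; 2; 4; 5]] spider_uniq isT.
by rewrite /= p12 p13 p23; apply.
Qed.

(** Four vertices with a P4 exclude q = 4, and the six vertices of the spider, with three P4s,
    exclude q = 6. *)
Lemma spider_q : 5 <= q /\ q != 6.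
Proof.
have q4 : 4 <= q by have := @few set0; rewrite cards0 => /(_ isT); lia.
have [p12 _ _] := spider_paths.
have := @few_config k1 vs0 [:: 0; 1; 2; 3] [:: [:: 1; 0; 2; 3]] spider_uniq isT.
rewrite /= p12 => /(_ isT q4) q5; split=> //.
have := @few S0; rewrite spider_card; have := spider_num.
by case: (ltngtP q 6) => // -> n3 /(_ isT); lia.
Qed.

Section FiveSeven.
Hypothesis q57 : q = 5 \/ q = 7.

(** For q = 5, a P4 together with [x] would be five vertices with two P4s. For q = 7, the spider
    together with [x] would be seven vertices with four. *)
Lemma spider_no_ext1 x : x \in R -> x \notin S0 ->
  [/\ ~~ ext1 e [set s1; k1; k2; s2] x, ~~ ext1 e [set s1; k1; k3; s3] x &
      ~~ ext1 e [set s2; k2; k3; s3] x].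
Proof.
move=> xR xS; have [b1 b2 b3] := path4_spider_sub; have [p12 p13 p23] := spider_paths.
suff no a b c d : path4 e a b c d -> [set a; b; c; d] \subset S0 -> ~~ ext1 e [set a; b; c; d] x.
  by split; apply: no.
move=> p pS; apply/negP => ex; case: q57 => q5.
  have xp : x \notin [set a; b; c; d] by apply: contra xS; exact: (subsetP pS).
  have C : #|[set a; b; c; d]| = 4.
    have -> : [set a; b; c; d] = [set x in [:: a; b; c; d]] by apply/setP => z; rewrite !inE -!orbA.
    by rewrite cardsE (card_uniqP (path4_uniq esym eirr p)).
  have n1 : 0 < num_P4 e [set a; b; c; d].
    by rewrite /num_P4 card_gt0; apply/set0Pn; exists [set a; b; c; d]; rewrite inE subxx path4_induces.
  have := ext1_few xp ex; rewrite C q5 => /(_ isT).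
  by rewrite addnC; case: (num_P4 _ _) n1.
have := ext1_few xS (ext1_sub pS ex); rewrite spider_card q5 => /(_ isT).
by have := spider_num; rewrite addnC; case: (num_P4 _ _) => [|[|[|]]].
Qed.

Lemma spider_class x : x \in R -> x \notin S0 ->
  [/\ e x k2 = e x k1 /\ e x k3 = e x k1, e x s2 = e x s1 /\ e x s3 = e x s1 & e x s1 -> e x k1].
Proof.
move=> xR xS; have [n12 n13 n23] := spider_no_ext1 xR xS; have [p12 p13 p23] := spider_paths.
have [<- <- H] := ext1_adj esym eirr p12 (subxx _) n12.
by have [<- <- _] := ext1_adj esym eirr p13 (subxx _) n13.
Qed.

(** The arguments are the indices of five vertices with two P4s, for q = 5, and of seven vertices
    with four, for q = 7. *)
Ltac refute I5 L5 I7 L7 U := let q5 := fresh "q5" in case: q57 => q5;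
  [have := few_config (x0 := k1) (I := I5) (L := L5) U isT _ | have := few_config (x0 := k1) (I := I7) (L := L7) U isT _];
  rewrite q5; (apply; [paths | by []]).

(** Outside the spider, [A] sees all of it, [P] sees exactly the three body vertices, and [N] sees
    none of it but some vertex of [P]. *)
Let A := [set x in R :\: S0 | e x s1].
Let P := [set x in R :\: S0 | e x k1 && ~~ e x s1].
Let N := [set x in R :\: S0 | ~~ e x k1 && [exists y in P, e x y]].

Lemma spider_A x : x \in A -> [/\ x \in R, x \notin S0, [/\ e x k1, e x k2 & e x k3] & [/\ e x s1, e x s2 & e x s3]].
Proof.
rewrite !inE => /andP [/andP [xS xR] xs]; have xS' : x \notin S0 by rewrite !inE.
have [[-> ->] [-> ->] H] := spider_class xR xS'.
by rewrite xs H.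
Qed.

Lemma spider_P x : x \in P -> [/\ x \in R, x \notin S0, [/\ e x k1, e x k2 & e x k3] & [/\ ~~ e x s1, ~~ e x s2 & ~~ e x s3]].
Proof.
rewrite !inE => /andP [/andP [xS xR] /andP [xk xs]]; have xS' : x \notin S0 by rewrite !inE.
have [[-> ->] [-> ->] H] := spider_class xR xS'.
by rewrite xk xs.
Qed.

Lemma spider_none x : x \in R -> x \notin S0 -> ~~ e x k1 ->
  [/\ ~~ e x k1, ~~ e x k2 & ~~ e x k3] /\ [/\ ~~ e x s1, ~~ e x s2 & ~~ e x s3].
Proof.
move=> xR xS xk; have [[-> ->] [-> ->] H] := spider_class xR xS.
by rewrite (contra H) // xk.
Qed.

(** Otherwise s_i a k_j y is a P4 whenever i and j differ. The numbers index the list [a], [y],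
    [k1], [s1], [k2], [s2], [k3], [s3]. *)
Lemma spider_AP a y : a \in A -> y \in P -> e a y.
Proof.
move=> /spider_A [aR aS [a1 a2 a3] [b1 b2 b3]] /spider_P [yR yS [c1 c2 c3] [d1 d2 d3]].
apply: contraT => ay.
have ne : a != y by apply: contraTneq b1 => ->.
have U : uniq (a :: y :: vs0).
  by rewrite cons_uniq inE negb_or ne cons_uniq spider_uniq; move: aS yS; rewrite !in_set => -> ->.
move: sp => /and5P [_ h12 h13 h23 /and5P [h11 h22 h33 n12 /and5P [n13 n21 n23 n31 /and4P [n32 m12 m13 m23]]]].
refute [:: 0; 1; 2; 5; 7] [:: [:: 5; 0; 2; 1]; [:: 7; 0; 2; 1]]
  [:: 0; 1; 2; 4; 6; 5; 7] [:: [:: 5; 0; 2; 1]; [:: 7; 0; 2; 1]; [:: 7; 0; 4; 1]; [:: 5; 0; 6; 1]] U.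
Qed.

Lemma uniq_cons2 (x y z : T) : x \notin S0 -> y \notin S0 -> x != y -> x != z -> y != z ->
  uniq (z :: vs0) -> uniq [:: x, y, z & vs0].
Proof.
rewrite !in_set => xS yS xy xz yz Uz.
rewrite cons_uniq [uniq (y :: _)]cons_uniq Uz andbT.
move: xS yS; rewrite /vs0 !inE !negb_or => xS yS; rewrite xy xz yz /=.
by rewrite xS yS.
Qed.

(** Otherwise x y a s_i is a P4 for each i. In [spider_NN] the forbidden P4s are n x y k_i. *)
Lemma spider_AN a x y : a \in A -> x \in R -> x \notin S0 -> ~~ e x k1 -> y \in P -> e x y -> e a x.
Proof.
move=> aA xR xS xk yP xy; have ay := spider_AP aA yP.
have [[f1 f2 f3] [g1 g2 g3]] := spider_none xR xS xk.
move: aA yP => /spider_A [aR aS [a1 a2 a3] [b1 b2 b3]] /spider_P [yR yS [c1 c2 c3] [d1 d2 d3]].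
apply: contraT => ax.
have nay : a != y by apply: contraTneq b1 => ->.
have nxa : x != a by apply: contraNneq xk => ->.
have nxy : x != y by apply: contraNneq xk => ->.
have U : uniq (x :: y :: a :: vs0).
  apply: uniq_cons2 => //; first by rewrite eq_sym.
  by rewrite cons_uniq spider_uniq andbT; move: aS; rewrite in_set.
move: sp => /and5P [_ h12 h13 h23 /and5P [h11 h22 h33 n12 /and5P [n13 n21 n23 n31 /and4P [n32 m12 m13 m23]]]].
refute [:: 0; 1; 2; 4; 6] [:: [:: 0; 1; 2; 4]; [:: 0; 1; 2; 6]]
  [:: 0; 1; 2; 4; 6; 8; 3] [:: [:: 0; 1; 2; 4]; [:: 0; 1; 2; 6]; [:: 0; 1; 2; 8]; [:: 0; 1; 3; 4]] U.
Qed.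

Lemma spider_NN n x y : n \in R -> n \notin S0 -> ~~ e n k1 -> x \in R -> x \notin S0 -> ~~ e x k1 ->
  y \in P -> e x y -> ~~ e n y -> ~~ e n x.
Proof.
move=> nR nS nk xR xS xk yP xy ny.
have [[f1 f2 f3] [g1 g2 g3]] := spider_none xR xS xk.
have [[i1 i2 i3] [j1 j2 j3]] := spider_none nR nS nk.
move: yP => /spider_P [yR yS [c1 c2 c3] [d1 d2 d3]].
apply/negP => nx; suff : false by [].
have nny : n != y by apply: contraNneq nk => ->.
have nnx : n != x by apply: contraNneq ny => ->.
have nxy : x != y by apply: contraNneq xk => ->.
have U : uniq (n :: x :: y :: vs0).
  apply: uniq_cons2 => //.
  by rewrite cons_uniq spider_uniq andbT; move: yS; rewrite in_set.
move: sp => /and5P [_ h12 h13 h23 /and5P [h11 h22 h33 n12 /and5P [n13 n21 n23 n31 /and4P [n32 m12 m13 m23]]]].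
refute [:: 0; 1; 2; 3; 5] [:: [:: 0; 1; 2; 3]; [:: 0; 1; 2; 5]]
  [:: 0; 1; 2; 3; 5; 7; 4] [:: [:: 0; 1; 2; 3]; [:: 0; 1; 2; 5]; [:: 0; 1; 2; 7]; [:: 1; 2; 3; 4]] U.
Qed.

(** The vertices of [A] see everything in this union, and the remaining ones see nothing of it; so
    it is a module, and minimality applies. *)
Lemma spider_module : S0 :|: P :|: N = R.
Proof.
apply: minimal; last first.
  have : #|S0| <= #|S0 :|: P :|: N| by apply: subset_leq_card; rewrite -setUA subsetUl.
  by rewrite spider_card; apply: leq_trans.
split.
  rewrite !subUset S0R; apply/andP; split; apply/subsetP => x; rewrite inE => /andP [xD _];
  by move: xD; rewrite inE => /andP [].
move=> x u v xR; rewrite !in_setU !negb_or => /andP [/andP [xS xP] xN].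
have xP' : e x k1 -> e x s1.
  by move=> xk; move: xP; rewrite in_set in_setD xS xR xk /= negbK.
have cl w : (w \in S0) || (w \in P) || (w \in N) -> e w x = e x s1.
  rewrite esym; case xs: (e x s1).
    have xA : x \in A by rewrite in_set in_setD xS xR xs.
    have [_ _ [x1 x2 x3] [x4 x5 x6]] := spider_A xA.
    case/orP => [/orP [|wP]|wN].
    - by rewrite in_set !inE => /or4P [/eqP ->|/eqP ->|/eqP ->|/or3P [] /eqP ->].
    - exact: spider_AP.
    - move: wN; rewrite in_set in_setD => /andP [/andP [wS wR] /andP [wk /exists_inP [y yP wy]]].
      exact: spider_AN wy.
  have xk : ~~ e x k1 by apply/negP => /xP'; rewrite xs.
  have [[f1 f2 f3] [g1 g2 g3]] := spider_none xR xS xk.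
  have noP w' : w' \in P -> ~~ e x w'.
    move=> wP; apply: contra xN => xw; rewrite in_set in_setD xS xR xk /=.
    by apply/exists_inP; exists w'.
  move=> H; apply/negbTE; case/orP: H => [/orP [|wP]|wN].
  - by rewrite in_set !inE => /or4P [/eqP ->|/eqP ->|/eqP ->|/or3P [] /eqP ->].
  - exact: noP.
  - move: wN; rewrite in_set in_setD => /andP [/andP [wS wR] /andP [wk /exists_inP [y yP wy]]].
    by apply: spider_NN wy _ => //; exact: noP.
by move=> /cl -> /cl ->.
Qed.

(** As [A] is empty by [spider_module], the vertices of [R] outside the spider see no [s1], [s2],
    [s3], and they see all of the body or none of it. *)
Lemma spider_legs : legs e R k1 s1 k2 s2.
Proof.
have U := spider_uniq; move: (sp) => /and5P [_ h12 h13 h23 /and5P [h11 h22 h33 n12 /and5P [n13 n21 n23 n31 /and4P [n32 m12 m13 m23]]]].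
have inR v : v \in vs0 -> v \in R by move=> vv; apply: (subsetP S0R); rewrite in_set.
have cases w : w \in R -> [\/ w \in vs0, w \in P | w \in N].
  by rewrite -spider_module !in_setU [w \in S0]in_set => /orP [/orP []|]; [constructor 1|constructor 2|constructor 3].
have N_none w : w \in N -> [/\ ~~ e w k1, ~~ e w k2 & ~~ e w k3] /\ [/\ ~~ e w s1, ~~ e w s2 & ~~ e w s3].
  rewrite in_set in_setD => /andP [/andP [wS wR] /andP [wk _]]; exact: spider_none.
rewrite /legs /leaf !inR ?h11 ?h22 ?inE ?eqxx ?orbT //=.
apply/and4P; split.
- move: U; rewrite /= !inE !negb_or => /and5P [/and5P [-> -> -> _ _] /and4P [-> -> _ _] /and3P [-> _ _] _ _] //.
- apply/forall_inP => w /cases [|/spider_P [_ _ _ [d1 _ _]]|/N_none [_ [d1 _ _]]]; last 2 first.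
  + by rewrite esym (negPf d1).
  + by rewrite esym (negPf d1).
  rewrite !inE => /or4P [/eqP ->|/eqP ->|/eqP ->|/or3P [] /eqP ->]; rewrite ?eqxx ?implybT ?eirr //.
  + by rewrite esym (negPf n21).
  + by rewrite (negPf m12).
  + by rewrite esym (negPf n31).
  + by rewrite (negPf m13).
- apply/forall_inP => w /cases [|/spider_P [_ _ _ [_ d2 _]]|/N_none [_ [_ d2 _]]]; last 2 first.
  + by rewrite esym (negPf d2).
  + by rewrite esym (negPf d2).
  rewrite !inE => /or4P [/eqP ->|/eqP ->|/eqP ->|/or3P [] /eqP ->]; rewrite ?eqxx ?implybT ?eirr //.
  + by rewrite esym (negPf n12).
  + by rewrite esym (negPf m12).
  + by rewrite esym (negPf n32).
  + by rewrite (negPf m23).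
- apply/forall_inP => w /cases [|/spider_P [_ _ [c1 c2 _] _]|/N_none [[c1 c2 _] _]]; last 2 first.
  + by rewrite c1 c2 implybT.
  + by rewrite (negPf c1) (negPf c2) implybT.
  rewrite !inE => /or4P [/eqP ->|/eqP ->|/eqP ->|/or3P [] /eqP ->]; rewrite ?eqxx ?orbT //.
  + by rewrite !(esym k3) h13 h23 implybT.
  + by rewrite !(esym s3) (negPf n13) (negPf n23) implybT.
Qed.

End FiveSeven.

Lemma spider_rigid : rigid e s1 k1 S0.
Proof.
have [p12 p13 _] := spider_paths; have [b12 b13 _] := path4_spider_sub.
apply: (rigid_ext _ _ (rigid_path4 p12) b12); rewrite ?inE ?eqxx ?orbT // => x xS xQ.
have : x \in [:: k3; s3].
  by move: xS xQ; rewrite !inE !negb_or -!andbA => /or4P [/eqP ->|/eqP ->|/eqP ->|/or3P [] ->]; rewrite ?eqxx ?orbT //= ?andbF.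
rewrite !inE => /orP [] /eqP ->; [exists k1|exists s1]; rewrite ?inE ?eqxx ?orbT // => X [_ H];
by have [] := H _ _ _ _ p13 b13.
Qed.

(* A spider and a bad pair have 6 P4s on 8 vertices.  Starting again from them, the
   extension stops at least two vertices below q, so that there is room for any
   further bad pair, and hence none is left at the end. *)
Lemma spider_big : 8 <= q -> #|R| <= q + 2.
Proof.
move=> q8; have [p12 p13 p23] := spider_paths; have [b12 b13 b23] := path4_spider_sub.
have bR : [set s1; k1; k2; s2] \subset R := subset_trans b12 S0R.
have g0 : good s1 k1 k2 s2 3 S0.
  split=> //; [exact: spider_rigid|by rewrite spider_card; apply: leq_trans q8|].
  by rewrite spider_card -[6]/(3 + 3) leq_add2r; exact: spider_num.
have [S [S0S gS clS nb]] := grow p12 bR (leqnn 3) g0.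
have Sq := good_size gS.
case: (boolP [exists x, exists y, badpair s1 k1 S x y]) => [/existsP [x /existsP [y bad]]|no]; last first.
  have H : #|R| <= #|S| + 3.
    by apply: (closed_bound p12 bR gS clS) => x y; apply: contraNN no => b; apply/existsP; exists x; apply/existsP; exists y.
  by clear -H Sq; lia.
have [QS SR rS _ _] := gS.
have [xR xS yR yS /andP [/andP [yk ys] H]] := and5P bad.
have nx := clS x xR xS; have ny := clS y yR yS.
have b13S := subset_trans b13 S0S; have b23S := subset_trans b23 S0S.
have [y2 y3 _] := ext1_adj esym eirr p12 QS ny.
have [y4 y5 _] := ext1_adj esym eirr p13 b13S ny.
have yk2 : e y k2 by rewrite -y2. have yk3 : e y k3 by rewrite -y4.
have ys2 : ~~ e y s2 by rewrite -y3. have ys3 : ~~ e y s3 by rewrite -y5.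
have xS0 : x \notin S0 by apply: contra xS; exact: (subsetP S0S).
have yS0 : y \notin S0 by apply: contra yS; exact: (subsetP S0S).
have inS v : v \in vs0 -> v \in S by move=> vv; apply: (subsetP S0S); rewrite in_set.
have [[k1S s1S k2S] [s2S k3S s3S]] : [/\ k1 \in S, s1 \in S & k2 \in S] /\ [/\ s2 \in S, k3 \in S & s3 \in S].
  by rewrite !inS // !inE eqxx ?orbT.
have nxy : x != y by apply: contraTneq H => ->; rewrite yk (negPf ys).
have U : uniq [:: x, y & vs0].
  rewrite cons_uniq in_cons negb_or nxy cons_uniq spider_uniq andbT.
  by move: xS0 yS0; rewrite !in_set => -> ->.
set S1 := [set x; y] :|: S0.
have S1E : S1 = [set z in [seq nth k1 [:: x, y & vs0] i | i <- iota 0 8]].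
  by apply/setP => z; rewrite !inE -!orbA.
have S1c : #|S1| = 8 by rewrite S1E cardsE (card_uniqP U).
have S1S : S1 \subset [set x; y] :|: S by rewrite setUS.
suff [rS1 nS1] : rigid e s1 k1 S1 /\ 6 <= num_P4 e S1.
  have g1 : good s1 k1 k2 s2 2 S1.
    split; rewrite ?S1c //; last by rewrite -[8]/(6 + 2) leq_add2r.
      by apply: subset_trans b12 (subsetUr _ _).
    by rewrite /S1 !subUset !sub1set xR yR S0R.
  have [S' [_ gS' clS' nb']] := grow p12 bR (leqnSn 2) g1.
  have S'q := good_size gS'.
  have S'q2 : #|S'| + 2 <= q by clear -S'q; lia.
  have := closed_bound p12 bR gS' clS' (nb' S'q2); clear -S'q2; lia.
move: (sp) => /and5P [_ h12 h13 h23 /and5P [h11 h22 h33 n12 /and5P [n13 n21 n23 n31 /and4P [n32 m12 m13 m23]]]].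
have S0S1 : S0 \subset S1 by exact: subsetUr.
have S0_mem v : v \in vs0 -> v \in S0 by rewrite in_set.
have S1_mem v : v \in vs0 -> v \in S1 by move=> /S0_mem; exact: (subsetP S0S1).
have xS1 : x \in S1 by rewrite !inE eqxx.
have yS1 : y \in S1 by rewrite !inE eqxx orbT.
have link u v : u \in vs0 -> v \in vs0 ->
    (forall X, sep e S1 X -> (x \in X) = (u \in X) /\ (y \in X) = (v \in X)) -> rigid e s1 k1 S1.
  move=> uv vv lk; apply: (rigid_ext _ _ spider_rigid S0S1); rewrite ?S0_mem ?inE ?eqxx ?orbT //.
  move=> z zS1 zS0; have : z \in [set x; y] by case/setUP: zS1 => // zS; rewrite zS in zS0.
  by rewrite !inE => /orP [] /eqP ->; [exists u|exists v]; rewrite ?S0_mem // => X /lk [].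
case/orP: H => /andP [H1 H2].
  have cn := class_none p12 QS rS nx H1.
  have [f1 f2 f3] : [/\ ~~ e x k1, ~~ e x k2 & ~~ e x k3] by rewrite !cn.
  have [f4 f5 f6] : [/\ ~~ e x s1, ~~ e x s2 & ~~ e x s3] by rewrite !cn.
  have q1 : path4 e x y k1 s1 by paths.
  split.
    apply: (link s1 k1); rewrite ?inE ?eqxx ?orbT // => X [_ HX].
    have := HX _ _ _ _ q1; rewrite sub4 xS1 yS1 !S1_mem ?inE ?eqxx ?orbT //.
    by move=> /(_ isT) [-> -> _].
  rewrite S1E; have := @num_P4_config k1 _ (iota 0 8) [:: [:: 3; 2; 4; 5]; [:: 3; 2; 6; 7]; [:: 5; 4; 6; 7];
    [:: 0; 1; 2; 3]; [:: 0; 1; 4; 5]; [:: 0; 1; 6; 7]] U isT; apply; paths.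
have ca := class_all p12 QS rS nx H1.
have [f1 f2 f3] : [/\ e x k1, e x k2 & e x k3] by rewrite !ca.
have [f4 f5 f6] : [/\ e x s1, e x s2 & e x s3] by rewrite !ca.
have q1 : path4 e s2 x k1 y by paths.
split.
  apply: (link k1 s2); rewrite ?inE ?eqxx ?orbT // => X [_ HX].
  have := HX _ _ _ _ q1; rewrite sub4 xS1 yS1 !S1_mem ?inE ?eqxx ?orbT //.
  by move=> /(_ isT) [-> -> _].
rewrite S1E; have := @num_P4_config k1 _ (iota 0 8) [:: [:: 3; 2; 4; 5]; [:: 3; 2; 6; 7]; [:: 5; 4; 6; 7];
  [:: 5; 0; 2; 1]; [:: 3; 0; 4; 1]; [:: 3; 0; 6; 1]] U isT; apply; paths.
Qed.

Lemma spider_dichotomy : #|R| <= q + 2 \/ legs e R k1 s1 k2 s2.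
Proof.
have [q5 q6] := spider_q; case: (leqP 8 q) => q8; first by left; exact: spider_big.
right; apply: spider_legs; move: q5 q6 q8; case: (q) => [|[|[|[|[|[|[|[|]]]]]]]] //; [left|right] => //.
Qed.

End Spider.
End Growth.

(** * Complements and cographs *)

Definition compl (T : finType) (e : rel T) : rel T := fun x y => (x != y) && ~~ e x y.

Section Complement.
Variables (T : finType) (e : rel T).
Hypotheses (esym : symmetric e) (eirr : irreflexive e).

Lemma compl_sym : symmetric (compl e).
Proof. by move=> x y; rewrite /compl eq_sym esym. Qed.

Lemma compl_irr : irreflexive (compl e).
Proof. by move=> x; rewrite /compl eqxx. Qed.

Lemma path4_compl a b c d : path4 (compl e) a b c d = path4 e b d a c.
Proof.
apply/idP/idP => p.
  have := path4_uniq compl_sym compl_irr p; rewrite /= !inE !negb_or => /and4P [/and3P [ab ac ad] /andP [bc bd] cd _].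
  move: p; rewrite /path4 /compl ab bc cd ac bd ad /= !negbK (esym d a) (esym d c) (esym b a).
  by case/and5P => -> -> -> -> /andP [-> ->].
have := path4_uniq esym eirr p; rewrite /= !inE !negb_or => /and4P [/and3P [bd ba bc] /andP [da dc] ac _].
move: p; rewrite /path4 /compl (eq_sym a b) ba bc (eq_sym c d) dc ac bd (eq_sym a d) da /= !negbK.
rewrite (esym d a) (esym d c) (esym b a).
by case/and5P => -> -> -> -> /andP [-> ->].
Qed.

Lemma num_P4_compl S : num_P4 (compl e) S = num_P4 e S.
Proof.
apply: eq_card => A; rewrite !inE; congr (_ && _); apply/idP/idP.
  case/(induces_path4) => a [b [c [d [-> p]]]]; rewrite path4_compl in p.
  have -> : [set a; b; c; d] = [set b; d; a; c].
    by apply/setP => x; rewrite !inE; do 4!case: (x == _).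
  exact: path4_induces.
case/(induces_path4) => a [b [c [d [-> p]]]].
have -> : [set a; b; c; d] = [set c; a; d; b].
  by apply/setP => x; rewrite !inE; do 4!case: (x == _).
by apply: path4_induces; [exact: compl_sym|exact: compl_irr|rewrite path4_compl].
Qed.

Lemma module_compl R M : module (compl e) R M -> module e R M.
Proof.
case=> MR H; split=> // x u v xR xM uM vM.
have := H x u v xR xM uM vM; rewrite /compl.
have -> : u != x by apply: contraNneq xM => <-.
have -> : v != x by apply: contraNneq xM => <-.
by move=> /= /negb_inj.
Qed.

End Complement.

Section Cographs.
Variable T : finType.
Implicit Types (e : rel T) (R A : {set T}).

Definition no_path4 e R := forall a b c d, a \in R -> b \in R -> c \in R -> d \in R -> ~~ path4 e a b c d.

Definition splits e R A (k : bool) := [/\ A \subset R, A != set0, A != R &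
  forall x y, x \in A -> y \in R -> y \notin A -> e x y = k].

(** If [v] is universal, it splits off. If no neighbour of [v] sees a non-neighbour, the
    non-neighbours split off. Otherwise there is a path v x y with [y] a non-neighbour of [v]; [x]
    and [y] lie on the same side of [A], and a neighbour z of [v] on the other side would give the
    P4 y x v z. So the other side splits off. *)
Lemma split_step e R v A : symmetric e -> no_path4 e R -> v \in R ->
  splits e (R :\ v) A false -> exists A' k, splits e R A' k.
Proof.
move=> esym nop vR [AR A0 An H].
have inR x : x \in A -> (x \in R) && (x != v).
  by move=> /(subsetP AR); rewrite !inE andbC.
have [y0 y0R] : exists2 y, y \in R :\ v & y \notin A.
  by apply/subsetPn; apply: contra An => RA; rewrite eqEsubset AR.
move=> y0A; have [x0 x0A] := set0Pn _ A0.
pose Z := [set x in R :\ v | ~~ e v x].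
case: (eqVneq Z set0) => [Z0|Z0].
  exists [set v], true; split; rewrite ?sub1set //.
  - by apply/set0Pn; exists v; rewrite inE.
  - by apply/eqP => E; move: y0R; rewrite -E !inE; case: eqP.
  - move=> x y /set1P -> yR; rewrite inE => ny.
    have /setP /(_ y) := Z0; rewrite !inE yR ny /= => /negbFE //.
case: (boolP [exists x in R :\ v, exists y in Z, e v x && e x y]) => [|no]; last first.
  exists Z, false; split => //.
  - by apply/subsetP => x; rewrite !inE => /andP [/andP []].
  - by apply/eqP => E; move: vR; rewrite -E !inE eqxx.
  - move=> x y xZ yR yZ; case: (eqVneq y v) => [->|ny].
      by move: xZ; rewrite !inE esym => /andP [_ /negbTE].
    have yv : e v y by move: yZ; rewrite !inE ny yR /= negbK.
    apply: contraNF no => xy; apply/exists_inP; exists y; first by rewrite !inE ny.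
    by apply/exists_inP; exists x => //; rewrite yv esym.
case/exists_inP => x xR /exists_inP [y yZ /andP [vx xy]].
have [yv yR yn] : [/\ ~~ e v y, y \in R & y != v].
  by move: yZ; rewrite !inE => /andP [/andP [-> ->] ->].
have {}xR : x \in R by move: xR; rewrite !inE => /andP [].
have xn : x != v by apply: contraNneq yv => <-.
have cross u w : u \in A -> w \in R -> w != v -> w \notin A -> e u w = false.
  by move=> uA wR wn wA; apply: H => //; rewrite !inE wn.
case xA: (x \in A).
  have yA : y \in A by apply: contraTT xy => yA; rewrite cross.
  exists (R :\ v :\: A), false; split.
  - by apply/subsetP => z; rewrite !inE => /andP [_ /andP []].
  - by apply/set0Pn; exists y0; rewrite inE y0A.
  - by apply/eqP => E; move: vR; rewrite -E !inE eqxx andbF.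
  - move=> z w; rewrite !inE => /andP [zA /andP [zn zR]] wR; rewrite !negb_and negbK wR orbF negbK.
    case/orP => [wA|/eqP ->]; first by rewrite esym cross.
    apply/negP => zv; have := nop y x v z yR xR vR zR; apply/negP; rewrite negbK.
    by rewrite /path4 (esym y x) xy (esym x v) vx (esym v z) zv (esym y v) yv (cross x z) // (cross y z).
have yA : y \notin A by apply/negP => yA; move: xy; rewrite esym cross // xA.
exists A, false; split => //.
- by apply: subset_trans AR (subD1set _ _).
- by apply/eqP => E; have := subsetP AR v; rewrite E vR !inE eqxx => /(_ isT).
- move=> z w zA wR wA; case: (eqVneq w v) => [->|wn]; last exact: cross.
  apply/negP => zv; have /andP [zR _] := inR z zA; have := nop y x v z yR xR vR zR; apply/negP; rewrite negbK.
  by rewrite /path4 (esym y x) xy (esym x v) vx (esym v z) zv (esym y v) yv (esym x z) (esym y z) (cross z x) ?xA // (cross z y).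
Qed.

(* Seinsche: one of the graph and its complement is disconnected. *)
Lemma cograph_split e R : symmetric e -> irreflexive e -> no_path4 e R -> 1 < #|R| ->
  exists A k, splits e R A k.
Proof.
move=> esym eirr; elim/set_ind: R => R IH nop R2.
have /card_gt0P [v vR] : 0 < #|R| by apply: ltnW.
have := cardsD1 v R; rewrite vR add1n => cR.
case: (leqP #|R :\ v| 1) => [c1|c2].
  have /cards1P [w wE] : #|R :\ v| == 1 by rewrite eqn_leq c1 -ltnS -cR.
  have wR : w \in R :\ v by rewrite wE inE.
  exists [set v], (e v w); split; rewrite ?sub1set //.
  - by apply/set0Pn; exists v; rewrite inE.
  - by apply: contraTneq R2 => <-; rewrite cards1.
  - move=> x y /set1P -> yR; rewrite inE => ny.
    by have : y \in R :\ v; [rewrite !inE ny|rewrite wE inE => /eqP ->].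
have nop' : no_path4 e (R :\ v).
  by move=> a b c d /setD1P [_ aR] /setD1P [_ bR] /setD1P [_ cR'] /setD1P [_ dR]; apply: nop.
have [A [k sA]] := IH v vR nop' c2.
case: k sA => sA; last exact: split_step sA.
have nopc : no_path4 (compl e) R.
  by move=> a b c d aR bR cR' dR; rewrite path4_compl //; apply: nop.
have [|A' [k' [A1 A2 A3 A4]]] := split_step (compl_sym esym) nopc vR (A := A).
  case: sA => A1 A2 A3 A4; split=> // x y xA yR yA.
  by rewrite /compl A4 // andbF.
exists A', (~~ k'); split=> // x y xA yR yA.
have := A4 x y xA yR yA; rewrite /compl; have -> : x != y by apply: contraNneq yA => <-.
by move=> /= <-; rewrite negbK.
Qed.

End Cographs.

(** * Structure of minimal modules *)

Section Structure.
Variables (T : finType) (e : rel T).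
Hypotheses (esym : symmetric e) (eirr : irreflexive e).
Variables (R : {set T}) (q : nat).
Hypothesis few : forall S : {set T}, #|S| <= q -> num_P4 e S + 4 <= q.
Hypothesis minimal : forall M, module e R M -> 3 < #|M| -> M = R.

(** Both sides of the split are proper modules of [R], hence have at most three vertices each. *)
Lemma splits_small A k : splits e R A k -> #|R| <= 6.
Proof.
case=> AR A0 An H.
have m1 : module e R A.
  by split=> // x u v xR xA uA vA; rewrite !H.
have m2 : module e R (R :\: A).
  split; first exact: subsetDl.
  move=> x u v xR; rewrite !inE xR andbT negbK => xA /andP [uA uR] /andP [vA vR].
  by rewrite !(esym _ x) !H.
have A3 : #|A| <= 3.
  by rewrite leqNgt; apply: contra An => A4; rewrite (minimal m1 A4).
have B3 : #|R :\: A| <= 3.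
  rewrite leqNgt; apply: contra A0 => A4; have /setP E := minimal m2 A4.
  apply/eqP/setP => x; rewrite inE; apply/negP => xA.
  by have := E x; rewrite inE xA (subsetP AR).
by rewrite (cardsD R A) (setIidPr AR) in B3; move: (subset_leq_card AR) A3 B3; clear; lia.
Qed.

Local Ltac ineq := first [assumption | rewrite eq_sym; assumption | done | auto | rewrite eq_sym; auto].

(** If [x] sees none of [S], the body is [b0], [c0], [y] and the feet are [a0], [d0], [x]. If [x]
    sees all of [S], the body in the complement is [d0], [a0], [y] and the feet are [b0], [c0],
    [x]. *)
Lemma badpair_spider a0 b0 c0 d0 (S : {set T}) x y : path4 e a0 b0 c0 d0 ->
  [set a0; b0; c0; d0] \subset S -> rigid e a0 b0 S -> closed1 e R S ->
  badpair e R a0 b0 S x y ->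
  spider3 e b0 a0 c0 d0 y x \/ spider3 (compl e) d0 b0 a0 c0 y x.
Proof.
move=> p QS rS clS /and5P [xR xS yR yS /andP [/andP [yb ya] H]].
have nx := clS x xR xS; have ny := clS y yR yS.
have [y2 y3 _] := ext1_adj esym eirr p QS ny.
have yc : e y c0 by rewrite -y2. have yd : ~~ e y d0 by rewrite -y3.
have := QS; rewrite sub4 => /and4P [aS bS cS dS].
have := path4_uniq esym eirr p; rewrite /= !inE !negb_or => /and4P [/and3P [nab nac nad] /andP [nbc nbd] ncd _].
have ne z w : z \notin S -> w \in S -> w != z by move=> zS wS; apply: contraNneq zS => <-.
have ney z : z \in S -> z != y by exact: ne.
have nex z : z \in S -> z != x by exact: ne.
have nxy : y != x by apply: contraTneq H => <-; rewrite yb (negPf ya).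
case/and5P: (p) => ab bc cd ac /andP [bd ad].
case/orP: H => /andP [H1 H2]; [left|right].
  have cn := class_none esym eirr p QS rS nx H1.
  rewrite /spider3; apply/andP; split.
    rewrite /= !inE !negb_or; repeat (apply/andP; split); ineq.
  have xa := cn _ aS; have xb := cn _ bS; have xc := cn _ cS; have xd := cn _ dS.
  by repeat (apply/andP; split); first [assumption | rewrite esym; assumption].
have ca := class_all esym eirr p QS rS nx H1.
have xa := ca _ aS; have xb := ca _ bS; have xc := ca _ cS; have xd := ca _ dS.
rewrite /spider3; apply/andP; split.
  rewrite /= !inE !negb_or; repeat (apply/andP; split); ineq.
have cp u v : u != v -> ~~ e u v -> compl e u v by rewrite /compl => -> ->.
have cn u v : e u v -> ~~ compl e u v by rewrite /compl => ->; rewrite andbF.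
move: (compl e) cp cn => ce cp cn.
repeat (apply/andP; split); first [apply: cn; first [assumption | rewrite esym; assumption]
  | apply: cp; [ineq
    | first [assumption | rewrite esym; assumption]]].
Qed.

(** Fewness and minimality pass to the complement, so the result on spiders applies there as well;
    legs of the complement are pairs of nearly universal vertices of the graph. *)
Lemma minimal_module_bound : 6 < #|R| ->
  [\/ #|R| <= q + 2, (exists k1 s1 k2 s2, legs e R k1 s1 k2 s2) |
    exists k1 s1 k2 s2, [/\ k1 != k2, nearly_universal e R k1 s1 & nearly_universal e R k2 s2]].
Proof.
move=> R7.
have q4 : 3 < q by have := @few set0; rewrite cards0 => /(_ isT); apply: leq_trans; rewrite leq_addl.
case: (boolP [exists a in R, exists b in R, exists c in R, exists d in R, path4 e a b c d]); last first.
  move=> no; have nop : no_path4 e R.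
    move=> a b c d aR bR cR dR; apply: contraNN no => p.
    apply/exists_inP; exists a => //; apply/exists_inP; exists b => //.
    by apply/exists_inP; exists c => //; apply/exists_inP; exists d.
  have [A [k /splits_small]] := cograph_split esym eirr nop (leq_trans (isT : 1 < 7) R7).
  by rewrite leqNgt R7.
case/exists_inP => a aR /exists_inP [b bR /exists_inP [c cR /exists_inP [d dR p]]].
have pR : [set a; b; c; d] \subset R by rewrite sub4 aR bR cR dR.
have [S [QS gS clS nb]] := grow esym eirr few p pR (leqnn 3) (good_path4 esym eirr p pR q4).
have Sq := good_size few gS.
case: (boolP [exists x, exists y, badpair e R a b S x y]); last first.
  move=> no; constructor 1.
  have H : #|R| <= #|S| + 3.
    apply: (closed_bound esym eirr minimal p pR gS clS) => x y; apply: contraNN no => bad.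
    by apply/existsP; exists x; apply/existsP; exists y.
  by clear -H Sq; lia.
case/existsP => x /existsP [y bad]; have [_ SR rS _ _] := gS.
have [xR _ yR _ _] := and5P bad.
case: (badpair_spider p QS rS clS bad) => sp.
  have spR : [set z in [:: b; a; c; d; y; x]] \subset R.
    by apply/subsetP => z; rewrite !inE => /or4P [/eqP ->|/eqP ->|/eqP ->|/or3P [] /eqP ->].
  case: (spider_dichotomy esym eirr few minimal sp spR) => H; first by constructor 1.
  by constructor 2; exists b, a, c, d.
have spR : [set z in [:: d; b; a; c; y; x]] \subset R.
  by apply/subsetP => z; rewrite !inE => /or4P [/eqP ->|/eqP ->|/eqP ->|/or3P [] /eqP ->].
have fewc (S' : {set T}) : #|S'| <= q -> num_P4 (compl e) S' + 4 <= q.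
  by rewrite num_P4_compl //; exact: few.
have minc M : module (compl e) R M -> 3 < #|M| -> M = R.
  by move=> /(module_compl) mM; apply: minimal.
case: (spider_dichotomy (compl_sym esym) (compl_irr _) fewc minc sp spR) => H; first by constructor 1.
(* In the complement [b] is a leaf at [d] and [c] a leaf at [a], so in [e] the vertex [b] misses
   only [d], and [c] only [a]. Two neighbours of [d] are [c] and [x], two of [a] are [b] and [x]. *)
constructor 3; exists b, d, c, a.
move: sp; rewrite /spider3 => /and5P [U _ _ _ /and5P [_ _ _ n12 /and5P [n13 n21 n23 _ _]]].
case/and4P: H => _ /leafP [dR' bR' db bd] /leafP [aR' cR' ac ca] _.
move: U; rewrite /= !inE !negb_or => /and5P [/and5P [ndb nda ndc ndy ndx]].
move=> /and4P [nba nbc nby nbx] /and3P [nac nay nax] /andP [ncy ncx] _.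
have ncompl u v : u != v -> ~~ compl e u v -> e u v by rewrite /compl => -> /=; rewrite negbK.
split; first exact: nbc.
  apply/and5P; split; [exact: bR|exact: dR|by []| |apply/andP; split].
  - apply/forall_inP => w wR; apply/implyP => wd; case: eqVneq => //= wb.
    apply: contraT => bw; case/eqP: wd; apply: bd => //.
    by rewrite /compl eq_sym wb.
  - by move: db; rewrite /compl esym => /andP [].
  - have : [set c; x] \subset [set w in R | e d w].
      by apply/subsetP => w; rewrite !inE => /orP [] /eqP ->; rewrite ?cR ?xR ncompl.
    by move/subset_leq_card; rewrite cards2 ncx.
apply/and5P; split; [exact: cR|exact: aR|by []| |apply/andP; split].
- apply/forall_inP => w wR; apply/implyP => wd; case: eqVneq => //= wb.
  apply: contraT => bw; case/eqP: wd; apply: ca => //.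
  by rewrite /compl eq_sym wb.
- by move: ac; rewrite /compl esym => /andP [].
- have : [set b; x] \subset [set w in R | e a w].
    by apply/subsetP => w; rewrite !inE => /orP [] /eqP ->; rewrite ?bR ?xR ncompl // eq_sym.
  by move/subset_leq_card; rewrite cards2 nbx.
Qed.

End Structure.

(** * A language of loops and its compiler *)

(** Sums over the numbers below n serve as quantifiers, as cardinalities and for the multiplication
    by n, which the machine lacks. *)
Inductive expr :=
  | EC of nat
  | EN
  | EV of nat
  | EIn of expr
  | EA of 'I_16 & expr
  | EAdd of expr & expr
  | ESub of expr & expr
  | ESum of nat & expr.

Inductive cmd :=
  | CSet of nat & expr
  | CArr of 'I_16 & expr & expr
  | CSeq of cmd & cmd
  | CIf of expr & cmd & cmd
  | CForN of nat & cmd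
  | CForV of nat & nat & cmd.

Record hstate := HState { hv : nat -> nat; ha : 'I_16 -> nat -> nat }.

Definition setv (h : hstate) (x k : nat) : hstate := HState (upd (hv h) x k) (ha h).

Definition seta (h : hstate) (a : 'I_16) (i k : nat) : hstate :=
  HState (hv h) (fun b j => if (b == a) && (j == i) then k else ha h b j).

Fixpoint loop (S : Type) (f : nat -> S -> S) (k : nat) (s : S) : S :=
  if k is k'.+1 then f k' (loop f k' s) else s.

Section Semantics.
Variables (n : nat) (g : nat -> nat).

Fixpoint eval (h : hstate) (x : expr) : nat :=
  match x with
  | EC k => k
  | EN => n
  | EV i => hv h i
  | EIn x1 => g (eval h x1)
  | EA a x1 => ha h a (eval h x1)
  | EAdd x1 x2 => eval h x1 + eval h x2
  | ESub x1 x2 => eval h x1 - eval h x2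
  | ESum i x1 => \sum_(j < n) eval (setv h i j) x1
  end.

Fixpoint den (c : cmd) (h : hstate) : hstate :=
  match c with
  | CSet i x => setv h i (eval h x)
  | CArr a x y => seta h a (eval h x) (eval h y)
  | CSeq c1 c2 => den c2 (den c1 h)
  | CIf x c1 c2 => if eval h x == 0 then den c2 h else den c1 h
  | CForN i c1 => loop (fun j h1 => den c1 (setv h1 i j)) n h
  | CForV i y c1 => loop (fun j h1 => den c1 (setv h1 i j)) (hv h y) h
  end.

(* The CForV loops are the only ones whose length is not bounded by n; M bounds it. *)
Fixpoint ok (M : nat) (c : cmd) (h : hstate) : Prop :=
  match c with
  | CSeq c1 c2 => ok M c1 h /\ ok M c2 (den c1 h)
  | CIf x c1 c2 => if eval h x == 0 then ok M c2 h else ok M c1 h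
  | CForN i c1 => forall k, k < n ->
      ok M c1 (setv (loop (fun j h1 => den c1 (setv h1 i j)) k h) i k)
  | CForV i y c1 => hv h y <= M /\ forall k, k < hv h y ->
      ok M c1 (setv (loop (fun j h1 => den c1 (setv h1 i j)) k h) i k)
  | _ => True
  end.

End Semantics.

(* Register layout: 0 holds n, variable x is register 2x+1, register 2 holds
   the number of input cells, the temporary d is register 2d+4.  Cell i of the
   array a is stored at address (number of input cells) + 16 i + a. *)
Definition rX x := x.*2.+1.
Definition rT d := d.*2.+4.

Definition seqs (ps : seq program) : program := foldr Seq Skip ps.

(** The input is read only below the bound in register 2, since the arrays follow it in memory. Four
    doublings multiply an array index by 16. A sum saves its variable and restores it at the end. *)
Fixpoint comp_e (x : expr) (d : nat) : program :=
  match x with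
  | EC k => Op (Const (rT d) k)
  | EN => Op (Move (rT d) 0)
  | EV i => Op (Move (rT d) (rX i))
  | EIn x1 => seqs [:: comp_e x1 d; Op (Defs.Sub (rT d.+1) 2 (rT d));
      If (rT d.+1) (Op (Read (rT d) (rT d))) (Op (Const (rT d) 0))]
  | EA a x1 => seqs [:: comp_e x1 d;
      Op (Add (rT d) (rT d) (rT d)); Op (Add (rT d) (rT d) (rT d));
      Op (Add (rT d) (rT d) (rT d)); Op (Add (rT d) (rT d) (rT d));
      Op (Add (rT d) 2 (rT d)); Op (Const (rT d.+1) a);
      Op (Add (rT d) (rT d) (rT d.+1)); Op (Read (rT d) (rT d))]
  | EAdd x1 x2 => seqs [:: comp_e x1 d; comp_e x2 d.+1;
      Op (Add (rT d) (rT d) (rT d.+1))]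
  | ESub x1 x2 => seqs [:: comp_e x1 d; comp_e x2 d.+1;
      Op (Defs.Sub (rT d) (rT d) (rT d.+1))]
  | ESum i x1 => seqs [:: Op (Move (rT d.+1) (rX i)); Op (Const (rX i) 0);
      Op (Const (rT d) 0); Op (Move (rT d.+2) 0); Op (Const (rT d.+3) 1);
      While (rT d.+2) (seqs [:: comp_e x1 d.+4; Op (Add (rT d) (rT d) (rT d.+4));
        Op (Add (rX i) (rX i) (rT d.+3)); Op (Defs.Sub (rT d.+2) (rT d.+2) (rT d.+3))]);
      Op (Move (rX i) (rT d.+1))]
  end.

(** The temporary d counts the remaining iterations and d + 1 the completed ones. The loop variable
    is copied from the latter each time, so the body may overwrite it. *)
Definition for_loop (i d : nat) (p : program) : program :=
  seqs [:: Op (Const (rT d.+1) 0); Op (Const (rT d.+2) 1);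
    While (rT d) (seqs [:: Op (Move (rX i) (rT d.+1)); p;
      Op (Add (rT d.+1) (rT d.+1) (rT d.+2)); Op (Defs.Sub (rT d) (rT d) (rT d.+2))])].

Fixpoint comp (c : cmd) (d : nat) : program :=
  match c with
  | CSet i x => seqs [:: comp_e x d; Op (Move (rX i) (rT d))]
  | CArr a x y => seqs [:: comp_e y d; comp_e x d.+1;
      Op (Add (rT d.+1) (rT d.+1) (rT d.+1)); Op (Add (rT d.+1) (rT d.+1) (rT d.+1));
      Op (Add (rT d.+1) (rT d.+1) (rT d.+1)); Op (Add (rT d.+1) (rT d.+1) (rT d.+1));
      Op (Add (rT d.+1) 2 (rT d.+1)); Op (Const (rT d.+2) a);
      Op (Add (rT d.+1) (rT d.+1) (rT d.+2)); Op (Write (rT d.+1) (rT d))]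
  | CSeq c1 c2 => Seq (comp c1 d) (comp c2 d)
  | CIf x c1 c2 => Seq (comp_e x d) (If (rT d) (comp c1 d) (comp c2 d))
  | CForN i c1 => Seq (Op (Move (rT d) 0)) (for_loop i d (comp c1 d.+3))
  | CForV i y c1 => Seq (Op (Move (rT d) (rX y))) (for_loop i d (comp c1 d.+3))
  end.

Fixpoint cost_e (M : nat) (x : expr) : nat :=
  match x with
  | EC _ | EN | EV _ => 1
  | EIn x1 => cost_e M x1 + 3
  | EA _ x1 => cost_e M x1 + 8
  | EAdd x1 x2 | ESub x1 x2 => cost_e M x1 + cost_e M x2 + 1
  | ESum _ x1 => M * (cost_e M x1 + 4) + 7
  end.

Fixpoint cost (M : nat) (c : cmd) : nat :=
  match c with
  | CSet _ x => cost_e M x + 1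
  | CArr _ x y => cost_e M y + cost_e M x + 8
  | CSeq c1 c2 => cost M c1 + cost M c2
  | CIf x c1 c2 => cost_e M x + (cost M c1 + cost M c2).+1
  | CForN _ c1 | CForV _ _ c1 => M * (cost M c1 + 4) + 4
  end.

(** * Triples with time bounds, and correctness of the compiler *)

Definition runs (p : program) (s : state) (B : nat) (Q : state -> Prop) : Prop :=
  exists t s', [/\ exec p s t s', t <= B & Q s'].

Lemma runs_weak p s B B' (Q Q' : state -> Prop) :
  B <= B' -> (forall s', Q s' -> Q' s') -> runs p s B Q -> runs p s B' Q'.
Proof.
move=> leB QQ' [t [s' [ex le q]]]; exists t, s'; split=> //; last exact: QQ'.
exact: leq_trans leB.
Qed.

Lemma runs_seq p1 p2 s B1 B2 (Q1 Q : state -> Prop) :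
  runs p1 s B1 Q1 -> (forall s1, Q1 s1 -> runs p2 s1 B2 Q) ->
  runs (Seq p1 p2) s (B1 + B2) Q.
Proof.
move=> [t1 [s1 [ex1 le1 q1]]] /(_ s1 q1) [t2 [s2 [ex2 le2 q2]]].
by exists (t1 + t2), s2; split=> //; [exact: exec_seq ex1 ex2 | exact: leq_add].
Qed.

Lemma runs_skip s B (Q : state -> Prop) : Q s -> runs Skip s B Q.
Proof. by move=> q; exists 0, s; split=> //; exact: exec_skip. Qed.

Lemma runs_op o s B (Q : state -> Prop) : 0 < B -> Q (step o s) -> runs (Op o) s B Q.
Proof. by move=> B0 q; exists 1, (step o s); split=> //; exact: exec_op. Qed.

Lemma runs_ops o ps s B (Q : state -> Prop) :
  runs (seqs ps) (step o s) B Q -> runs (seqs (Op o :: ps)) s B.+1 Q.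
Proof.
move=> H; rewrite -add1n; apply: (runs_seq (Q1 := fun s1 => s1 = step o s)).
  exact: runs_op.
by move=> _ ->.
Qed.

Lemma runs_cons p ps s B1 B2 (Q1 Q : state -> Prop) :
  runs p s B1 Q1 -> (forall s1, Q1 s1 -> runs (seqs ps) s1 B2 Q) ->
  runs (seqs (p :: ps)) s (B1 + B2) Q.
Proof. exact: runs_seq. Qed.

Lemma runs_if i p1 p2 s B (Q : state -> Prop) :
  (reg s i != 0 -> runs p1 s B Q) -> (reg s i = 0 -> runs p2 s B Q) ->
  runs (If i p1 p2) s B.+1 Q.
Proof.
move=> H1 H2; case: (eqVneq (reg s i) 0) => E.
  have [t [s' [ex le q]]] := H2 E.
  by exists t.+1, s'; split=> //; exact: exec_if_false.
have [t [s' [ex le q]]] := H1 E.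
by exists t.+1, s'; split=> //; exact: exec_if_true.
Qed.

(* [J k] is the invariant when k iterations are left. *)
Lemma runs_while i p B (J : nat -> state -> Prop) :
  (forall k s, J k s -> reg s i = k) ->
  (forall k s, J k.+1 s -> runs p s B (J k)) ->
  forall k s, J k s -> runs (While i p) s (k * B.+1 + 1) (J 0).
Proof.
move=> Ji Jp; elim=> [|k IH] s Js.
  by exists 1, s; split=> //; apply: exec_while_false; exact: Ji Js.
have [t1 [s1 [ex1 le1 J1]]] := Jp _ _ Js.
have [t2 [s2 [ex2 le2 J2]]] := IH _ J1.
exists (t1 + t2).+1, s2; split=> //; last by lia.
by apply: exec_while_true ex1 ex2; rewrite (Ji _ _ Js).
Qed.
Arguments runs_while : clear implicits.

Lemma upd_same m a v : upd m a v a = v.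
Proof. by rewrite /upd eqxx. Qed.

Lemma upd_diff m a v b : b != a -> upd m a v b = m b.
Proof. by rewrite /upd => /negPf ->. Qed.

Section Compile.
Variables (n base M : nat) (g : nat -> nat).
Hypotheses (leM : n <= M) (g0 : forall i, base <= i -> g i = 0).

Definition sim (h : hstate) (s : state) : Prop :=
  [/\ reg s 0 = n, reg s 2 = base, (forall x, reg s (rX x) = hv h x),
      (forall i, i < base -> memory s i = g i) &
      (forall (a : 'I_16) i, memory s (base + (i * 16 + a)) = ha h a i)].

(* The effect of evaluating an expression whose temporaries start at d. *)
Definition same (d : nat) (s s' : state) : Prop :=
  (forall r, odd r || (r < rT d) -> reg s' r = reg s r) /\
  (forall i, memory s' i = memory s i).

Lemma sim_same d h s s' : sim h s -> same d s s' -> sim h s'.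
Proof.
move=> [r0 r2 rx mi ma] [sr sm]; split.
- by rewrite sr.
- by rewrite sr.
- by move=> x; rewrite sr ?rx // /rX /= odd_double.
- by move=> i Hi; rewrite sm mi.
- by move=> a i; rewrite sm ma.
Qed.

Ltac absurd_reg := let H := fresh in intro H; exfalso; move: H; rewrite /rT /rX; lia.
Ltac upds := rewrite /= /upd; repeat
  ((case: eqP; [by absurd_reg | move=> _]) || (case: eqP; [move=> _ | by absurd_reg])); try by [].

Lemma comp_eP x d h s : sim h s ->
  runs (comp_e x d) s (cost_e M x)
    (fun s' => same d s s' /\ reg s' (rT d) = eval n g h x).
Proof.
elim: x d h s => [k||i|x1 IH|a x1 IH|x1 IH1 x2 IH2|x1 IH1 x2 IH2|i x1 IH] d h s R.
- apply: runs_op => //; case: s R => r m R; split; last by rewrite /= upd_same.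
  by split=> // r' H; rewrite /= upd_diff //; apply/eqP; rewrite /rT in H *; lia.
- apply: runs_op => //; case: s R => r m R; split; last first.
    by rewrite /= upd_same; case: R.
  by split=> // r' H; rewrite /= upd_diff //; apply/eqP; rewrite /rT in H *; lia.
- apply: runs_op => //; case: s R => r m R; split; last first.
    by rewrite /= upd_same; case: R.
  by split=> // r' H; rewrite /= upd_diff //; apply/eqP; rewrite /rT in H *; lia.
- apply: runs_cons (IH d h s R) _ => -[r m] [S E].
  have R1 := sim_same R S.
  apply: runs_ops; rewrite [step _ _]/=.
  have b2 : r 2 = base by case: R1.
  apply: (runs_weak (B := 2 + 0)) => //; first by move=> s' H; exact: H.
  apply: (runs_cons (Q1 := fun s' => same d s s' /\ reg s' (rT d) = g (eval n g h x1))); last by move=> ? ?; apply: runs_skip.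
  case: S => S1 S2.
  apply: runs_if => /= H; apply: runs_op => //=; rewrite upd_same in H; split.
  + split=> // r' Hr; rewrite /= /upd.
    have -> : (r' == rT d) = false by apply/eqP; rewrite /rT in Hr *; lia.
    have -> : (r' == rT d.+1) = false by apply/eqP; rewrite /rT in Hr *; lia.
    exact: S1.
  + rewrite upd_same /upd; have -> : (rT d == rT d.+1) = false by rewrite /rT; apply/eqP; lia.
    rewrite /= in E; rewrite E; case: R1 => /= _ _ _ Hm _; apply: Hm.
    by rewrite -E; lia.
  + split=> // r' Hr; rewrite /= /upd.
    have -> : (r' == rT d) = false by apply/eqP; rewrite /rT in Hr *; lia.
    have -> : (r' == rT d.+1) = false by apply/eqP; rewrite /rT in Hr *; lia.
    exact: S1.
  + by rewrite upd_same g0 // -E /=; lia.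
- apply: runs_cons (IH d h s R) _ => -[r m] [S E].
  have R1 := sim_same R S.
  have b2 : r 2 = base by case: R1.
  do 8 apply: runs_ops; apply: runs_skip; rewrite /=.
  have d1 : (rT d == rT d.+1) = false by rewrite /rT; apply/eqP; lia.
  have d2 : (2 == rT d) = false by rewrite /rT; apply/eqP; lia.
  have d3 : (rT d.+1 == rT d) = false by rewrite /rT; apply/eqP; lia.
  case: S => S1 S2; split.
    split=> // r' Hr; rewrite /= /upd.
    have -> : (r' == rT d) = false by apply/eqP; rewrite /rT in Hr *; lia.
    have -> : (r' == rT d.+1) = false by apply/eqP; rewrite /rT in Hr *; lia.
    exact: S1.
  rewrite /upd !eqxx d1 ?d2 ?d3 b2 /=; rewrite /= in E; rewrite E.
  case: R1 => /= _ _ _ _ <-; congr m; lia.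
- apply: runs_weak (runs_cons (IH1 d h s R) (B2 := cost_e M x2 + 1) _) => //.
  + by rewrite /= addnA.
  + by move=> s' H; exact: H.
  move=> s1 [S E]; have R1 := sim_same R S.
  apply: runs_cons (IH2 d.+1 h s1 R1) _ => -[r m] [S' E'].
  apply: runs_ops; apply: runs_skip; rewrite /=.
  case: S S' => S1 S2 [S1' S2']; split.
    split=> [r' Hr|i]; last by rewrite /= -S2 -S2'.
    rewrite /= /upd; have -> : (r' == rT d) = false by apply/eqP; rewrite /rT in Hr *; lia.
    rewrite -S1 // -S1' //=; rewrite /rT in Hr *; lia.
  by rewrite upd_same -E -E' -(S1' (rT d)) //= /rT; lia.
- apply: runs_weak (runs_cons (IH1 d h s R) (B2 := cost_e M x2 + 1) _) => //.
  + by rewrite /= addnA.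
  + by move=> s' H; exact: H.
  move=> s1 [S E]; have R1 := sim_same R S.
  apply: runs_cons (IH2 d.+1 h s1 R1) _ => -[r m] [S' E'].
  apply: runs_ops; apply: runs_skip; rewrite /=.
  case: S S' => S1 S2 [S1' S2']; split.
    split=> [r' Hr|i]; last by rewrite /= -S2 -S2'.
    rewrite /= /upd; have -> : (r' == rT d) = false by apply/eqP; rewrite /rT in Hr *; lia.
    rewrite -S1 // -S1' //=; rewrite /rT in Hr *; lia.
  by rewrite upd_same -E -E' -(S1' (rT d)) //= /rT; lia.
- have -> : cost_e M (ESum i x1) = (M * (cost_e M x1 + 4) + 2).+4.+1 by rewrite /=; lia.
  do 5 apply: runs_ops.
  case: s R => r m R; rewrite [step _ _]/=.
  set s1 := State _ _.
  pose J k s' := [/\ k <= n,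
     (forall r', r' != rX i -> odd r' || (r' < rT d) -> reg s' r' = r r'),
     (forall j, memory s' j = m j) &
     [/\ reg s' (rT d) = \sum_(j < n - k) eval n g (setv h i j) x1,
      reg s' (rX i) = n - k, reg s' (rT d.+1) = r (rX i),
      reg s' (rT d.+2) = k & reg s' (rT d.+3) = 1]].
  have r0 : r 0 = n by case: R.
  have dd a b : a != b -> (rT a == rT b) = false by rewrite /rT; lia.
  have dx a b : (rT a == rX b) = false by rewrite /rT /rX; lia.
  have xd a b : (rX b == rT a) = false by rewrite /rT /rX; lia.
  have J1 : J n s1.
    split=> //; last split; rewrite /s1 /= ?subnn ?big_ord0 //.
    - move=> r' ne H; rewrite /upd.
      have -> : (r' == rT d.+3) = false by apply/eqP; rewrite /rT in H *; lia.
      have -> : (r' == rT d.+2) = false by apply/eqP; rewrite /rT in H *; lia.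
      have -> : (r' == rT d) = false by apply/eqP; rewrite /rT in H *; lia.
      have -> : (r' == rT d.+1) = false by apply/eqP; rewrite /rT in H *; lia.
      by rewrite (negPf ne).
    - by upds.
    - by upds.
    - by upds.
    - by upds.
    - by upds.
  apply: (runs_weak (B := (n * (cost_e M x1 + 3).+1 + 1) + 1) (Q := fun s' => same d (State r m) s' /\ reg s' (rT d) = \sum_(j < n) eval n g (setv h i j) x1)) => //; first by nia.
  apply: runs_cons.
    apply: (runs_while _ _ (cost_e M x1 + 3) J) J1.
      by move=> k s' [_ _ _ []].
    move=> k s' [lek Hr Hm [E1 E2 E3 E4 E5]].
    have R' : sim (setv h i (n - k.+1)) s'.
      case: R => /= R0 R2 Rx Rm Ra; split=> /=.
      - by rewrite Hr.
      - by rewrite Hr // /rX; lia.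
      - move=> x; rewrite /upd; case: eqVneq => [->//|ne].
        by rewrite Hr ?Rx // ?/rX /= ?odd_double //; apply: contra_neq ne; rewrite /rX; lia.
      - by move=> j Hj; rewrite Hm Rm.
      - by move=> a j; rewrite Hm Ra.
    apply: runs_cons (IH d.+4 _ _ R') _ => -[r2 m2] [[S1 S2] E].
    do 3 apply: runs_ops; apply: runs_skip; rewrite /=.
    have S1' q : q < d.+4 -> r2 (rT q) = reg s' (rT q).
      by move=> qd; apply: (S1 (rT q)); rewrite /rT; lia.
    have nk : n - k = (n - k.+1).+1 by lia.
    split; [by lia| |by move=> j; rewrite -Hm; exact: S2|].
      move=> r' ne H; rewrite /= /upd (negPf ne).
      have -> : (r' == rT d.+2) = false by apply/eqP; rewrite /rT in H *; lia.
      have -> : (r' == rT d) = false by apply/eqP; rewrite /rT in H *; lia.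
      by rewrite -Hr // -S1 //=; rewrite /rT in H *; lia.
    rewrite /= in E; split; rewrite /= /upd ?eqxx ?dx ?xd ?dd ?eqxx ?dx ?xd ?dd //; try lia.
    + by rewrite (S1' d) ?E1 ?E ?nk ?big_ord_recr //; lia.
    + have := S1 (rX i); rewrite /= /rX /= odd_double => -> //; rewrite S1' ?E5 ?nk -/(rX i) ?E2; lia.
    + by rewrite S1' //; lia.
    + by rewrite !S1' ?E4 ?E5; lia.
    + by rewrite S1' //; lia.
  move=> [r2 m2] [_ Hr Hm [E1 E2 E3 E4 E5]].
  apply: runs_ops; apply: runs_skip; rewrite /=.
  rewrite subn0 in E1; split; last first.
    by rewrite /= /upd; have -> : (rT d == rX i) = false by rewrite /rT /rX; lia.
  split=> // r' H; rewrite /= /upd; case: eqVneq => [->//|ne].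
  exact: Hr.
Qed.

(** A command may change variables, so only the temporaries below d are preserved; the counters of
    the enclosing loops are among them. *)
Definition keep (d : nat) (s s' : state) : Prop :=
  forall k, k < d -> reg s' (rT k) = reg s (rT k).

Lemma for_loopP i d p f h s N B : N <= M ->
  (forall k s, k < N -> sim (setv (loop f k h) i k) s ->
     runs p s B (fun s' => sim (loop f k.+1 h) s' /\ keep d.+3 s s')) ->
  sim h s -> reg s (rT d) = N ->
  runs (for_loop i d p) s (M * (B + 4) + 3) (fun s' => sim (loop f N h) s' /\ keep d s s').
Proof.
move=> leN Hp R rN; rewrite (_ : _ + 3 = (M * (B + 4) + 1).+2); last by lia.
do 2 apply: runs_ops.
case: s R rN => r m R rN; rewrite [step _ _]/=; set s1 := State _ _.
pose J k s' := [/\ k <= N, sim (loop f (N - k) h) s', keep d (State r m) s' &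
  [/\ reg s' (rT d) = k, reg s' (rT d.+1) = N - k & reg s' (rT d.+2) = 1]].
have J1 : J N s1.
  rewrite /J subnn; split=> //.
  - case: R => /= R0 R2 Rx Rm Ra; split=> //= x.
    by rewrite -Rx; upds.
  - by move=> k lk; upds.
  - by split; rewrite -?rN; upds.
apply: (runs_weak (B := (N * (B + 3).+1 + 1) + 0) (Q := fun s' => sim (loop f N h) s' /\ keep d (State r m) s')) => //; first by nia.
apply: runs_cons (runs_while _ _ (B + 3) J _ _ _ _ J1) _.
- by move=> k s' [_ _ _ []].
- move=> k [r1 m1] [lek R1 K1 [E1 E2 E3]].
  rewrite (_ : B + 3 = (B + 2).+1); last by lia.
  apply: runs_ops; rewrite [step _ _]/=.
  have R2 : sim (setv (loop f (N - k.+1) h) i (N - k.+1)) (State (upd r1 (rX i) (r1 (rT d.+1))) m1).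
    case: R1 => /= R0 R2 Rx Rm Ra; rewrite /= in E2; rewrite E2; split=> //=.
      by rewrite /upd; case: eqP => //; rewrite /rX; lia.
    move=> x; rewrite /upd; have -> : (rX x == rX i) = (x == i) by rewrite /rX; lia.
    by case: eqP.
  have ltk : N - k.+1 < N by lia.
  apply: runs_cons (Hp _ _ ltk R2) _ => -[r2 m2] [R3 K3].
  do 2 apply: runs_ops; apply: runs_skip; rewrite [step _ _]/=.
  have nk : (N - k.+1).+1 = N - k by lia.
  rewrite nk in R3; split; first by lia.
  - case: R3 => /= R0 R2' Rx Rm Ra; split=> //= x.
    by rewrite -Rx; upds.
  - move=> j jd; rewrite -K1 //; have := K3 j; rewrite /= => K3'.
    upds; rewrite K3'; last by lia.
    by upds.
  - have K3' q : q < d.+3 -> r2 (rT q) = r1 (rT q).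
      by move=> qd; have := K3 _ qd => /= ->; upds.
    have e1 := K3' d; have e2 := K3' d.+1; have e3 := K3' d.+2.
    rewrite /= in E1 E2 E3; split; upds; rewrite ?e1 ?e2 ?e3 ?E1 ?E2 ?E3; lia.
- move=> s' [_ R' K' _]; apply: runs_skip; split=> //.
  by rewrite subn0 in R'.
Qed.

Lemma compP c d h s : sim h s -> ok n g M c h ->
  runs (comp c d) s (cost M c) (fun s' => sim (den n g c h) s' /\ keep d s s').
Proof.
elim: c d h s => [i x|a x y|c1 IH1 c2 IH2|x c1 IH1 c2 IH2|i c1 IH|i y c1 IH] d h s R.
- move=> _; apply: runs_cons (comp_eP x d R) _ => -[r m] [S E].
  apply: runs_ops; apply: runs_skip; have R1 := sim_same R S.
  case: R1 => /= R0 R2 Rx Rm Ra; rewrite /= in E; split; last first.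
    move=> k kd; case: S => /= <-; first by upds.
    by rewrite /rT; lia.
  split=> //=; first by rewrite /upd; case: eqP => //; rewrite /rX; lia.
  move=> z; rewrite /upd; have -> : (rX z == rX i) = (z == i) by rewrite /rX; lia.
  by rewrite E; case: eqP.
- have -> : cost M (CArr a x y) = cost_e M y + (cost_e M x + 8) by rewrite /= addnA.
  move=> _; apply: runs_cons (comp_eP y d R) _ => s1 [S E]; have R1 := sim_same R S.
  apply: runs_cons (comp_eP x d.+1 R1) _ => -[r m] [S' E']; have R2 := sim_same R1 S'.
  do 8 apply: runs_ops; apply: runs_skip.
  have E2 : r (rT d) = eval n g h y.
    by rewrite -E; case: S' => /(_ (rT d)) /= -> //; rewrite /rT; lia.
  case: R2 => /= R0 R2 Rx Rm Ra; rewrite /= in E'; split; last first.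
    move=> k kd; case: S S' => S1 _ [S1' _]; rewrite -S1 ?/rT; last by lia.
    rewrite -S1' /=; last by rewrite /rT; lia.
    by upds.
  split=> /=.
  + by rewrite /upd.
  + by rewrite /upd; case: eqP => [|_]; rewrite ?/rT; [lia|]; case: eqP => [|_]; rewrite ?/rT; lia.
  + by move=> z; rewrite -Rx; upds.
  + move=> j jb; rewrite -Rm // /upd; case: eqP => // H.
    have : base <= j; last by lia.
    by rewrite H; upds; rewrite R2; lia.
  + move=> b j; rewrite -Ra /upd.
    set ad := (X in _ == X).
    have -> : ad = base + (eval n g h x * 16 + a).
      rewrite /ad -E'; upds; rewrite R2; lia.
    (* Array numbers are below 16, so the address determines array and index. *)
    have -> : (base + (j * 16 + b) == base + (eval n g h x * 16 + a)) = (b == a) && (j == eval n g h x).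
      apply/eqP/andP => [H|[/eqP -> /eqP ->]] //.
      have ab : (b : nat) = a.
        have : (j * 16 + b) %% 16 = (eval n g h x * 16 + a) %% 16 by congr (_ %% _); lia.
        by rewrite !modnMDl !modn_small.
      split; last by apply/eqP; lia.
      by apply/eqP/val_inj.
    by case: (_ && _) => //; rewrite -E2; upds.
- move=> [ok1 ok2]; apply: runs_seq (IH1 d h s R ok1) _ => s1 [R1 K1].
  apply: runs_weak (IH2 d _ s1 R1 ok2) => // s' [R' K']; split=> // k kd.
  by rewrite K' ?K1.
- rewrite /= => H; apply: runs_seq (comp_eP x d R) _ => s1 [S E]; have R1 := sim_same R S.
  have K1 : keep d s s1 by move=> k kd; case: S => -> //; rewrite /rT; lia.
  apply: runs_if => Ez; rewrite E in Ez.
    rewrite (negPf Ez) in H *; apply: runs_weak (IH1 d h s1 R1 H); first by lia.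
    by move=> s' [R' K']; split=> // k kd; rewrite K' ?K1.
  rewrite Ez eqxx in H *; apply: runs_weak (IH2 d h s1 R1 H); first by lia.
  by move=> s' [R' K']; split=> // k kd; rewrite K' ?K1.
- rewrite /= => H; rewrite (_ : _ + 4 = 1 + (M * (cost M c1 + 4) + 3)); last by lia.
  case: s R => r m R; apply: (runs_seq (Q1 := fun s1 => s1 = State (upd r (rT d) (r 0)) m)).
    exact: runs_op.
  move=> _ ->; apply: runs_weak (for_loopP (f := fun j h1 => den n g c1 (setv h1 i j)) (h := h) (N := n) (B := cost M c1) _ _ _ _) => //.
  + move=> s' [R' K']; split=> // k kd; rewrite K' //=; by upds.
  + by move=> k s kn Rk; apply: IH => //; exact: H.
  + case: R => /= R0 R2 Rx Rm Ra; split=> //= z; rewrite -Rx; by upds.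
  + by rewrite /= upd_same; case: R.
- rewrite /= => -[leM' H]; rewrite (_ : _ + 4 = 1 + (M * (cost M c1 + 4) + 3)); last by lia.
  case: s R => r m R; apply: (runs_seq (Q1 := fun s1 => s1 = State (upd r (rT d) (r (rX y))) m)).
    exact: runs_op.
  move=> _ ->; apply: runs_weak (for_loopP (f := fun j h1 => den n g c1 (setv h1 i j)) (h := h) (N := hv h y) (B := cost M c1) _ _ _ _) => //.
  + move=> s' [R' K']; split=> // k kd; rewrite K' //=; by upds.
  + by move=> k s kn Rk; apply: IH => //; exact: H.
  + case: R => /= R0 R2 Rx Rm Ra; split=> //= z; rewrite -Rx; by upds.
  + by rewrite /= upd_same; case: R.
Qed.

End Compile.

(** * Polynomial bounds on the cost *)

Lemma poly_bound (b : nat -> nat) (K D : nat) (K' D' : nat) M :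
  b M <= K * M.+1 ^ D -> K <= K' -> D <= D' -> b M <= K' * M.+1 ^ D'.
Proof.
by move=> H lK lD; apply: leq_trans H _; rewrite leq_mul // leq_pexp2l.
Qed.

Definition poly_bounded (b : nat -> nat) := exists K D, forall M, b M <= K * M.+1 ^ D.

Lemma poly_bounded_const k : poly_bounded (fun=> k).
Proof. by exists k, 0 => M; rewrite muln1. Qed.

Lemma poly_bounded_add b1 b2 :
  poly_bounded b1 -> poly_bounded b2 -> poly_bounded (fun M => b1 M + b2 M).
Proof.
move=> [K1 [D1 H1]] [K2 [D2 H2]]; exists (K1 + K2), (D1 + D2) => M; rewrite mulnDl.
by apply: leq_add; [apply: poly_bound (H1 M) _ _|apply: poly_bound (H2 M) _ _];
  rewrite ?leq_addr ?leq_addl.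
Qed.

Lemma poly_bounded_mul b : poly_bounded b -> poly_bounded (fun M => M * b M).
Proof.
move=> [K [D H]]; exists K, D.+1 => M; rewrite expnS mulnCA.
by apply: leq_mul.
Qed.

Lemma poly_bounded_cost_e x : poly_bounded (fun M => cost_e M x).
Proof.
elim: x => [k||i|x1 IH|a x1 IH|x1 IH1 x2 IH2|x1 IH1 x2 IH2|i x1 IH] /=;
  repeat first [exact: poly_bounded_const | assumption | apply: poly_bounded_add | apply: poly_bounded_mul].
Qed.

Lemma poly_bounded_cost c : poly_bounded (fun M => cost M c).
Proof.
elim: c => [i x|a x y|c1 IH1 c2 IH2|x c1 IH1 c2 IH2|i c1 IH|i y c1 IH] /=;
  repeat first [exact: poly_bounded_const | exact: poly_bounded_cost_e | assumption
    | apply: (poly_bounded_add (b1 := fun=> 1)) | apply: poly_bounded_add | apply: poly_bounded_mul].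
Qed.

(** * Rules for programs *)

(** Nonzero numbers are true: addition is disjunction, a sum is an existential quantifier, and
    truncated subtraction is a strict comparison. *)
Definition ENot x := ESub (EC 1) x.
Definition EAnd x y := ENot (EAdd (ENot x) (ENot y)).
Definition ELt x y := ESub y x.
Definition EEq x y := ENot (EAdd (ESub x y) (ESub y x)).
Definition EBool x := ENot (ENot x).
Definition EAll i x := ENot (ESum i (ENot x)).
Definition EImp x y := EAdd (ENot x) y.
(* Variable 63 is reserved for the multiplication by n. *)
Definition EAdj i j := EIn (EAdd (ESum 63 (EV i)) (EV j)).
Definition CSkip := CSet 61 (EC 0).

(** The variables and arrays that a program may change are computed from its text, so the side
    conditions of the frame rules hold by evaluation. *)
Fixpoint wvars (c : cmd) : seq nat :=
  match c with
  | CSet i _ => [:: i]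
  | CArr _ _ _ => [::]
  | CSeq c1 c2 | CIf _ c1 c2 => wvars c1 ++ wvars c2
  | CForN i c1 | CForV i _ c1 => i :: wvars c1
  end.

Fixpoint warrs (c : cmd) : seq nat :=
  match c with
  | CSet _ _ => [::]
  | CArr a _ _ => [:: val a]
  | CSeq c1 c2 | CIf _ c1 c2 => warrs c1 ++ warrs c2
  | CForN _ c1 | CForV _ _ c1 => warrs c1
  end.

Fixpoint no_forV (c : cmd) : bool :=
  match c with
  | CSeq c1 c2 | CIf _ c1 c2 => no_forV c1 && no_forV c2
  | CForN _ c1 => no_forV c1
  | CForV _ _ _ => false
  | _ => true
  end.

Lemma loop_ind (S : Type) (f : nat -> S -> S) (I : nat -> S -> Prop) N s :
  I 0 s -> (forall j s1, j < N -> I j s1 -> I j.+1 (f j s1)) -> I N (loop f N s).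
Proof.
move=> I0 IS; suff H k : k <= N -> I k (loop f k s) by exact: H.
by elim: k => // k IH lt; apply: IS => //; apply: IH; exact: ltnW.
Qed.

Section Rules.
Variables (n : nat) (g : nat -> nat).
Notation den := (den n g).
Notation eval := (eval n g).
Notation ok := (ok n g).

Definition tr h x := eval h x != 0.

Lemma trE h x : tr h x = (eval h x != 0).
Proof. by []. Qed.

Lemma tr_not h x : tr h (ENot x) = ~~ tr h x.
Proof. by rewrite /tr /=; case: (eval h x) => [|[]]. Qed.

Lemma tr_and h x y : tr h (EAnd x y) = tr h x && tr h y.
Proof. by rewrite /tr /=; case: (eval h x) => [|?]; case: (eval h y) => [|?]; rewrite //= ?subn0 ?addn0; lia. Qed.

Lemma tr_or h x y : tr h (EAdd x y) = tr h x || tr h y.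
Proof. by rewrite /tr /= addn_eq0 negb_and. Qed.

Lemma tr_imp h x y : tr h (EImp x y) = (tr h x ==> tr h y).
Proof. by rewrite /EImp tr_or tr_not implybE. Qed.

Lemma tr_lt h x y : tr h (ELt x y) = (eval h x < eval h y).
Proof. by rewrite /tr /= subn_eq0 ltnNge. Qed.

Lemma tr_eq h x y : tr h (EEq x y) = (eval h x == eval h y).
Proof. by rewrite /EEq tr_not /tr /= negbK addn_eq0 !subn_eq0 eqn_leq. Qed.

Lemma eval_bool h x : eval h (EBool x) = tr h x.
Proof. by rewrite /tr /=; case: (eval h x) => [|?]. Qed.

Lemma eval_not h x : eval h (ENot x) = ~~ tr h x.
Proof. by rewrite /tr /=; case: (eval h x) => [|?]. Qed.

Lemma tr_any h i x : tr h (ESum i x) = [exists j : 'I_n, tr (setv h i j) x].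
Proof.
rewrite /tr /=; apply/idP/existsP => [|[j jx]].
  move=> S; apply/existsP; apply: contraNT S; rewrite negb_exists => /forallP H.
  by rewrite big1 // => j _; move: (H j); rewrite negbK => /eqP.
by apply: contra jx; rewrite sum_nat_eq0 => /forallP /(_ j).
Qed.

Lemma tr_all h i x : tr h (EAll i x) = [forall j : 'I_n, tr (setv h i j) x].
Proof.
rewrite /EAll tr_not tr_any negb_exists; apply: eq_forallb => j.
by rewrite tr_not negbK.
Qed.

Lemma eval_count h i x : eval h (ESum i (EBool x)) = #|[set j : 'I_n | tr (setv h i j) x]|.
Proof.
rewrite -sum1_card [LHS]/= [RHS]big_mkcond; apply: eq_bigr => j _.
by have := eval_bool (setv h i j) x; rewrite /= => ->; rewrite inE; case: (tr _ _).
Qed.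

Lemma den_set i x h : den (CSet i x) h = setv h i (eval h x).
Proof. by []. Qed.
Lemma den_arr a x y h : den (CArr a x y) h = seta h a (eval h x) (eval h y).
Proof. by []. Qed.
Lemma den_seq c1 c2 h : den (CSeq c1 c2) h = den c2 (den c1 h).
Proof. by []. Qed.
Lemma den_if x c1 c2 h : den (CIf x c1 c2) h = if tr h x then den c1 h else den c2 h.
Proof. by rewrite /= /tr; case: eqP. Qed.
Lemma den_forN i c h : den (CForN i c) h = loop (fun j h1 => den c (setv h1 i j)) n h.
Proof. by []. Qed.
Lemma den_forV i y c h : den (CForV i y c) h = loop (fun j h1 => den c (setv h1 i j)) (hv h y) h.
Proof. by []. Qed.

Lemma frame_v c x h : x \notin wvars c -> hv (den c h) x = hv h x.
Proof.
elim: c h => [i y|a y z|c1 IH1 c2 IH2|y c1 IH1 c2 IH2|i c1 IH|i y c1 IH] h.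
- by rewrite inE => ne; rewrite /= /upd (negPf ne).
- by [].
- by rewrite mem_cat negb_or => /andP [n1 n2]; rewrite den_seq IH2 // IH1.
- rewrite mem_cat negb_or => /andP [n1 n2]; rewrite den_if.
  by case: ifP => _; [exact: IH1|exact: IH2].
- rewrite inE negb_or => /andP [ne nx]; rewrite den_forN.
  apply: (loop_ind (I := fun _ h1 => hv h1 x = hv h x)) => // j h1 _ <-.
  by rewrite IH // /= /upd (negPf ne).
- rewrite inE negb_or => /andP [ne nx]; rewrite den_forV.
  apply: (loop_ind (I := fun _ h1 => hv h1 x = hv h x)) => // j h1 _ <-.
  by rewrite IH // /= /upd (negPf ne).
Qed.

Lemma frame_a c (a : 'I_16) i h : val a \notin warrs c -> ha (den c h) a i = ha h a i.
Proof.
elim: c h => [k y|b y z|c1 IH1 c2 IH2|y c1 IH1 c2 IH2|k c1 IH|k y c1 IH] h.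
- by [].
- rewrite inE => ne; rewrite /=; have -> : (a == b) = false by apply: contraNF ne => /eqP ->.
  by [].
- by rewrite mem_cat negb_or => /andP [n1 n2]; rewrite den_seq IH2 // IH1.
- rewrite mem_cat negb_or => /andP [n1 n2]; rewrite den_if.
  by case: ifP => _; [exact: IH1|exact: IH2].
- move=> nx; rewrite den_forN.
  by apply: (loop_ind (I := fun _ h1 => ha h1 a i = ha h a i)) => // j h1 _ <-; rewrite IH.
- move=> nx; rewrite den_forV.
  by apply: (loop_ind (I := fun _ h1 => ha h1 a i = ha h a i)) => // j h1 _ <-; rewrite IH.
Qed.

Lemma no_forV_ok M c h : no_forV c -> ok M c h.
Proof.
elim: c h => //= [c1 IH1 c2 IH2|y c1 IH1 c2 IH2|i c1 IH] h.
- by case/andP => n1 n2; split; [exact: IH1|exact: IH2].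
- by case/andP => n1 n2; case: ifP => _; [exact: IH2|exact: IH1].
- by move=> n1 k _; exact: IH.
Qed.

Lemma ok_if M x c1 c2 h : (tr h x -> ok M c1 h) -> (~~ tr h x -> ok M c2 h) -> ok M (CIf x c1 c2) h.
Proof. by rewrite /tr /=; case: eqP => _ H1 H2; [exact: H2|exact: H1]. Qed.

Lemma ok_forN_any M i c h : (forall h1, ok M c h1) -> ok M (CForN i c) h.
Proof. by move=> H k _; exact: H. Qed.

Lemma forN_rule M (I : nat -> hstate -> Prop) i c h : I 0 h ->
  (forall j h1, j < n -> I j h1 -> ok M c (setv h1 i j) /\ I j.+1 (den c (setv h1 i j))) ->
  ok M (CForN i c) h /\ I n (den (CForN i c) h).
Proof.
move=> I0 IS; split; last by rewrite den_forN; apply: loop_ind => // j h1 jn /(IS _ _ jn) [].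
move=> k kn; apply: (proj1 (IS _ _ kn _)).
by apply: loop_ind => // j h1 jk /(IS _ _ (ltn_trans jk kn)) [].
Qed.

Definition aset (a : 'I_16) (h : hstate) : {set 'I_n} := [set x : 'I_n | ha h a x != 0].

Lemma aset_frame a c h : val a \notin warrs c -> aset a (den c h) = aset a h.
Proof. by move=> na; apply/setP => x; rewrite !inE frame_a. Qed.

Lemma aset_setv a h i k : aset a (setv h i k) = aset a h.
Proof. by []. Qed.

Variable e : rel 'I_n.
Hypothesis gE : forall i j : 'I_n, g (i * n + j) = e i j.

Lemma eval_adj h x y (i j : 'I_n) : x != 63 -> hv h x = i -> hv h y = j -> eval h (EAdj x y) = e i j.
Proof.
move=> x63 hx hy; rewrite /= hy.
have -> : \sum_(k < n) upd (hv h) 63 k x = i * n.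
  rewrite (eq_bigr (fun=> nat_of_ord i)); first by rewrite sum_nat_const card_ord mulnC.
  by move=> k _; rewrite /upd (negPf x63).
exact: gE.
Qed.

Lemma tr_adj h x y (i j : 'I_n) : x != 63 -> hv h x = i -> hv h y = j -> tr h (EAdj x y) = e i j.
Proof. by move=> x63 hx hy; rewrite /tr (eval_adj x63 hx hy); case: (e i j). Qed.

End Rules.

(** * Dynamic programming over the positions *)

Definition digit b c := (c %/ 3 ^ b) %% 3.

Lemma digit_add_lt a k c : a < k -> c < 3 ^ k -> digit a c < 2 -> c + 3 ^ a < 3 ^ k.
Proof.
move=> ak; rewrite /digit -(subnK ak) -addSnnS expnD expnS.
set w := 3 ^ a; set u := 3 ^ _ => cu d2.
have w0 : 0 < w by rewrite expn_gt0.
have m3 : c %/ w < 3 * u by rewrite ltn_divLR.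
have := divn_eq c w; have := ltn_pmod c w0; have := divn_eq (c %/ w) 3.
move=> m3E lw cE; have m2 : c %/ w + 2 <= 3 * u.
  by clear -d2 m3 m3E; lia.
have := leq_mul m2 (leqnn w); rewrite mulnDl; clear -lw cE; lia.
Qed.

(** A digit below 2 can be raised without a carry. *)
Lemma digit_add a b c : digit a c < 2 -> digit b (c + 3 ^ a) = digit b c + (a == b).
Proof.
move=> d2; have p3 k : 0 < 3 ^ k by rewrite expn_gt0.
case: (ltngtP a b) => [ab|ba|<-]; last first.
- rewrite /digit in d2 *; rewrite divnDr ?divnn ?p3 // -modnDml modn_small //; lia.
- rewrite addn0 /digit -(subnK ba) -addSnnS expnD expnS divnDMl //.
  by rewrite addnC mulnC modnMDl.
have lo : digit a (c %% 3 ^ b) = digit a c.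
  rewrite /digit [in RHS](divn_eq c (3 ^ b)) -(subnK ab) -addSnnS.
  rewrite [in X in _ = (_ * X + _) %/ _ %% _]expnD mulnA divnMDl ?p3 //.
  by rewrite expnS mulnCA mulnC modnMDl.
have lt := digit_add_lt ab (ltn_pmod c (p3 b)); rewrite lo in lt.
rewrite addn0 /digit {1}(divn_eq c (3 ^ b)) -addnA divnMDl ?p3 // (divn_small (lt d2)).
by rewrite addn0.
Qed.

(** The machine has no division: a base 3 digit is extracted by two conditional subtractions of its
    weight. *)
Lemma two_digit_steps w c : 0 < w -> let r := c %% (3 * w) in
  let r1 := if w <= r then r - w else r in
  (if w <= r1 then r1 - w else r1) = c %% w /\ (w <= r) + (w <= r1) = (c %/ w) %% 3.
Proof.
move=> w0.
have [d [l [d3 lw rE lE dE]]] : exists d l, [/\ d < 3, l < w, c %% (3 * w) = d * w + l, c %% w = l & (c %/ w) %% 3 = d].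
  exists ((c %/ w) %% 3), (c %% w); rewrite !ltn_pmod //; split=> //.
  have lt : (c %/ w) %% 3 * w + c %% w < 3 * w.
    have := ltn_pmod (c %/ w) (isT : 0 < 3); have := ltn_pmod c w0.
    by case: (_ %% 3) => [|[|[|]]] //; clear; lia.
  by rewrite -[RHS](modn_small lt) [in LHS](divn_eq c w) {1}(divn_eq (c %/ w) 3) mulnDl -mulnA -addnA modnMDl.
have wl : (w <= l) = false by rewrite leqNgt lw.
rewrite /= rE lE dE; case: d d3 {rE dE} => [|[|[|]]] // _; rewrite ?mul0n ?mul1n ?add0n.
- by rewrite !wl.
- by rewrite leq_addr addKn wl.
- have -> : 2 * w + l = w + (w + l) by lia.
  by rewrite leq_addr addKn leq_addr addKn.
Qed.

Section Positions.
Variables (n : nat) (B : {set 'I_n}).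
Implicit Types (x y : 'I_n).

(** For a vertex of [B], its rank in [B]: the place of its digit in the code of a position. *)
Definition below k := #|[set y in B | y < k]|.

Lemma below0 : below 0 = 0.
Proof. by apply: eq_card0 => y; rewrite !inE andbF. Qed.

Lemma below_n : below n = #|B|.
Proof. by apply: eq_card => y; rewrite !inE ltn_ord andbT. Qed.

Lemma belowS x : below x.+1 = below x + (x \in B).
Proof.
rewrite /below; case xB: (x \in B); last first.
  rewrite addn0; apply: eq_card => y; rewrite !inE ltnS leq_eqVlt.
  by case: eqVneq => //= /val_inj ->; rewrite xB ltnn.
rewrite addn1 (cardsD1 x) !inE xB ltnSn add1n; congr _.+1.
apply: eq_card => y; rewrite !inE ltnS [y < x]ltn_neqAle; case: (y \in B); rewrite ?andbF //=.
Qed.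

Lemma below_leq k l : k <= l -> below k <= below l.
Proof.
move=> kl; apply: subset_leq_card; apply/subsetP => y; rewrite !inE => /andP [-> yk] /=.
exact: leq_trans kl.
Qed.

Lemma below_lt x : x \in B -> below x < #|B|.
Proof. by move=> xB; rewrite -below_n; have := below_leq (ltn_ord x); rewrite belowS xB; lia. Qed.

Lemma below_inj x y : x \in B -> y \in B -> below x = below y -> x = y.
Proof.
move=> xB yB E; apply/val_inj/eqP; rewrite eqn_leq /=; case: (ltngtP x y) => // lt.
  by have := below_leq lt; rewrite belowS xB E addn1 ltnn.
by have := below_leq lt; rewrite belowS yB E addn1 ltnn.
Qed.

Definition unclaimed c := [set x in B | digit (below x) c == 0].
Definition dominators c := [set x in B | digit (below x) c == 1].

Lemma unclaimed0 : unclaimed 0 = B.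
Proof. by apply/setP => x; rewrite !inE /digit div0n andbT. Qed.

Lemma dominators0 : dominators 0 = set0.
Proof. by apply/setP => x; rewrite !inE /digit div0n andbF. Qed.

Lemma claim_lt x c : x \in unclaimed c -> c < 3 ^ #|B| -> c + 3 ^ below x < 3 ^ #|B|.
Proof.
rewrite inE => /andP [xB /eqP d0] lt; apply: digit_add_lt; rewrite ?d0 //; exact: below_lt.
Qed.

Lemma digit_claim x y c : x \in unclaimed c -> y \in B ->
  digit (below y) (c + 3 ^ below x) = digit (below y) c + (x == y).
Proof.
rewrite inE => /andP [xB /eqP d0] yB; rewrite digit_add ?d0 //; congr (_ + nat_of_bool _).
by apply/eqP/eqP => [/below_inj-> //|->].
Qed.

Lemma digit_claim2 x y c : x \in unclaimed c -> y \in B ->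
  digit (below y) (c + (3 ^ below x + 3 ^ below x)) = digit (below y) c + (x == y).*2.
Proof.
move=> xU yB; have xB : x \in B by move: xU; rewrite inE => /andP [].
have d1 : digit (below x) (c + 3 ^ below x) = 1.
  by rewrite digit_claim // eqxx; move: xU; rewrite inE => /andP [_ /eqP ->].
rewrite addnA digit_add ?d1 // digit_claim //.
have -> : (below x == below y) = (x == y) by apply/eqP/eqP => [/below_inj-> //|->].
by rewrite -addnA addnn.
Qed.

Lemma claim2_lt x c : x \in unclaimed c -> c < 3 ^ #|B| ->
  c + (3 ^ below x + 3 ^ below x) < 3 ^ #|B|.
Proof.
move=> xU lt; rewrite addnA; apply: digit_add_lt.
- by apply: below_lt; move: xU; rewrite inE => /andP [].
- exact: claim_lt.
- by rewrite digit_claim ?eqxx //; move: xU; rewrite inE => /andP [// _ /eqP ->].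
Qed.

Lemma unclaimed_claim x c : x \in unclaimed c -> unclaimed (c + 3 ^ below x) = unclaimed c :\ x.
Proof.
move=> xU; apply/setP => y; rewrite !inE; case yB: (y \in B); rewrite ?andbF //=.
by rewrite digit_claim // addn_eq0 andbC (eq_sym y x); case: (x == y).
Qed.

Lemma dominators_claim x c : x \in unclaimed c -> dominators (c + 3 ^ below x) = x |: dominators c.
Proof.
move=> xU; apply/setP => y; rewrite !inE; case: (eqVneq y x) => [->|ne].
  move: (xU); rewrite inE => /andP [xB /eqP d0]; by rewrite xB digit_claim // d0 eqxx.
case yB: (y \in B) => //=; rewrite digit_claim // (eq_sym x y) (negPf ne) addn0 //.
Qed.

Lemma unclaimed_claim2 x c : x \in unclaimed c ->
  unclaimed (c + (3 ^ below x + 3 ^ below x)) = unclaimed c :\ x.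
Proof.
move=> xU; apply/setP => y; rewrite !inE; case yB: (y \in B); rewrite ?andbF //=.
by rewrite digit_claim2 // addn_eq0 andbC (eq_sym y x); case: (x == y).
Qed.

Lemma dominators_claim2 x c : x \in unclaimed c ->
  dominators (c + (3 ^ below x + 3 ^ below x)) = dominators c.
Proof.
move=> xU; apply/setP => y; rewrite !inE; case: (eqVneq x y) => [<-|ne].
  move: (xU); rewrite inE => /andP [xB /eqP d0]; by rewrite xB digit_claim2 // d0 eqxx.
by case yB: (y \in B) => //=; rewrite digit_claim2 // (negPf ne) addn0.
Qed.

End Positions.

(* A position is encoded in base 3: the digit of a vertex x of aIn, of weight
   aWt x, is 0 if x is unclaimed, 1 if Dominator has claimed it, 2 if Staller has.
   A move increases the code, so the tables aWD and aWS of the values with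
   Dominator and Staller to move are filled from the largest code downwards. *)
Definition aIn : 'I_16 := @Ordinal 16 4 isT.
Definition aWt : 'I_16 := @Ordinal 16 5 isT.
Definition aDig : 'I_16 := @Ordinal 16 6 isT.
Definition aWD : 'I_16 := @Ordinal 16 7 isT.
Definition aWS : 'I_16 := @Ordinal 16 8 isT.

Definition weights_prog :=
  CSeq (CSet 50 (EC 1))
  (CForN 1 (CIf (EA aIn (EV 1))
    (CSeq (CArr aWt (EV 1) (EV 50)) (CSet 50 (EAdd (EV 50) (EAdd (EV 50) (EV 50))))) CSkip)).

Definition digit_step :=
  CIf (ENot (ESub (EA aWt (EV 1)) (EV 53)))
    (CSeq (CSet 53 (ESub (EV 53) (EA aWt (EV 1)))) (CArr aDig (EV 1) (EAdd (EA aDig (EV 1)) (EC 1))))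
    CSkip.

(** The vertices are visited from the last to the first, because the digits of larger weight have to
    be subtracted first. *)
Definition decode_prog :=
  CSeq (CSet 53 (EV 52))
  (CForN 2 (CSeq (CSet 1 (ESub EN (EAdd (EV 2) (EC 1))))
    (CSeq (CArr aDig (EV 1) (EC 0)) (CIf (EA aIn (EV 1)) (CSeq digit_step digit_step) CSkip)))).

Definition EFree := EAnd (EA aIn (EV 1)) (EEq (EA aDig (EV 1)) (EC 0)).

Definition EDom := EAll 1 (EImp (EA aIn (EV 1)) (ESum 2 (EAnd (EA aIn (EV 2))
  (EAnd (EEq (EA aDig (EV 2)) (EC 1)) (EAdd (EEq (EV 2) (EV 1)) (EAdj 2 1)))))).

Definition table_prog :=
  CIf (ESum 1 EFree)
  (CSeq (CArr aWD (EV 52) (EBool (ESum 1 (EAnd EFree (EA aWS (EAdd (EV 52) (EA aWt (EV 1))))))))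
        (CArr aWS (EV 52) (EAll 1 (EImp EFree (EA aWD (EAdd (EV 52) (EAdd (EA aWt (EV 1)) (EA aWt (EV 1)))))))))
  (CSeq (CArr aWD (EV 52) EDom) (CArr aWS (EV 52) EDom)).

Definition entry_prog := CSeq (CSet 52 (ESub (EV 50) (EAdd (EV 51) (EC 1)))) (CSeq decode_prog table_prog).

(* Input: the array aIn (a set B); output: whether Dominator wins on the
   subgraph induced by B, moving first (variable 30) or second (variable 31). *)
Definition brute_prog :=
  CSeq weights_prog (CSeq (CForV 51 50 entry_prog)
    (CSeq (CSet 30 (EA aWD (EC 0))) (CSet 31 (EA aWS (EC 0))))).

Section Brute.
Variables (n : nat) (g : nat -> nat) (e : rel 'I_n).
Hypothesis gE : forall i j : 'I_n, g (i * n + j) = e i j.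
Notation den := (den n g).
Notation tr := (tr n g).
Variable B : {set 'I_n}.

Definition weights_ok (h : hstate) := aset n aIn h = B /\
  forall x : 'I_n, x \in B -> ha h aWt x = 3 ^ below B x.

Lemma aset_tr a i h (j : 'I_n) : hv h i = j -> tr h (EA a (EV i)) = (j \in aset n a h).
Proof. by rewrite inE /tr /= => ->. Qed.

Lemma weights_progP h : aset n aIn h = B ->
  weights_ok (den weights_prog h) /\ hv (den weights_prog h) 50 = 3 ^ #|B|.
Proof.
move=> hB; rewrite /weights_prog den_seq den_set; set h0 := setv _ _ _.
pose I j h1 := [/\ aset n aIn h1 = B, forall x : 'I_n, x \in B -> x < j -> ha h1 aWt x = 3 ^ below B x &
  hv h1 50 = 3 ^ below B j].
suff [I1 I2 I3] : I n (den (CForN 1 (CIf (EA aIn (EV 1))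
    (CSeq (CArr aWt (EV 1) (EV 50)) (CSet 50 (EAdd (EV 50) (EAdd (EV 50) (EV 50))))) CSkip)) h0).
  by split; [split=> // x xB; rewrite I2|rewrite I3 below_n].
rewrite den_forN; apply: loop_ind; first by split=> //; rewrite below0.
move=> j h1 jn [I1 I2 I3]; pose x := Ordinal jn.
rewrite den_if (aset_tr _ (j := x)) // [aset _ _ _]I1; case: ifP => xB.
  split=> //.
  - move=> y yB; rewrite ltnS /= /upd /=; case: eqVneq => [yj _|yj]; last first.
      by rewrite leq_eqVlt (negPf yj) /=; exact: I2.
    by rewrite I3 yj.
  - by have := belowS B x; rewrite /= /upd /= I3 xB addn1 => ->; rewrite expnS; lia.
split=> //.
- move=> y yB; rewrite ltnS leq_eqVlt => /orP [/eqP yj|]; last exact: I2.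
  by move: yB; rewrite (_ : y = x) ?xB //; exact: val_inj.
- by have := belowS B x; rewrite /= /upd /= I3 xB addn0 => ->.
Qed.

Lemma digit_stepP h x r d : hv h 1 = x -> hv h 53 = r -> ha h aDig x = d ->
  let h' := den digit_step h in
  [/\ hv h' 1 = x, hv h' 53 = if ha h aWt x <= r then r - ha h aWt x else r,
      ha h' aDig x = d + (ha h aWt x <= r), forall i, ha h' aWt i = ha h aWt i &
      forall y, y != x -> ha h' aDig y = ha h aDig y].
Proof.
move=> h1 h53 hd h'; rewrite /h' /digit_step den_if tr_not trE /= h1 h53 negbK subn_eq0.
case: ifP => _; rewrite /= /upd /= ?h1 ?h53 ?eqxx ?hd ?addn0 //; split=> // y /negPf ny.
by rewrite ny.
Qed.

Lemma decode_progP h : weights_ok h -> hv h 52 < 3 ^ #|B| ->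
  weights_ok (den decode_prog h) /\
  forall x : 'I_n, x \in B -> ha (den decode_prog h) aDig x = digit (below B x) (hv h 52).
Proof.
move=> [hB hw] lt; split.
  split; first by rewrite aset_frame.
  by move=> x xB; rewrite frame_a // hw.
rewrite /decode_prog den_seq den_set; set h0 := setv _ _ _; set c := hv h 52 in lt *.
pose I j h1 := [/\ weights_ok h1, hv h1 53 = c %% 3 ^ below B (n - j) &
  forall x : 'I_n, x \in B -> n - j <= x -> ha h1 aDig x = digit (below B x) c].
set body := CForN 2 _.
suff [_ _ H] : I n (den body h0) by move=> x xB; apply: H; rewrite // subnn.
rewrite den_forN; apply: loop_ind.
  split=> //; first by rewrite subn0 below_n /= /upd /= modn_small.
  by move=> x _; rewrite subn0 leqNgt ltn_ord.
move=> j h1 jn [[hB1 hw1] I2 I3].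
have xn : n - (j + 1) < n by lia.
pose x := Ordinal xn.
rewrite den_seq den_set den_seq den_arr; set h2 := seta _ _ _ _.
have h2_1 : hv h2 1 = x by [].
have h2w i : ha h2 aWt i = ha h1 aWt i by [].
have h2B : aset n aIn h2 = B by [].
have h2r : hv h2 53 = c %% 3 ^ below B (n - j) by rewrite -I2.
have h2d : ha h2 aDig x = 0 by rewrite /= /upd /= eqxx.
have h2d' y : y != val x -> ha h2 aDig y = ha h1 aDig y by rewrite /= /upd /= => /negPf ->.
have nj : n - j = x.+1 by rewrite /=; lia.
have nj1 : n - j.+1 = x by rewrite /=; lia.
clearbody h2; rewrite /I nj1 den_if (aset_tr _ (j := x)) // h2B.
rewrite nj belowS in h2r; case: ifP => xB; last first.
  rewrite xB addn0 in h2r; split; first by split=> // y yB; rewrite h2w hw1.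
    by rewrite /= /upd /= h2r.
  move=> y yB yx; have ne : (y : nat) != x by apply/eqP => /val_inj E; rewrite -E yB in xB.
  by rewrite /= h2d' // I3 // nj ltn_neqAle eq_sym ne.
rewrite xB addn1 in h2r; rewrite den_seq.
have [e1 e2 e3 e4 e5] := digit_stepP h2_1 h2r h2d.
have wx : ha h2 aWt x = 3 ^ below B x by rewrite h2w hw1.
have w0 : 0 < 3 ^ below B x by rewrite expn_gt0.
have [S1 S2] := two_digit_steps c w0.
rewrite wx expnS in e2; rewrite wx expnS in e3.
have [f1 f2 f3 f4 f5] := digit_stepP e1 e2 e3.
rewrite e4 wx in f2 f3.
split.
- split; first by rewrite !aset_frame.
  by move=> y yB; rewrite !frame_a // h2w hw1.
- by rewrite f2 S1.
- move=> y yB yx; case: (eqVneq y x) => [->|ne].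
    by rewrite f3 add0n S2.
  by rewrite f5 // e5 // h2d' // I3 // nj ltn_neqAle eq_sym ne.
Qed.

Definition value t c := mb_val (dom e B) (unclaimed B c) (dominators B c) t.

Definition digits_ok (h : hstate) c := forall x : 'I_n, x \in B -> ha h aDig x = digit (below B x) c.

Definition table_ok (h : hstate) c := forall c', c <= c' -> c' < 3 ^ #|B| ->
  ha h aWD c' = value true c' /\ ha h aWS c' = value false c'.

Lemma tr_free h c (x : 'I_n) : aset n aIn h = B -> digits_ok h c -> hv h 1 = x ->
  tr h EFree = (x \in unclaimed B c).
Proof.
move=> hB hd h1; rewrite tr_and (aset_tr aIn h1) hB tr_eq inE /= h1.
by case xB: (x \in B) => //=; rewrite hd.
Qed.

Lemma tr_EDom h c : aset n aIn h = B -> digits_ok h c -> tr h EDom = dom e B (dominators B c).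
Proof.
move=> hB hd; rewrite tr_all; apply: eq_forallb => x.
rewrite tr_imp (@aset_tr _ _ _ x) ?aset_setv // hB; congr (_ ==> _).
rewrite tr_any; apply: eq_existsb => y.
rewrite tr_and (@aset_tr _ _ _ y) ?aset_setv // hB inE -andbA; case yB: (y \in B) => //=.
rewrite tr_and tr_or !tr_eq (@tr_adj _ _ e _ _ _ _ y x) // /= /upd /=; congr (_ && _).
by rewrite hd.
Qed.

(** A claim by Dominator adds the weight of the vertex once, a claim by Staller twice; the entries
    consulted have larger codes and are already in the tables. *)
Lemma table_progP h c : weights_ok h -> digits_ok h c -> hv h 52 = c -> c < 3 ^ #|B| ->
  table_ok h c.+1 -> table_ok (den table_prog h) c.
Proof.
move=> [hB hw] hd h52 lt tb; rewrite /table_prog.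
have trU : tr h (ESum 1 EFree) = (unclaimed B c != set0).
  rewrite tr_any; apply/existsP/set0Pn => -[x xU]; exists x; move: xU;
  by rewrite (@tr_free _ c x).
(* The entry of [aWS] is computed after the one of [aWD] has been written at the same code, and it
   consults [aWD] at other codes only. *)
have notc k c' : 0 < k -> (c' + k == c') = false by move=> k0; rewrite -[X in _ == X]addn0 eqn_add2l eqn0Ngt k0.
have w0 x : 0 < 3 ^ below B x by rewrite expn_gt0.
suff H : ha (den table_prog h) aWD c = value true c /\ ha (den table_prog h) aWS c = value false c /\
    forall c', c' != c -> ha (den table_prog h) aWD c' = ha h aWD c' /\ ha (den table_prog h) aWS c' = ha h aWS c'.
  case: H => H1 [H2 H3] c'; rewrite leq_eqVlt => /orP [/eqP <- //|lt' ltB].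
  have ne : c' != c by rewrite gtn_eqF.
  by have [-> ->] := H3 c' ne; exact: tb.
rewrite /table_prog den_if; case: ifP => tU; rewrite den_seq !den_arr; rewrite trU in tU.
  set v1 := eval _ _ _ (EBool _); set h1 := seta h aWD _ _.
  set v2 := eval _ _ _ (EAll _ _).
  have v1E : v1 = value true c.
    rewrite /v1 eval_bool tr_any /value valD //; congr nat_of_bool; apply: eq_existsb => x.
    rewrite tr_and (@tr_free _ c x) //; case xU: (x \in unclaimed B c) => //=.
    have xB : x \in B by move: xU; rewrite inE => /andP [].
    have gt : c < c + 3 ^ below B x by rewrite -addn1 leq_add2l.
    rewrite trE /= /upd /= h52 hw //; have [_ ->] := tb _ gt (claim_lt xU lt).
    by rewrite /value unclaimed_claim // dominators_claim //; case: (mb_val _ _ _ _).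
  have v2E : v2 = value false c.
    rewrite /v2 eval_not tr_any /value valS //; congr nat_of_bool.
    rewrite negb_exists; apply: eq_forallb => x.
    rewrite tr_not negbK tr_imp (@tr_free _ c x) //; case xU: (x \in unclaimed B c) => //=.
    have xB : x \in B by move: xU; rewrite inE => /andP [].
    have gt : c < c + (3 ^ below B x + 3 ^ below B x) by rewrite -addn1 leq_add2l addn_gt0 w0.
    rewrite trE /= /upd /= h52 hw // notc ?addn_gt0 ?w0 //.
    have [-> _] := tb _ gt (claim2_lt xU lt).
    by rewrite /value unclaimed_claim2 // dominators_claim2 //; case: (mb_val _ _ _ _).
  by rewrite /= !h52 !eqxx v1E v2E; split=> //; split=> // c' /negPf ->.
move/negbFE/eqP: tU => U0.
have dE h1 : aset n aIn h1 = B -> digits_ok h1 c -> eval n g h1 EDom = value true c /\ eval n g h1 EDom = value false c.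
  move=> hB1 hd1; rewrite /value U0 !val0 -(tr_EDom hB1 hd1).
  by rewrite /EDom /EAll eval_not tr_not.
have [d1 _] := dE h hB hd; set h1 := seta h aWD _ _.
have [_ d2] := dE h1 hB hd.
by rewrite d2 /h1 d1 /= !h52 !eqxx; split=> //; split=> // c' /negPf ->.
Qed.

Lemma brute_progP h : aset n aIn h = B ->
  hv (den brute_prog h) 30 = out e B true /\ hv (den brute_prog h) 31 = out e B false.
Proof.
move=> hB; rewrite /brute_prog den_seq.
have [w1 p1] := weights_progP hB; set h1 := den weights_prog h in w1 p1 *.
rewrite den_seq; set h2 := den (CForV _ _ _) h1.
suff [_ _] : [/\ weights_ok h2, hv h2 50 = 3 ^ #|B| & table_ok h2 0].
  have lt0 : 0 < 3 ^ #|B| by rewrite expn_gt0.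
  move=> /(_ 0 isT lt0); rewrite /value unclaimed0 dominators0 => -[E1 E2].
  by rewrite den_seq !den_set /= /upd /= E1 E2.
rewrite /h2 den_forV p1.
pose I i h3 := [/\ weights_ok h3, hv h3 50 = 3 ^ #|B| & table_ok h3 (3 ^ #|B| - i)].
suff : I (3 ^ #|B|) (loop (fun j h3 => den entry_prog (setv h3 51 j)) (3 ^ #|B|) h1).
  by rewrite /I subnn.
apply: loop_ind.
  by split=> // c'; rewrite subn0 => le /(leq_ltn_trans le); rewrite ltnn.
move=> i h3 lt [[b3 w3] p3 t3]; set h4 := setv h3 51 i.
rewrite /entry_prog den_seq den_set den_seq.
set c := 3 ^ #|B| - i.+1; set h5 := setv h4 52 _.
have h5c : hv h5 52 = c by rewrite /= /upd /= p3 addn1.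
have ltc : c < 3 ^ #|B| by rewrite /c; lia.
have w5 : weights_ok h5 by [].
have lt5 : hv h5 52 < 3 ^ #|B| by rewrite h5c.
have [w6 d6] := decode_progP w5 lt5; rewrite h5c in d6.
have t6 : table_ok (den decode_prog h5) c.+1.
  by move=> c' le' lt'; rewrite !frame_a //; apply: t3 => //; rewrite /c in le'; lia.
split.
- case: w6 => b6 w6; split; first by rewrite aset_frame.
  by move=> x xB; rewrite frame_a // w6.
- by rewrite !frame_v.
- by apply: table_progP => //; rewrite frame_v.
Qed.

Lemma brute_prog_ok M h : aset n aIn h = B -> 3 ^ #|B| <= M -> ok n g M brute_prog h.
Proof.
move=> hB leM; have [w1 p1] := weights_progP hB.
split; first exact: no_forV_ok.
split; last by [].
by split; [rewrite p1|move=> k _; exact: no_forV_ok].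
Qed.

End Brute.

(** * Closure of a set under splitters *)

Fixpoint rarrs (x : expr) : seq nat :=
  match x with
  | EA a x1 => val a :: rarrs x1
  | EIn x1 | ESum _ x1 => rarrs x1
  | EAdd x1 x2 | ESub x1 x2 => rarrs x1 ++ rarrs x2
  | _ => [::]
  end.

Definition aAlive : 'I_16 := @Ordinal 16 1 isT.
Definition aCur : 'I_16 := @Ordinal 16 2 isT.
Definition aBest : 'I_16 := @Ordinal 16 3 isT.

Definition for4 c := CForN 10 (CForN 11 (CForN 12 (CForN 13 c))).

Definition ESplit := EAnd (EA aAlive (EV 1)) (EAnd (ENot (EA aCur (EV 1)))
  (ESum 3 (ESum 4 (EAnd (EAnd (EA aCur (EV 3)) (EA aCur (EV 4)))
                        (EAnd (EAdj 3 1) (ENot (EAdj 4 1))))))).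

Definition closure_prog :=
  CSeq (CForN 1 (CArr aCur (EV 1) (EAdd (EAdd (EEq (EV 1) (EV 10)) (EEq (EV 1) (EV 11)))
                                        (EAdd (EEq (EV 1) (EV 12)) (EEq (EV 1) (EV 13))))))
       (CForN 2 (CForN 1 (CIf ESplit (CArr aCur (EV 1) (EC 1)) CSkip))).

Section Fill.
Variables (n : nat) (g : nat -> nat).
Notation den := (den n g).
Notation tr := (tr n g).
Notation eval := (eval n g).

Lemma eval_ext h h' x : (forall v, hv h v = hv h' v) ->
  (forall (a : 'I_16) i, val a \in rarrs x -> ha h a i = ha h' a i) -> eval h x = eval h' x.
Proof.
elim: x h h' => [k||i|x1 IH|a x1 IH|x1 IH1 x2 IH2|x1 IH1 x2 IH2|i x1 IH] h h' Hv Ha //=.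
- by rewrite (IH h h').
- rewrite (IH h h') //; first by apply: Ha; rewrite inE eqxx.
  by move=> b k bx; apply: Ha; rewrite inE bx orbT.
- by rewrite (IH1 h h') ?(IH2 h h') // => b k bx; apply: Ha; rewrite mem_cat bx ?orbT.
- by rewrite (IH1 h h') ?(IH2 h h') // => b k bx; apply: Ha; rewrite mem_cat bx ?orbT.
- apply: eq_bigr => j _; apply: IH => [v|a k ax] /=; last exact: Ha.
  by rewrite /upd Hv.
Qed.

(** The expression does not read the array being filled, so it can be evaluated in the initial state
    throughout. *)
Lemma den_fill (a : 'I_16) i x h (j : 'I_n) : val a \notin rarrs x ->
  ha (den (CForN i (CArr a (EV i) x)) h) a j = eval (setv h i j) x.
Proof.
move=> ax; rewrite den_forN.
pose I k h1 := [/\ forall v, v != i -> hv h1 v = hv h v, forall (b : 'I_16) l, b != a -> ha h1 b l = ha h b l &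
  forall l, l < k -> ha h1 a l = eval (setv h i l) x].
suff [_ _ H] : I n (loop (fun k h1 => den (CArr a (EV i) x) (setv h1 i k)) n h) by apply: H.
apply: loop_ind; first by split.
move=> k h1 kn [I1 I2 I3].
have E : eval (setv h1 i k) x = eval (setv h i k) x.
  apply: eval_ext => [v|b l bx] /=; first by rewrite /upd; case: eqVneq => // ne; exact: I1.
  by apply: I2; apply: contraNneq ax => <-.
rewrite den_arr E; split => [v vi|b l ba|l].
- by rewrite /= /upd (negPf vi) I1.
- by rewrite /= (negPf ba) I2.
- rewrite ltnS leq_eqVlt /= /upd !eqxx /= => /orP [/eqP ->|lk]; first by rewrite eqxx.
  by rewrite ltn_eqF // I3.
Qed.

Lemma aset_fill (a : 'I_16) i x h : val a \notin rarrs x ->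
  aset n a (den (CForN i (CArr a (EV i) x)) h) = [set j : 'I_n | tr (setv h i j) x].
Proof. by move=> ax; apply/setP => j; rewrite !inE den_fill. Qed.

Section For4.
Variables (J : hstate -> Prop) (mono4 : hstate -> hstate -> Prop).
Hypothesis mono4_refl : forall h, mono4 h h.
Hypothesis mono4_trans : forall h1 h2 h3, mono4 h1 h2 -> mono4 h2 h3 -> mono4 h1 h3.

Lemma forN_level x c (J' : hstate -> Prop) (P : 'I_n -> hstate -> Prop) :
  (forall h m, J' h -> J' (setv h x m)) -> (forall h m, mono4 h (setv h x m)) ->
  (forall (i : 'I_n) h, J' h -> hv h x = i -> [/\ J' (den c h), P i (den c h) & mono4 h (den c h)]) ->
  (forall i h h', mono4 h h' -> P i h -> P i h') ->
  forall h, J' h -> [/\ J' (den (CForN x c) h), forall i, P i (den (CForN x c) h) & mono4 h (den (CForN x c) h)].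
Proof.
move=> Js Ms body Pm h Jh; rewrite den_forN.
pose I k h1 := [/\ J' h1, forall i : 'I_n, i < k -> P i h1 & mono4 h h1].
suff [I1 I2 I3] : I n (loop (fun j h1 => den c (setv h1 x j)) n h) by split=> // i; exact: I2.
apply: loop_ind; first by split.
move=> k h1 kn [I1 I2 I3].
have Ek : hv (setv h1 x k) x = Ordinal kn by rewrite /= upd_same.
have [B1 B2 B3] := body (Ordinal kn) _ (Js _ k I1) Ek.
have M1 : mono4 h1 (den c (setv h1 x k)) by apply: mono4_trans B3.
split=> //; last exact: mono4_trans M1.
move=> i; rewrite ltnS leq_eqVlt => /orP [/eqP ik|ik]; last by apply: Pm M1 _; exact: I2.
by have -> : i = Ordinal kn by exact: val_inj.
Qed.

(** Each quadruple achieves [P] when it is visited, and the later iterations preserve [P] because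
    they only move up in the preorder [mono4]. The invariant is [J]. *)
Lemma for4P c (P : 'I_n -> 'I_n -> 'I_n -> 'I_n -> hstate -> Prop) h :
  ~~ has (mem (wvars c)) [:: 10; 11; 12; 13] ->
  (forall h1 x m, x \in [:: 10; 11; 12; 13] -> J h1 -> J (setv h1 x m)) ->
  (forall h1 x m, x \in [:: 10; 11; 12; 13] -> mono4 h1 (setv h1 x m)) ->
  (forall (i j k l : 'I_n) h1, J h1 -> hv h1 10 = i -> hv h1 11 = j -> hv h1 12 = k -> hv h1 13 = l ->
     [/\ J (den c h1), P i j k l (den c h1) & mono4 h1 (den c h1)]) ->
  (forall i j k l h1 h2, mono4 h1 h2 -> P i j k l h1 -> P i j k l h2) ->
  J h -> J (den (for4 c) h) /\ forall i j k l, P i j k l (den (for4 c) h).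
Proof.
rewrite /= !negb_or andbT => /and4P [w10 w11 w12 w13] Js Ms body Pm Jh.
suff [H1 H2 _] : [/\ J (den (for4 c) h), forall i j k l, P i j k l (den (for4 c) h) & mono4 h (den (for4 c) h)].
  by split.
apply: (forN_level (P := fun i h1 => forall j k l, P i j k l h1)) => //.
- by move=> h1 m; apply: Js.
- by move=> h1 m; apply: Ms.
- move=> i h1 J1 E1.
  have [|||||[J2 _] P2 M2] := @forN_level 11 (CForN 12 (CForN 13 c)) (fun h1 => J h1 /\ hv h1 10 = i)
     (fun j h1 => forall k l, P i j k l h1) _ _ _ _ h1; rewrite ?inE //.
  + by move=> h2 m [J2 E2]; split=> //; apply: Js.
  + by move=> h2 m; apply: Ms.
  + move=> j h2 [J2 E2] E3.
    have [|||||[J3 E4 E5] P3 M3] := @forN_level 12 (CForN 13 c) (fun h1 => [/\ J h1, hv h1 10 = i & hv h1 11 = j])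
       (fun k h1 => forall l, P i j k l h1) _ _ _ _ h2; rewrite ?inE //.
    * by move=> h3 m [J3 E4 E5]; split=> //; apply: Js.
    * by move=> h3 m; apply: Ms.
    * move=> k h3 [J3 E4 E5] E6.
      have [|||||[J4 F1 F2 F3] P4 M4] := @forN_level 13 c
         (fun h1 => [/\ J h1, hv h1 10 = i, hv h1 11 = j & hv h1 12 = k]) (fun l h1 => P i j k l h1) _ _ _ _ h3; rewrite ?inE //.
      - by move=> h4 m [J4 F1 F2 F3]; split=> //; apply: Js.
      - by move=> h4 m; apply: Ms.
      - move=> l h4 [J4 F1 F2 F3] F4; have [B1 B2 B3] := body i j k l h4 J4 F1 F2 F3 F4.
        by split=> //; split=> //; rewrite frame_v.
      - by move=> l h4 h5 M; apply: Pm.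
    * by move=> k h3 h4 M H l; apply: Pm M _.
  + by move=> j h2 h3 M H k l; apply: Pm M _.
- by move=> i h1 h2 M H j k l; apply: Pm M _.
Qed.

End For4.
End Fill.

Section Modules.
Variables (n : nat) (g : nat -> nat) (e : rel 'I_n).
Hypothesis gE : forall i j : 'I_n, g (i * n + j) = e i j.
Notation den := (den n g).
Notation tr := (tr n g).
Notation eval := (eval n g).
Notation aset := (aset n).

Definition quad (i j k l : 'I_n) : {set 'I_n} := [set i; j; k; l].

Definition closure_of (U Q C : {set 'I_n}) := [/\ Q \subset C, module e U C &
  forall M, module e U M -> Q \subset M -> C \subset M].

Lemma tr_ESplit h (x : 'I_n) U C : aset aAlive h = U -> aset aCur h = C -> hv h 1 = x ->
  tr h ESplit = [&& x \in U, x \notin C & [exists u, exists v, [&& u \in C, v \in C, e u x & ~~ e v x]]].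
Proof.
move=> hU hC h1; rewrite !tr_and tr_not !(aset_tr _ _ h1) hU hC; congr [&& _, _ & _].
rewrite tr_any; apply: eq_existsb => u; rewrite tr_any; apply: eq_existsb => v.
rewrite !tr_and tr_not (@aset_tr _ _ _ 3 _ u) // (@aset_tr _ _ _ 4 _ v) // !aset_setv hC.
by rewrite (@tr_adj _ _ e _ _ 3 1 u x) // (@tr_adj _ _ e _ _ 4 1 v x) // -andbA.
Qed.

(** A vertex that distinguishes two members belongs to every module around the quadruple. A round
    that starts from a set that is not a module adds a vertex, so after t rounds the set is a module
    or has at least t elements; n rounds suffice. *)
Lemma closure_progP h U (i j k l : 'I_n) : aset aAlive h = U ->
  hv h 10 = i -> hv h 11 = j -> hv h 12 = k -> hv h 13 = l -> quad i j k l \subset U ->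
  closure_of U (quad i j k l) (aset aCur (den closure_prog h)).
Proof.
move=> hU h10 h11 h12 h13 QU; rewrite /closure_prog den_seq.
set Q := quad i j k l in QU *.
set h0 := den (CForN 1 _) h.
have h0U : aset aAlive h0 = U by rewrite aset_frame.
have h0C : aset aCur h0 = Q.
  rewrite aset_fill //; apply/setP => x; rewrite !inE !tr_or !tr_eq /= /upd /= h10 h11 h12 h13.
  by rewrite orbA.
pose good (C : {set 'I_n}) := [/\ Q \subset C, C \subset U & forall M, module e U M -> Q \subset M -> C \subset M].
pose I t h1 := [/\ aset aAlive h1 = U, good (aset aCur h1) &
  module e U (aset aCur h1) \/ t <= #|aset aCur h1|].
suff [IU [I1 I2 I3] I4] : I n (den (CForN 2 (CForN 1 (CIf ESplit (CArr aCur (EV 1) (EC 1)) CSkip))) h0).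
  split=> //; case: I4 => // le; split=> // x u v _.
  have /eqP -> : aset aCur (den (CForN 2 (CForN 1 (CIf ESplit (CArr aCur (EV 1) (EC 1)) CSkip))) h0) == setT.
    by rewrite eqEcard subsetT cardsT card_ord.
  by rewrite inE.
rewrite den_forN; apply: loop_ind.
  by split=> //; [rewrite h0C; split|right].
move=> t h1 tn [hU1 [G1 G2 G3] G4].
set C1 := aset aCur h1 in G1 G2 G3 G4 *.
pose split_by (C : {set 'I_n}) (x : 'I_n) := [exists u, exists v, [&& u \in C, v \in C, e u x & ~~ e v x]].
pose K j0 h2 := [/\ aset aAlive h2 = U, good (aset aCur h2), C1 \subset aset aCur h2 &
  forall x : 'I_n, x < j0 -> x \in U -> split_by C1 x -> x \in aset aCur h2].
have [K1 [K2 K3 K4] K5 K6] : K n (den (CForN 1 (CIf ESplit (CArr aCur (EV 1) (EC 1)) CSkip)) (setv h1 2 t)).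
  rewrite den_forN; apply: loop_ind; first by split.
  move=> m h2 mn [L1 [L2 L3 L4] L5 L6]; pose x := Ordinal mn.
  rewrite den_if (tr_ESplit (x := x) (U := U) (C := aset aCur h2)) //.
  have mS (C : {set 'I_n}) : C1 \subset C -> split_by C1 x -> split_by C x.
    move=> CC /existsP [u /existsP [v /and4P [uC vC ux vx]]].
    by apply/existsP; exists u; apply/existsP; exists v; rewrite !(subsetP CC) ?ux.
  have lt_x (y : 'I_n) : y < m.+1 -> y < m \/ y = x.
    by rewrite ltnS leq_eqVlt => /orP [/eqP E|]; [right; apply: val_inj|left].
  case: ifP => [/and3P [xU xC xs]|H]; last first.
    split=> // y /lt_x [/L6//|-> xU xs]; apply: contraFT H => xC.
    by rewrite xU xC; exact: mS L5 xs.
  have CE : aset aCur (den (CArr aCur (EV 1) (EC 1)) (setv h2 1 m)) = x |: aset aCur h2.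
    apply/setP => y; rewrite !inE den_arr /= /upd /= -[y == x]val_eqE /=.
    by case: (nat_of_ord y == m).
  rewrite /K CE; split.
  - by rewrite aset_frame.
  - split; [exact: subset_trans L2 (subsetUr _ _)|by rewrite subUset sub1set xU|].
    move=> M mM QM; rewrite subUset L4 // andbT sub1set; apply: contraT => xM.
    case/existsP: xs => u /existsP [v /and4P [uC vC ux]].
    have CM := L4 M mM QM; case: mM => _ H.
    by rewrite -(H x u v) ?ux // (subsetP CM).
  - exact: subset_trans L5 (subsetUr _ _).
  - by move=> y /lt_x [yx yU ys|-> _ _]; rewrite in_setU1 ?eqxx // L6 ?orbT.
split=> //; set C2 := aset aCur _ in K2 K3 K4 K5 K6 *.
case: (boolP [exists x in U, (x \notin C1) && split_by C1 x]) => [/exists_inP [x xU /andP [xC xs]]|no].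
  have xC2 : x \in C2 by apply: K6.
  right; case: G4 => [[_ H]|le]; last first.
    apply: leq_ltn_trans le _; apply: proper_card; rewrite properE K5.
    by apply/subsetPn; exists x.
  case/existsP: xs => u /existsP [v /and4P [uC vC ux vx]].
  by move: vx; rewrite -(H x u v xU xC uC vC) ux.
have m1 : module e U C1.
  split=> // x u v xU xC uC vC.
  have nos w w' : w \in C1 -> w' \in C1 -> e w x -> e w' x.
    move=> wC wC' wx; apply: contraNT no => nw; apply/exists_inP; exists x; rewrite // xC.
    by apply/existsP; exists w; apply/existsP; exists w'; rewrite wC wC' wx.
  by apply/idP/idP; exact: nos.
have -> : C2 = C1 by apply/eqP; rewrite eqEsubset K5 K4.
by left.
Qed.

End Modules.

(** * The algorithm *)

Definition aTmp : 'I_16 := @Ordinal 16 9 isT.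

(* Variable 22 tells whether two legs have been found, variable 34 whether three
   vertices have been found to replace the module aBest, and variables 32 and 33
   hold the outcomes of aBest with Dominator moving first and second. *)
Definition ENeq i j := ENot (EEq (EV i) (EV j)).

Definition EUniq4 := EAnd (EAnd (ENeq 10 11) (EAnd (ENeq 10 12) (ENeq 10 13)))
  (EAnd (EAnd (ENeq 11 12) (ENeq 11 13)) (ENeq 12 13)).

Definition find_body :=
  CIf (EAnd (EAnd (EAnd (EA aAlive (EV 10)) (EA aAlive (EV 11)))
                  (EAnd (EA aAlive (EV 12)) (EA aAlive (EV 13)))) EUniq4)
  (CSeq closure_prog (CSeq (CSet 21 (ESum 1 (EBool (EA aCur (EV 1)))))
    (CIf (ELt (EV 21) (EV 20))
      (CSeq (CSet 20 (EV 21)) (CForN 1 (CArr aBest (EV 1) (EA aCur (EV 1)))))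
      CSkip)))
  CSkip.

(* Finds a smallest module with at least four vertices (array aBest); its size
   goes to variable 20, which is n + 1 if there is none. *)
Definition find_prog := CSeq (CSet 20 (EAdd EN (EC 1))) (for4 find_body).

Definition ELeaf k s := EAnd (EA aBest (EV k)) (EAnd (EA aBest (EV s)) (EAnd (EAdj k s)
  (EAll 1 (EImp (EA aBest (EV 1)) (EImp (EAdj s 1) (EEq (EV 1) (EV k))))))).

Definition ELegs := EAnd EUniq4 (EAnd (ELeaf 10 11) (EAnd (ELeaf 12 13)
  (EAll 1 (EImp (EA aBest (EV 1))
     (EImp (EAnd (EAnd (ENeq 1 10) (ENeq 1 11)) (EAnd (ENeq 1 12) (ENeq 1 13)))
           (EEq (EAdj 1 10) (EAdj 1 12))))))).

Definition legs_body :=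
  CIf (EAnd (ENot (EV 22)) ELegs)
  (CSeq (CArr aAlive (EV 12) (EC 0)) (CSeq (CArr aAlive (EV 13) (EC 0)) (CSet 22 (EC 1))))
  CSkip.

Definition legs_prog := CSeq (CSet 22 (EC 0)) (for4 legs_body).

Definition ENearly k s := EAnd (EA aBest (EV k)) (EAnd (EA aBest (EV s)) (EAnd (ENeq s k)
  (EAnd (EAll 1 (EImp (EA aBest (EV 1)) (EImp (ENeq 1 s) (EAdd (EEq (EV 1) (EV k)) (EAdj k 1)))))
  (EAnd (ENot (EAdj k s)) (ELt (EC 1) (ESum 1 (EBool (EAnd (EA aBest (EV 1)) (EAdj s 1))))))))).

Definition ETwoNearly := ESum 10 (ESum 11 (ESum 12 (ESum 13
  (EAnd (ENeq 10 12) (EAnd (ENearly 10 11) (ENearly 12 13)))))).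

(** The test for nearly universal vertices comes first, since such a module may be too large for the
    dynamic programming. *)
Definition type_prog :=
  CIf ETwoNearly (CSeq (CSet 32 (EC 1)) (CSet 33 (EC 1)))
  (CSeq (CForN 1 (CArr aIn (EV 1) (EA aBest (EV 1))))
  (CSeq brute_prog (CSeq (CSet 32 (EV 30)) (CSet 33 (EV 31))))).

(** The new vertex set is built in [aTmp] and then copied, so that no array is read while it is
    being filled. *)
Definition three_inner :=
  CSeq (CForN 1 (CArr aIn (EV 1) (EAdd (EEq (EV 1) (EV 10)) (EAdd (EEq (EV 1) (EV 11)) (EEq (EV 1) (EV 12))))))
  (CSeq brute_prog
  (CIf (EAnd (EEq (EV 30) (EV 32)) (EEq (EV 31) (EV 33)))
    (CSeq (CSet 34 (EC 1))
    (CSeq (CForN 1 (CArr aTmp (EV 1) (EAnd (EA aAlive (EV 1)) (EAdd (ENot (EA aBest (EV 1))) (EA aIn (EV 1))))))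
          (CForN 1 (CArr aAlive (EV 1) (EA aTmp (EV 1))))))
    CSkip)).

(** Variable 12 may repeat 10 or 11, which allows replacements by two vertices. *)
Definition three_body :=
  CIf (EAnd (ENot (EV 34)) (EAnd (EAnd (EA aBest (EV 10)) (EAnd (EA aBest (EV 11)) (EA aBest (EV 12)))) (ENeq 10 11)))
  three_inner CSkip.

Definition three_prog := CSeq (CSet 34 (EC 0)) (for4 three_body).

Definition reduce_prog := CIf (EV 22) CSkip (CSeq type_prog three_prog).

Definition tail_prog := CIf (ELt (EV 20) (EAdd EN (EC 1))) (CSeq legs_prog reduce_prog) CSkip.

Definition round_prog := CSeq find_prog tail_prog.

(** Variable 0 is register 1, where the input names the first player. *)
Definition answer_prog :=
  CSeq (CForN 1 (CArr aIn (EV 1) (EA aAlive (EV 1))))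
  (CSeq brute_prog (CIf (EV 0) (CSet 40 (EV 30)) (CSet 40 (EV 31)))).

Definition main_prog :=
  CSeq (CForN 1 (CArr aAlive (EV 1) (EC 1))) (CSeq (CForN 5 round_prog) answer_prog).

(** * Correctness of the algorithm *)

Section Algorithm.
Variables (n : nat) (g : nat -> nat) (e : rel 'I_n).
Hypothesis gE : forall i j : 'I_n, g (i * n + j) = e i j.
Hypotheses (esym : symmetric e) (eirr : irreflexive e).
Notation den := (den n g).
Notation tr := (tr n g).
Notation eval := (eval n g).
Notation aset := (aset n).

Lemma tr_neq h i j (x y : 'I_n) : hv h i = x -> hv h j = y -> tr h (ENeq i j) = (x != y).
Proof. by move=> hx hy; rewrite tr_not tr_eq /= hx hy. Qed.

Lemma tr_uniq4 h (i j k l : 'I_n) : hv h 10 = i -> hv h 11 = j -> hv h 12 = k -> hv h 13 = l ->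
  tr h EUniq4 = uniq [:: i; j; k; l].
Proof.
move=> h0 h1 h2 h3; rewrite !tr_and (tr_neq h0 h1) (tr_neq h0 h2) (tr_neq h0 h3) (tr_neq h1 h2)
  (tr_neq h1 h3) (tr_neq h2 h3) /= !inE !negb_or !andbT.
by do 6 case: eqP.
Qed.

Lemma four_elements (M : {set 'I_n}) : 3 < #|M| ->
  exists i j k l, uniq [:: i; j; k; l] /\ quad i j k l \subset M.
Proof.
rewrite cardE; have := enum_uniq M; have := mem_enum M.
case: (enum M) => [|i [|j [|k [|l s]]]] //= E U _; exists i, j, k, l; split.
  have := U; rewrite !inE !negb_or; case/and5P => /and4P [-> -> -> _] /and3P [-> -> _] /andP [-> _] _ _ //.
by rewrite /quad !subUset !sub1set -!E !inE !eqxx ?orbT.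
Qed.

(** Every module with at least four vertices contains the closure of any four of them, so the
    smallest closure of a quadruple is a smallest such module. *)
Lemma find_progP h U : aset aAlive h = U -> let h' := den find_prog h in
  [/\ hv h' 20 = n.+1 \/ [/\ module e U (aset aBest h'), 3 < #|aset aBest h'| & hv h' 20 = #|aset aBest h'|] &
    forall M, module e U M -> 3 < #|M| -> hv h' 20 <= #|M|].
Proof.
move=> hU h'; rewrite /h' /find_prog den_seq den_set; set h0 := setv _ _ _.
pose J h1 := aset aAlive h1 = U /\ (hv h1 20 = n.+1 \/
  [/\ module e U (aset aBest h1), 3 < #|aset aBest h1| & hv h1 20 = #|aset aBest h1|]).
pose P (i j k l : 'I_n) h1 := uniq [:: i; j; k; l] -> quad i j k l \subset U ->
  forall M, module e U M -> quad i j k l \subset M -> hv h1 20 <= #|M|.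
pose mono4 (h1 h2 : hstate) := hv h2 20 <= hv h1 20.
have [||||||||[J1 J2] H] := @for4P n g J mono4 _ _ find_body P h0; rewrite ?/mono4 //.
- by move=> h1 h2 h3 H1 H2; exact: leq_trans H2 H1.
- by move=> h1 x m; rewrite !inE => /or4P [] /eqP ->.
- by move=> h1 x m; rewrite !inE => /or4P [] /eqP ->.
- move=> i j k l h1 [J1 J2] h10 h11 h12 h13.
  rewrite /find_body den_if tr_and (tr_uniq4 h10 h11 h12 h13) !tr_and.
  rewrite (aset_tr _ _ h10) (aset_tr _ _ h11) (aset_tr _ _ h12) (aset_tr _ _ h13) J1.
  case: ifP => [/andP [inU U4]|ninU]; last first.
    split=> // U4 QU; move: ninU QU; rewrite U4 andbT /quad !subUset !sub1set.
    by rewrite -!andbA => ->.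
  have QU : quad i j k l \subset U by rewrite /quad !subUset !sub1set -!andbA in inU *.
  have := closure_progP gE J1 h10 h11 h12 h13 QU; rewrite den_seq.
  have : aset aAlive (den closure_prog h1) = U by rewrite aset_frame.
  have : aset aBest (den closure_prog h1) = aset aBest h1 by rewrite aset_frame.
  have : hv (den closure_prog h1) 20 = hv h1 20 by rewrite frame_v.
  set h2 := den closure_prog h1; set C := aset aCur h2 => E20 EB EU [QC mC minC].
  have C4 : 3 < #|C|.
    apply: leq_trans (subset_leq_card QC).
    have -> : quad i j k l = [set x in [:: i; j; k; l]] by apply/setP => x; rewrite !inE -!orbA.
    by rewrite cardsE (card_uniqP U4).
  rewrite den_seq den_set eval_count.
  have -> : [set j0 : 'I_n | tr (setv h2 1 j0) (EA aCur (EV 1))] = C.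
    by apply/setP => x; rewrite !inE.
  set h3 := setv h2 21 _; rewrite den_if tr_lt.
  have -> : eval h3 (EV 21) = #|C| by [].
  have -> : eval h3 (EV 20) = hv h1 20 by [].
  case: ifP => lt; last first.
    split; last by rewrite /mono4 -E20; exact: leqnn.
      by rewrite -E20 -EB in J2; split; [exact: EU|exact: J2].
    move=> _ _ M mM QM; suff : hv h1 20 <= #|M| by rewrite -E20.
    by apply: leq_trans (subset_leq_card (minC M mM QM)); rewrite leqNgt lt.
  rewrite den_seq den_set; set h4 := setv h3 20 _; set h5 := den _ h4.
  have h5B : aset aBest h5 = C.
    by rewrite /h5 aset_fill //; apply/setP => x; rewrite !inE.
  have h5_20 : hv h5 20 = #|C| by rewrite /h5 frame_v.
  have h5U : aset aAlive h5 = U by rewrite /h5 aset_frame.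
  split; rewrite ?/mono4 ?h5_20 ?(ltnW lt) //.
    by split=> //; right; rewrite h5B.
  by move=> _ _ M mM QM; rewrite h5_20; exact: subset_leq_card (minC M mM QM).
- by move=> i j k l h1 h2 H1 H2 U4 QU M mM QM; apply: leq_trans H1 _; exact: H2.
- by split=> //; left; rewrite /= /upd /= addn1.
split=> // M mM M4; have [i [j [k [l [U4 QM]]]]] := four_elements M4.
by apply: (H i j k l) => //; apply: subset_trans QM _; case: mM.
Qed.

(** The bounds keep [a] and [b] apart from the bound variable 1 and from the reserved variable
    63. *)
Lemma tr_leaf h B a b (k s : 'I_n) : aset aBest h = B -> 1 < a < 63 -> 1 < b < 63 ->
  hv h a = k -> hv h b = s -> tr h (ELeaf a b) = leaf e B k s.
Proof.
move=> hB /andP [a1 a63] /andP [b1 b63] ha hb; rewrite /ELeaf !tr_and !(aset_tr _ _ ha) !(aset_tr _ _ hb) hB.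
have a63' : a != 63 by rewrite neq_ltn a63.
have b63' : b != 63 by rewrite neq_ltn b63.
rewrite (tr_adj gE a63' ha hb); congr [&& _, _, _ & _].
rewrite tr_all; apply: eq_forallb => w.
have wa : hv (setv h 1 w) a = k by rewrite /= upd_diff // gtn_eqF.
have wb : hv (setv h 1 w) b = s by rewrite /= upd_diff // gtn_eqF.
rewrite !tr_imp (@aset_tr _ _ _ _ _ w) ?aset_setv // hB tr_eq.
have -> : eval (setv h 1 w) (EV a) = k by exact: wa.
by rewrite (tr_adj gE b63' wb (erefl _ : hv (setv h 1 w) 1 = w)).
Qed.

Lemma tr_legs h B (k1 s1 k2 s2 : 'I_n) : aset aBest h = B ->
  hv h 10 = k1 -> hv h 11 = s1 -> hv h 12 = k2 -> hv h 13 = s2 ->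
  tr h ELegs = legs e B k1 s1 k2 s2.
Proof.
move=> hB h10 h11 h12 h13; rewrite /ELegs tr_and (tr_uniq4 h10 h11 h12 h13) tr_and (tr_leaf hB (isT : 1 < 10 < 63) (isT : 1 < 11 < 63) h10 h11).
rewrite tr_and (tr_leaf hB (isT : 1 < 12 < 63) (isT : 1 < 13 < 63) h12 h13); congr [&& _, _, _ & _].
rewrite tr_all; apply: eq_forallb => w.
have w1 : hv (setv h 1 w) 1 = w by [].
rewrite !tr_imp (aset_tr _ _ w1) aset_setv hB; congr (_ ==> _).
have [w10 w11] : hv (setv h 1 w) 10 = k1 /\ hv (setv h 1 w) 11 = s1 by [].
have [w12 w13] : hv (setv h 1 w) 12 = k2 /\ hv (setv h 1 w) 13 = s2 by [].
rewrite !tr_and (tr_neq w1 w10) (tr_neq w1 w11) (tr_neq w1 w12) (tr_neq w1 w13).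
rewrite !inE !negb_or -andbA; congr (_ ==> _).
rewrite tr_eq (@eval_adj _ _ _ gE _ 1 10 w k1) // (@eval_adj _ _ _ gE _ 1 12 w k2) //.
by case: (e w k1); case: (e w k2).
Qed.

Lemma legs_progP h U B : aset aAlive h = U -> aset aBest h = B -> let h' := den legs_prog h in
  [/\ hv h' 22 = 0, aset aAlive h' = U & forall k1 s1 k2 s2, ~~ legs e B k1 s1 k2 s2] \/
  hv h' 22 = 1 /\ exists k1 s1 k2 s2, legs e B k1 s1 k2 s2 /\ aset aAlive h' = U :\ k2 :\ s2.
Proof.
move=> hU hB h'; rewrite /h' /legs_prog den_seq den_set; set h0 := setv _ _ _.
pose J h1 := aset aBest h1 = B /\ (hv h1 22 = 0 /\ aset aAlive h1 = U \/
  hv h1 22 = 1 /\ exists k1 s1 k2 s2, legs e B k1 s1 k2 s2 /\ aset aAlive h1 = U :\ k2 :\ s2).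
pose P (k1 s1 k2 s2 : 'I_n) h1 := hv h1 22 = 0 -> ~~ legs e B k1 s1 k2 s2.
pose mono4 (h1 h2 : hstate) := hv h2 22 = 0 -> hv h1 22 = 0.
have [||||||||[J1 J2] H] := @for4P n g J mono4 _ _ legs_body P h0; rewrite ?/mono4 //.
- by move=> h1 h2 h3 H1 H2 /H2 /H1.
- by move=> h1 x m; rewrite !inE => /or4P [] /eqP ->.
- by move=> h1 x m; rewrite !inE => /or4P [] /eqP ->.
- move=> k1 s1 k2 s2 h1 [J1 J2] h10 h11 h12 h13.
  rewrite /legs_body den_if tr_and tr_not (tr_legs J1 h10 h11 h12 h13) trE [eval _ _]/= negbK.
  case: ifP => [/andP [/eqP h22 L]|nL]; last first.
    split=> // h22; apply: contraFN nL => ->; rewrite andbT.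
    by apply/eqP.
  have EA' : aset aAlive (den (CSeq (CArr aAlive (EV 12) (EC 0)) (CSeq (CArr aAlive (EV 13) (EC 0)) (CSet 22 (EC 1)))) h1) = U :\ k2 :\ s2.
    case: J2 => [[_ <-]|[]]; last by rewrite h22.
    apply/setP => x; rewrite !inE /= h12 h13.
    rewrite -[x == k2]val_eqE -[x == s2]val_eqE /=.
    by case: (nat_of_ord x == s2); case: (nat_of_ord x == k2).
  by split=> //; split=> //; right; split=> //; exists k1, s1, k2, s2; rewrite EA'.
- by move=> i j k l h1 h2 M H h22; apply: H; exact: M.
- by split=> //; left.
case: J2 => [[J2 J3]|[J2 J3]]; [left|right]; split=> //.
by move=> k1 s1 k2 s2; exact: H.
Qed.

Lemma tr_nearly h B a b (k s : 'I_n) : aset aBest h = B -> 1 < a < 63 -> 1 < b < 63 ->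
  hv h a = k -> hv h b = s -> tr h (ENearly a b) = nearly_universal e B k s.
Proof.
move=> hB /andP [a1 a63] /andP [b1 b63] ha hb.
rewrite /ENearly !tr_and !(aset_tr _ _ ha) !(aset_tr _ _ hb) hB (tr_neq hb ha) tr_not.
have a63' : a != 63 by rewrite neq_ltn a63.
have b63' : b != 63 by rewrite neq_ltn b63.
rewrite (tr_adj gE a63' ha hb) tr_lt eval_count; congr [&& _, _, _, _, _ & _].
  rewrite tr_all; apply: eq_forallb => w.
  have w1 : hv (setv h 1 w) 1 = w by [].
  have wa : hv (setv h 1 w) a = k by rewrite /= upd_diff // gtn_eqF.
  have wb : hv (setv h 1 w) b = s by rewrite /= upd_diff // gtn_eqF.
  rewrite 2!tr_imp (aset_tr _ _ w1) aset_setv hB (tr_neq w1 wb) tr_or tr_eq (tr_adj gE a63' wa w1).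
  by have -> : eval (setv h 1 w) (EV a) = k by exact: wa.
congr (1 < _); apply: eq_card => w; rewrite !inE.
have w1 : hv (setv h 1 w) 1 = w by [].
have wb : hv (setv h 1 w) b = s by rewrite /= upd_diff // gtn_eqF.
by rewrite tr_and (aset_tr _ _ w1) aset_setv hB (tr_adj gE b63' wb w1).
Qed.

Lemma tr_two_nearly h B : aset aBest h = B ->
  tr h ETwoNearly <-> exists k1 s1 k2 s2, [/\ k1 != k2, nearly_universal e B k1 s1 & nearly_universal e B k2 s2].
Proof.
move=> hB.
have E (k1 s1 k2 s2 : 'I_n) : tr (setv (setv (setv (setv h 10 k1) 11 s1) 12 k2) 13 s2)
    (EAnd (ENeq 10 12) (EAnd (ENearly 10 11) (ENearly 12 13))) =
    [&& k1 != k2, nearly_universal e B k1 s1 & nearly_universal e B k2 s2].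
  by rewrite tr_and (@tr_neq _ 10 12 k1 k2) // tr_and (@tr_nearly _ B 10 11 k1 s1) // (@tr_nearly _ B 12 13 k2 s2).
split.
  rewrite tr_any => /existsP [k1]; rewrite tr_any => /existsP [s1].
  rewrite tr_any => /existsP [k2]; rewrite tr_any => /existsP [s2]; rewrite E => /and3P [H1 H2 H3].
  by exists k1, s1, k2, s2.
case=> k1 [s1 [k2 [s2 [H1 H2 H3]]]].
rewrite tr_any; apply/existsP; exists k1; rewrite tr_any; apply/existsP; exists s1.
rewrite tr_any; apply/existsP; exists k2; rewrite tr_any; apply/existsP; exists s2.
by rewrite E H1 H2.
Qed.

Lemma type_progP h B : aset aBest h = B ->
  hv (den type_prog h) 32 = out e B true /\ hv (den type_prog h) 33 = out e B false.
Proof.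
move=> hB; rewrite /type_prog den_if; case: ifP => [/(tr_two_nearly hB)|_].
  by case=> k1 [s1 [k2 [s2 [H1 H2 H3]]]]; rewrite !(out_nearly_universal esym eirr _ H1 H2 H3).
rewrite den_seq; set h1 := den _ h.
have h1B : aset aIn h1 = B by rewrite /h1 aset_fill // -hB; apply/setP => x; rewrite !inE.
rewrite den_seq; move: (den brute_prog h1) (brute_progP gE h1B) => h2 [E1 E2].
by rewrite den_seq !den_set /= /upd /= E1 E2.
Qed.

Lemma type_prog_ok M h B : aset aBest h = B -> ~ (exists k1 s1 k2 s2,
    [/\ k1 != k2, nearly_universal e B k1 s1 & nearly_universal e B k2 s2]) -> 3 ^ #|B| <= M ->
  ok n g M type_prog h.
Proof.
move=> hB no leM; apply: ok_if => [/(tr_two_nearly hB)//|_].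
have h1B : aset aIn (den (CForN 1 (CArr aIn (EV 1) (EA aBest (EV 1)))) h) = B.
  by rewrite aset_fill // -hB; apply/setP => x; rewrite !inE.
by split; [|split; [exact: brute_prog_ok h1B leM|]].
Qed.

Definition represents (B : {set 'I_n}) (u v w : 'I_n) := [&& u \in B, v \in B, w \in B, u != v,
  out e [set u; v; w] true == out e B true & out e [set u; v; w] false == out e B false].

Lemma three_bodyP h B U (u v w : 'I_n) : aset aBest h = B -> aset aAlive h = U -> B \subset U ->
  hv h 32 = out e B true -> hv h 33 = out e B false -> hv h 34 = 0 ->
  hv h 10 = u -> hv h 11 = v -> hv h 12 = w ->
  if represents B u v w
  then hv (den three_body h) 34 = 1 /\ aset aAlive (den three_body h) = (U :\: B) :|: [set u; v; w]
  else hv (den three_body h) 34 = 0 /\ aset aAlive (den three_body h) = U.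
Proof.
move=> hB hU BU h32 h33 h34 h10 h11 h12.
have -> : den three_body h = if [&& u \in B, v \in B, w \in B & u != v]
    then den three_inner h else setv h 61 0.
  rewrite /three_body den_if 3!tr_and tr_not (tr_neq h10 h11) tr_and.
  rewrite (aset_tr _ _ h10) (aset_tr _ _ h11) (aset_tr _ _ h12) hB.
  by have -> : tr h (EV 34) = false by [rewrite trE /= h34]; rewrite -!andbA.
case: (boolP [&& u \in B, v \in B, w \in B & u != v]) => [/and4P [uB vB wB uv]|no]; last first.
  by have -> : represents B u v w = false by apply: contraNF no => /and5P [-> -> -> -> _].
have -> : represents B u v w = (out e [set u; v; w] true == out e B true) &&
    (out e [set u; v; w] false == out e B false) by rewrite /represents uB vB wB uv.
rewrite /three_inner.
rewrite den_seq; set h1 := den (CForN _ _) h.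
have h1I : aset aIn h1 = [set u; v; w].
  rewrite /h1 aset_fill //; apply/setP => x; rewrite !inE tr_or tr_or !tr_eq /= /upd /= h10 h11 h12.
  by rewrite orbA.
have h1B : aset aBest h1 = B by rewrite /h1 aset_frame.
have h1U : aset aAlive h1 = U by rewrite /h1 aset_frame.
have [e32 e33 e34] : [/\ hv h1 32 = hv h 32, hv h1 33 = hv h 33 & hv h1 34 = hv h 34].
  by rewrite /h1 !frame_v.
rewrite den_seq; have := brute_progP gE h1I.
have : [/\ aset aBest (den brute_prog h1) = B, aset aAlive (den brute_prog h1) = U & aset aIn (den brute_prog h1) = [set u; v; w]].
  by split; rewrite (@aset_frame n g _ brute_prog).
have : [/\ hv (den brute_prog h1) 32 = hv h1 32, hv (den brute_prog h1) 33 = hv h1 33 & hv (den brute_prog h1) 34 = hv h1 34].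
  by split; rewrite (@frame_v n g brute_prog).
move: (den brute_prog h1) => h2 [f32 f33 f34] [h2B h2U h2I] [f30 f31].
rewrite den_if tr_and !tr_eq.
have -> : (eval h2 (EV 30) == eval h2 (EV 32)) = (out e [set u; v; w] true == out e B true).
  by rewrite /= f30 f32 e32 h32; case: (out _ _ _); case: (out _ _ _).
have -> : (eval h2 (EV 31) == eval h2 (EV 33)) = (out e [set u; v; w] false == out e B false).
  by rewrite /= f31 f33 e33 h33; case: (out _ _ _); case: (out _ _ _).
case: (_ && _); last by split; [exact: (etrans f34 (etrans e34 h34))|exact: h2U].
rewrite den_seq den_set; set h3 := setv h2 34 _; rewrite den_seq; set h4 := den (CForN _ _) h3.
split; first by rewrite frame_v // /h4 frame_v.
rewrite aset_fill //; apply/setP => x; rewrite !inE.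
have : x \in aset aTmp h4 = (x \in (U :\: B) :|: [set u; v; w]).
  rewrite /h4 aset_fill // inE tr_and tr_or tr_not.
  have x1 : hv (setv h3 1 x) 1 = x by [].
  rewrite !(aset_tr _ _ x1) !aset_setv h2U h2B h2I in_setU in_setD.
  case xU: (x \in U); rewrite ?andbT //= andbF /=; symmetry; apply/negP.
  by rewrite !inE -orbA => /or3P [] /eqP E; move: xU; rewrite E (subsetP BU).
by rewrite !inE => <-.
Qed.

(** Only the first suitable triple is used, as it raises the flag; if the flag were still down at
    the end, every triple would have failed, against [out_three]. *)
Lemma three_progP h B U : aset aBest h = B -> aset aAlive h = U -> B \subset U -> 1 < #|B| ->
  hv h 32 = out e B true -> hv h 33 = out e B false ->
  exists u v w, represents B u v w /\
    aset aAlive (den three_prog h) = (U :\: B) :|: [set u; v; w].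
Proof.
move=> hB hU BU B2 h32 h33; rewrite den_seq den_set; set h0 := setv _ _ _.
pose J h1 := [/\ aset aBest h1 = B, hv h1 32 = out e B true, hv h1 33 = out e B false &
  hv h1 34 = 0 /\ aset aAlive h1 = U \/ hv h1 34 = 1 /\ exists u v w, represents B u v w /\
    aset aAlive h1 = (U :\: B) :|: [set u; v; w]].
pose P (u v w _ : 'I_n) h1 := hv h1 34 = 0 -> ~~ represents B u v w.
pose mono4 (h1 h2 : hstate) := hv h2 34 = 0 -> hv h1 34 = 0.
have [||||||||[J1 _ _ J2] H] := @for4P n g J mono4 _ _ three_body P h0; rewrite ?/mono4 //.
- by move=> h1 h2 h3 H1 H2 /H2 /H1.
- by move=> h1 x m; rewrite !inE => /or4P [] /eqP ->.
- by move=> h1 x m; rewrite !inE => /or4P [] /eqP ->.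
- move=> u v w l h1 [J1 J2 J3 J4] h10 h11 h12 _.
  have F : [/\ aset aBest (den three_body h1) = B, hv (den three_body h1) 32 = out e B true &
      hv (den three_body h1) 33 = out e B false] by rewrite aset_frame // !frame_v.
  case: J4 => [[h34 J4]|[h34 J4]].
    have := three_bodyP J1 J4 BU J2 J3 h34 h10 h11 h12.
    move: (den three_body h1) F => h2 [F1 F2 F3]; rewrite /P.
    case: ifP => [rp [E1 E2]|nrp [E1 E2]]; split=> //; last 1 first.
    + by split=> //; left.
    + by split=> //; right; split=> //; exists u, v, w.
    + by rewrite E1.
  have -> : den three_body h1 = setv h1 61 0.
    by rewrite /three_body den_if tr_and tr_not trE [eval _ _]/= h34.
  by split; rewrite /P //= /upd /= ?h34 //; split=> //; right.
- by move=> i j k l h1 h2 M H h34; apply: H; exact: M.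
- by split=> //; left.
case: J2 => [[h34 _]|[_ //]].
have [u [v [w [uB vB wB uv E]]]] := out_three esym eirr B2.
by have := H u v w u h34; rewrite /represents uB vB wB uv !E !eqxx.
Qed.

Lemma card_setU3 (A1 A2 A3 : {set 'I_n}) : #|A1| <= 1 -> #|A2| <= 1 -> #|A3| <= 1 ->
  #|A1 :|: (A2 :|: A3)| <= 3.
Proof. by rewrite !cardsU => H1 H2 H3; clear -H1 H2 H3; lia. Qed.

Lemma three_body_ok M h : 27 <= M -> ok n g M three_body h.
Proof.
move=> M27; apply: ok_if => _; last by [].
split; first by [].
split; last by apply: ok_if.
set h1 := den _ h; apply: brute_prog_ok (erefl _) _.
apply: leq_trans M27; rewrite -[27]/(3 ^ 3) leq_exp2l //.
have one a : #|[set x : 'I_n | nat_of_ord x == a]| <= 1.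
  by apply/card_le1_eqP => x y; rewrite !inE => /eqP <- /eqP /val_inj.
have -> : aset aIn h1 = [set x : 'I_n | nat_of_ord x == hv h 10] :|:
    ([set x : 'I_n | nat_of_ord x == hv h 11] :|: [set x : 'I_n | nat_of_ord x == hv h 12]).
  by rewrite /h1 aset_fill //; apply/setP => x; rewrite !inE tr_or tr_or !tr_eq.
exact: card_setU3.
Qed.

(** This makes a smallest module of [U] minimal also among its own modules. *)
Lemma module_trans (U B M : {set 'I_n}) : module e U B -> module e B M -> module e U M.
Proof.
move=> [BU H1] [MB H2]; split; first exact: subset_trans BU.
move=> x u v xU xM uM vM; case: (boolP (x \in B)) => [xB|xB]; first exact: H2.
by apply: H1 => //; exact: (subsetP MB).
Qed.

(** * Progress of a round, and the loop bounds *)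

Section Round.
Variables (q M : nat).
Hypothesis few : forall S : {set 'I_n}, #|S| <= q -> num_P4 e S + 4 <= q.
Hypothesis leM : 3 ^ (q + 6) <= M.

Lemma M27 : 27 <= M.
Proof. by apply: leq_trans leM; rewrite -[27]/(3 ^ 3) leq_exp2l // (leq_trans (isT : 3 <= 6)) ?leq_addl. Qed.

(** There are always n rounds; the first alternative covers those that come after the graph has
    become small. *)
Definition reduced (U U' : {set 'I_n}) :=
  (forall t, out e U' t = out e U t) /\ (#|U'| <= 3 \/ #|U'| < #|U|).

(** At least two vertices of [B] remain, as the substitution requires. *)
Lemma reduce_legs (U B : {set 'I_n}) k1 s1 k2 s2 : module e U B -> 3 < #|B| -> legs e B k1 s1 k2 s2 ->
  reduced U (U :\ k2 :\ s2).
Proof.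
move=> mB B4 L; have BU : B \subset U by case: mB.
have [_ _ l2 _] := and4P L; have [k2B s2B k2s2 _] := leafP l2.
have ne : s2 != k2 by apply: contraTneq k2s2 => ->; rewrite eirr.
have c1 : #|B| = #|B :\ k2|.+1 by rewrite (cardsD1 k2 B) k2B.
have c2 : #|B :\ k2| = #|B :\ k2 :\ s2|.+1.
  by rewrite (cardsD1 s2 (B :\ k2)); have -> : s2 \in B :\ k2 by rewrite !inE ne.
have -> : U :\ k2 :\ s2 = (U :\: B) :|: (B :\ k2 :\ s2).
  apply/setP => x; rewrite !inE; case: (eqVneq x s2) => [->|xs]; rewrite ?andbF ?s2B //=.
  case: (eqVneq x k2) => [->|xk]; rewrite ?k2B //=.
  by case xB: (x \in B); rewrite ?orbF //= (subsetP BU).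
split.
  move=> t; apply: out_subst => //.
  - by rewrite !(subset_trans (subD1set _ _)) ?subD1set.
  - by move: B4; rewrite c1 c2.
  - by move=> t'; exact: out_legs L t'.
right; apply: proper_card; rewrite properE; apply/andP; split.
  by rewrite subUset subsetDl (subset_trans _ BU) // !(subset_trans (subD1set _ _)) ?subD1set.
apply/subsetPn; exists k2; first exact: (subsetP BU).
by rewrite !inE k2B eqxx andbF.
Qed.

Lemma reduce_three (U B : {set 'I_n}) u v w : module e U B -> 3 < #|B| -> represents B u v w ->
  reduced U ((U :\: B) :|: [set u; v; w]).
Proof.
move=> mB B4 /and5P [uB vB wB uv /andP [/eqP oT /eqP oF]]; have BU : B \subset U by case: mB.
split.
  move=> t; apply: out_subst => //.
  - by rewrite !subUset !sub1set uB vB.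
  - have : #|[set u; v]| <= #|[set u; v; w]| by apply: subset_leq_card; rewrite subsetUl.
    by rewrite cards2 uv.
  - by case.
right; have := cardsID B U; rewrite (setIidPr BU).
have : #|U :\: B :|: [set u; v; w]| <= #|U :\: B| + #|[set u; v; w]| by rewrite cardsU leq_subr.
have : #|[set u; v; w]| <= 3.
  have -> : [set u; v; w] = [set x in [:: u; v; w]] by apply/setP => x; rewrite !inE -!orbA.
  by rewrite cardsE card_size.
by move: B4; clear; lia.
Qed.

(** Brute force on [B] is reached only if there are no legs and no two nearly universal vertices;
    then |B| is at most 6 or at most q + 2, and its tables fit the bound [M]. *)
Lemma reduce_progP h U B : aset aBest h = B -> module e U B -> 3 < #|B| ->
  (forall M', module e B M' -> 3 < #|M'| -> M' = B) ->
  [/\ hv h 22 = 0, aset aAlive h = U & forall k1 s1 k2 s2, ~~ legs e B k1 s1 k2 s2] \/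
  hv h 22 = 1 /\ (exists k1 s1 k2 s2, legs e B k1 s1 k2 s2 /\ aset aAlive h = U :\ k2 :\ s2) ->
  ok n g M reduce_prog h /\ reduced U (aset aAlive (den reduce_prog h)).
Proof.
move=> hB mB B4 minB [[h22 hU noL]|[h22 [k1 [s1 [k2 [s2 [L hU]]]]]]]; last first.
  have t22 : tr h (EV 22) by rewrite trE /= h22.
  split; first by apply: ok_if; rewrite ?t22.
  rewrite den_if t22; have -> : aset aAlive (den CSkip h) = aset aAlive h by [].
  by rewrite hU; apply: reduce_legs L.
have t22 : tr h (EV 22) = false by rewrite trE /= h22.
have [tT tF] := type_progP hB.
have tB : aset aBest (den type_prog h) = B by rewrite aset_frame.
have tU : aset aAlive (den type_prog h) = U by rewrite aset_frame.
split.
  apply: ok_if => [|_]; first by rewrite t22.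
  split; last by split=> //; do 4 apply: ok_forN_any => ?; apply: three_body_ok; exact: M27.
  case: (leqP #|B| 6) => B7.
    case: (boolP (tr h ETwoNearly)) => tw.
      by apply: ok_if => [_|]; [exact: no_forV_ok|rewrite tw].
    apply: (type_prog_ok hB); first by move/(tr_two_nearly hB); rewrite (negPf tw).
    by apply: leq_trans leM; rewrite leq_exp2l // (leq_trans B7) // leq_addl.
  have [Bq|[k1 [s1 [k2 [s2 L]]]]|tn] := minimal_module_bound esym eirr few minB B7.
  - case: (boolP (tr h ETwoNearly)) => tw.
      by apply: ok_if => [_|]; [exact: no_forV_ok|rewrite tw].
    apply: (type_prog_ok hB); first by move/(tr_two_nearly hB); rewrite (negPf tw).
    by apply: leq_trans leM; rewrite leq_exp2l // (leq_trans Bq) // leq_add2l.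
  - by have := noL k1 s1 k2 s2; rewrite L.
  - apply: ok_if => [_|]; first exact: no_forV_ok.
    by have -> : tr h ETwoNearly by apply/(tr_two_nearly hB).
rewrite den_if t22 den_seq.
have BU : B \subset U by case: mB.
have [u [v [w [rp ->]]]] := three_progP tB tU BU (leq_trans (isT : 1 < 4) B4) tT tF.
exact: reduce_three.
Qed.

(** [U] is a module of itself, so if no module with at least four vertices is found, at most three
    vertices are alive. *)
Lemma tail_progP h U : aset aAlive h = U ->
  hv h 20 = n.+1 \/ [/\ module e U (aset aBest h), 3 < #|aset aBest h| & hv h 20 = #|aset aBest h|] ->
  (forall M', module e U M' -> 3 < #|M'| -> hv h 20 <= #|M'|) ->
  ok n g M tail_prog h /\ reduced U (aset aAlive (den tail_prog h)).
Proof.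
move=> hU fm min.
have tE : tr h (ELt (EV 20) (EAdd EN (EC 1))) = (hv h 20 < n.+1) by rewrite tr_lt /= addn1.
case: fm => [E20|[mB B4 E20]].
  rewrite E20 ltnn in tE; split; first by apply: ok_if; rewrite ?tE.
  rewrite den_if tE; have -> : aset aAlive (den CSkip h) = U by exact: hU.
  split=> //; left; rewrite leqNgt; apply/negP => U4.
  have mU : module e U U by split=> // x u v ->.
  have := min U mU U4; rewrite E20 leqNgt ltnS.
  by have := max_card (mem U); rewrite card_ord => ->.
have Bn : #|aset aBest h| < n.+1.
  by rewrite ltnS; have := max_card (mem (aset aBest h)); rewrite card_ord.
rewrite E20 Bn in tE.
have minB M' : module e (aset aBest h) M' -> 3 < #|M'| -> M' = aset aBest h.
  move=> mM' M4; have := min M' (module_trans mB mM') M4; rewrite E20 => le.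
  by apply/eqP; rewrite eqEcard le andbT; case: mM'.
have h2B : aset aBest (den legs_prog h) = aset aBest h by rewrite aset_frame.
have [ok3 red] := reduce_progP h2B mB B4 minB (legs_progP hU (erefl _)).
split; last by rewrite den_if tE den_seq.
apply: ok_if => [_|]; last by rewrite tE.
by split=> //; exact: no_forV_ok.
Qed.

Lemma round_progP h U : aset aAlive h = U ->
  ok n g M round_prog h /\ reduced U (aset aAlive (den round_prog h)).
Proof.
move=> hU; have [fm min] := find_progP hU.
have h1U : aset aAlive (den find_prog h) = U by rewrite aset_frame.
have [ok2 red] := tail_progP h1U fm min.
by split=> //; split=> //; exact: no_forV_ok.
Qed.

Lemma answer_progP h : #|aset aAlive h| <= 3 ->
  ok n g M answer_prog h /\ hv (den answer_prog h) 40 = out e (aset aAlive h) (hv h 0 != 0).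
Proof.
move=> small; rewrite /answer_prog den_seq; set h1 := den (CForN _ _) h.
have h1B : aset aIn h1 = aset aAlive h by rewrite /h1 aset_fill //; apply/setP => x; rewrite !inE.
have h10 : hv h1 0 = hv h 0 by rewrite /h1 frame_v.
split.
  split; first exact: no_forV_ok.
  split; last by apply: ok_if.
  rewrite -/h1; apply: brute_prog_ok h1B _; apply: leq_trans leM; rewrite leq_exp2l //.
  by apply: leq_trans small _; rewrite (leq_trans (isT : 3 <= 6)) ?leq_addl.
rewrite den_seq; have := brute_progP gE h1B.
have : hv (den brute_prog h1) 0 = hv h1 0 by rewrite (@frame_v n g brute_prog).
move: (den brute_prog h1) => h2 h20 [E1 E2].
rewrite den_if trE [eval _ _]/= h20 h10; case: (hv h 0 != 0); rewrite den_set /= /upd /=.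
  exact: E1.
exact: E2.
Qed.

Lemma main_progP h : ok n g M main_prog h /\
  hv (den main_prog h) 40 = out e setT (hv h 0 != 0).
Proof.
rewrite /main_prog den_seq; set h1 := den (CForN 1 _) h.
have h1U : aset aAlive h1 = setT by rewrite /h1 aset_fill //; apply/setP => x; rewrite !inE.
(* Until at most three vertices are left, each round removes at least one. *)
pose I k h' := [/\ forall t, out e (aset aAlive h') t = out e setT t &
  #|aset aAlive h'| <= 3 \/ #|aset aAlive h'| + k <= n].
have [okR [R1 R2]] : ok n g M (CForN 5 round_prog) h1 /\ I n (den (CForN 5 round_prog) h1).
  apply: forN_rule; first by split=> [t|]; rewrite h1U // cardsT card_ord addn0; right.
  move=> j h' jn [I1 I2]; have [ok1 [r1 r2]] := @round_progP (setv h' 5 j) _ (erefl _).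
  split=> //; split=> [t|]; first by rewrite r1 I1.
  case: r2 => r2; [by left|]; case: I2 => I2.
    by left; apply: leq_trans I2; apply: ltnW.
  by right; rewrite addnS -addSn; apply: leq_trans I2; rewrite leq_add2r.
have h2v : hv (den (CForN 5 round_prog) h1) 0 = hv h 0.
  by rewrite frame_v // /h1 frame_v.
have small : #|aset aAlive (den (CForN 5 round_prog) h1)| <= 3.
  by case: R2 => //; rewrite -[X in _ <= X]add0n leq_add2r leqn0 => /eqP ->.
have [okA ansA] := answer_progP small.
split; last by rewrite den_seq ansA R1 h2v.
by split; [exact: no_forV_ok|split].
Qed.

End Round.

End Algorithm.

(** * Running time *)

(** Run with n equal to the parameter k, so that the loop over 2 triples variable 1 k times. With c
    = 3 ^ 6 it then holds the base of the power, and the inner loop multiplies by it. *)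
Definition bound_prog (c K D : nat) :=
  CSeq (CSet 1 (EC c))
  (CSeq (CForN 2 (CSet 1 (EAdd (EV 1) (EAdd (EV 1) (EV 1)))))
  (CSeq (CSet 1 (EAdd (EV 1) (EC 1)))
  (CSeq (CSet 3 (EC K))
  (CSeq (CSet 4 (EC D))
  (CForV 5 4 (CSeq (CSet 6 (EC 0)) (CSeq (CForV 7 1 (CSet 6 (EAdd (EV 6) (EV 3)))) (CSet 3 (EV 6))))))))).

Lemma computable_bound K D : computable (fun k => K * (3 ^ (k + 6)).+1 ^ D).
Proof.
(* The constant is kept abstract, lest it be unfolded as a unary numeral. *)
have [c cE] : exists c, c = 3 ^ 6 by exists (3 ^ 6).
exists (Seq (comp (bound_prog c K D) 0) (Op (Move 0 (rX 3)))) => k.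
pose h0 := HState (fun=> 0) (fun _ _ => 0).
set s0 := State _ _.
pose w := (3 ^ (k + 6)).+1; pose M := k + D + w.
have sim0 : sim k 0 (fun=> 0) h0 s0 by split.
have [okB resB] : ok k (fun=> 0) M (bound_prog c K D) h0 /\ hv (den k (fun=> 0) (bound_prog c K D) h0) 3 = K * w ^ D.
  rewrite /bound_prog.
  rewrite den_seq den_set; set h1 := setv h0 1 _.
  have [o2 E2] : ok k (fun=> 0) M (CForN 2 (CSet 1 (EAdd (EV 1) (EAdd (EV 1) (EV 1))))) h1 /\
      hv (den k (fun=> 0) (CForN 2 (CSet 1 (EAdd (EV 1) (EAdd (EV 1) (EV 1))))) h1) 1 = c * 3 ^ k.
    apply: (forN_rule (I := fun j h => hv h 1 = c * 3 ^ j)); first by rewrite muln1.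
    by move=> j h _ E; split=> //; rewrite den_set /= /upd /= E expnS; lia.
  rewrite [den _ _ (CSeq _ _) h1]den_seq; set h2 := den _ _ (CForN _ _) h1 in E2 *.
  pose h3 := setv h2 1 w.
  have E3 : den k (fun=> 0) (CSet 1 (EAdd (EV 1) (EC 1))) h2 = h3.
    by rewrite den_set /= E2 cE -expnD addn1 addnC.
  pose h5 := setv (setv h3 3 K) 4 D.
  pose body := CSeq (CSet 6 (EC 0)) (CSeq (CForV 7 1 (CSet 6 (EAdd (EV 6) (EV 3)))) (CSet 3 (EV 6))).
  have step h : hv h 1 = w -> ok k (fun=> 0) M body h /\
      hv (den k (fun=> 0) body h) 1 = w /\ hv (den k (fun=> 0) body h) 3 = w * hv h 3.
    move=> h_1; set h6 := setv h 6 0.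
    have h6_1 : hv h6 1 = w by exact: h_1.
    have L : hv (den k (fun=> 0) (CForV 7 1 (CSet 6 (EAdd (EV 6) (EV 3)))) h6) 6 = w * hv h 3.
      rewrite den_forV h6_1.
      pose I j h' := hv h' 6 = j * hv h 3 /\ hv h' 3 = hv h 3.
      suff [] : I w (loop (fun j h1 => den k (fun=> 0) (CSet 6 (EAdd (EV 6) (EV 3))) (setv h1 7 j)) w h6) by [].
      apply: loop_ind; first by split.
      by move=> j h' _ [I1 I2]; split; rewrite den_set /= /upd /= ?I1 ?I2 // mulSn addnC.
    split; last first.
      split; first by rewrite frame_v.
      by rewrite /body den_seq den_set -/h6 den_seq den_set /= upd_same.
    split=> //; split=> //; split=> //.
    by rewrite -/h6 h6_1 /M leq_addl.
  have main j : hv (loop (fun j h => den k (fun=> 0) body (setv h 5 j)) j h5) 1 = w /\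
      hv (loop (fun j h => den k (fun=> 0) body (setv h 5 j)) j h5) 3 = K * w ^ j.
    elim: j => [|j [IH1 IH2]]; first by rewrite muln1.
    set h6 := loop _ _ _ in IH1 IH2 *; have [_ [F1 F2]] := step (setv h6 5 j) IH1.
    split; first exact: F1.
    have h6_3 : hv (setv h6 5 j) 3 = K * w ^ j by exact: IH2.
    by rewrite [LHS]F2 h6_3 expnS; lia.
  split; last first.
    by rewrite den_seq E3 den_seq den_set den_seq den_set; case: (main D).
  split=> //; split=> //; split=> //; rewrite -/h2 E3; split=> //; split=> //; split.
    by apply: (@leq_trans D) => //; rewrite /M addnAC leq_addl.
  move=> j jD; have [F1 _] := main j; exact: (proj1 (step (setv (loop _ j h5) 5 j) F1)).
have R := compP (leq_trans (leq_addr _ _) (leq_addr _ _) : k <= M) (fun _ _ => erefl) 0 sim0 okB.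
have [t [s' [ex _ [[_ _ sx _ _] _]]]] := R.
exists (t + 1), (step (Move 0 (rX 3)) s'); split.
  by apply: exec_seq ex _; exact: exec_op.
case: s' sx {ex R} => r m /= sx.
by rewrite /= upd_same sx resB.
Qed.

(** Puts n * n, the number of input cells, into register 2 by repeated addition, as the register
    layout demands. *)
Definition prologue : program :=
  seqs [:: Op (Move 4 0); Op (Const 6 1);
    While 4 (seqs [:: Op (Add 2 2 0); Op (Defs.Sub 4 4 6)])].

Lemma prologueP n g (f : nat) : let s := State (upd (upd (fun=> 0) 0 n) 1 f) g in
  (forall i, n * n <= i -> g i = 0) ->
  runs prologue s (n * 3 + 3) (sim n (n * n) g (HState (fun x => if x == 0 then f else 0) (fun _ _ => 0))).
Proof.
move=> s g0; rewrite (_ : n * 3 + 3 = (n * 3 + 1 + 0).+2); last by lia.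
do 2 apply: runs_ops; rewrite [step _ _]/=; set s1 := State _ _.
pose J k s' := [/\ k <= n, reg s' 0 = n, forall x, reg s' (rX x) = if x == 0 then f else 0,
  memory s' = g & [/\ reg s' 2 = (n - k) * n, reg s' 4 = k & reg s' 6 = 1]].
have J1 : J n s1.
  split=> //; last by rewrite subnn.
  by move=> [|x]; rewrite /= /upd /rX //=; do !case: eqP => //; lia.
apply: runs_cons (runs_while 4 _ 2 J _ _ _ _ J1) _.
- by move=> k s' [_ _ _ _ []].
- move=> k [r m] [lek r0 rx mg [r2 r4 r6]]; rewrite /= in r0 rx mg r2 r4 r6.
  do 2 apply: runs_ops; apply: runs_skip; rewrite [step _ _]/=.
  split=> //=; first exact: ltnW.
    by move=> x; rewrite -rx /upd; do !case: eqP => //; rewrite /rX; lia.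
  rewrite /upd /= r2 r4 r6 r0; split=> //; last by rewrite subn1.
  by rewrite addnC -mulSn subnSK.
- move=> [r m] [_ /= r0 rx -> [r2 _ _]]; apply: runs_skip.
  split=> //= [|a i]; first by rewrite r2 subn0.
  by apply: g0; exact: leq_addr.
Qed.

Theorem theorem4p5 :
  @FPT MB_Dom_Game (fun x : sgraph * player => P4_fewness (@adj x.1)).
Proof.
have [K [D KD]] : poly_bounded (fun M => (M * 3 + 3) + (cost M main_prog + 1)).
  apply: poly_bounded_add; last by apply: poly_bounded_add; [exact: poly_bounded_cost|exact: poly_bounded_const].
  by apply: poly_bounded_add; [apply: poly_bounded_mul|]; exact: poly_bounded_const.
exists (Seq prologue (Seq (comp main_prog 0) (Op (Move 0 (rX 40))))).
exists (fun k => K * (3 ^ (k + 6)).+1 ^ D), D; split; first exact: computable_bound.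
move=> [[n e esym eirr] F]; set q := P4_fewness _.
rewrite [input_size _]/=.
(* The bound q - 4 over the integers, written over the natural numbers without truncation. *)
have few (S : {set 'I_n}) : #|S| <= q -> num_P4 e S + 4 <= q.
  rewrite /q /P4_fewness; case: ex_minnP => q' /forallP /= H _ Sq.
  by have := H S; rewrite Sq /=; lia.
pose M := n + 3 ^ (q + 6).
pose g a := nat_of_bool [exists i : 'I_n, exists j : 'I_n, (a == i * n + j) && e i j].
have lt (i j : 'I_n) : i * n + j < n * n.
  by apply: (@leq_trans (i.+1 * n)); [rewrite mulSn addnC ltn_add2r|rewrite leq_mul2r ltn_ord orbT].
have g0 i : n * n <= i -> g i = 0.
  move=> le; rewrite /g; case: existsP => // -[a /existsP [b /andP [/eqP E _]]].
  by have := lt a b; rewrite -E ltnNge le.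
have gE (i j : 'I_n) : g (i * n + j) = e i j.
  rewrite /g; congr nat_of_bool; apply/existsP/idP => [[a /existsP [b /andP [/eqP E]]]|ij]; last first.
    by exists i; apply/existsP; exists j; rewrite eqxx.
  have n0 : 0 < n by apply: leq_ltn_trans (ltn_ord i).
  have ai : i = a by apply/val_inj; have := congr1 (fun z => z %/ n) E; rewrite /= !divnMDl // !divn_small ?addn0.
  have bj : j = b by apply/val_inj; move: E; rewrite ai => /addnI.
  by rewrite ai bj.
have leM : 3 ^ (q + 6) <= M by exact: leq_addl.
set h0 := HState (fun x => if x == 0 then nat_of_bool (is_dominator F) else 0) (fun _ _ => 0).
have [okm resm] := main_progP gE esym eirr few leM h0.
have P := @prologueP n g (is_dominator F) g0.
have C s1 : sim n (n * n) g h0 s1 -> runs (Seq (comp main_prog 0) (Op (Move 0 (rX 40)))) s1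
    (cost M main_prog + 1) (fun s' => reg s' 0 = out e setT (is_dominator F)).
  move=> sim1; apply: runs_seq (compP (leq_addr _ _) g0 0 sim1 okm) _ => -[r m] [[_ _ sx _ _] _].
  apply: runs_op => //; apply: etrans (sx 40) _; rewrite resm /=.
  by case: (is_dominator F).
have [t [s' [ex le res]]] := runs_seq P C.
exists t, s', (out e setT (is_dominator F)); split.
- exact: ex.
- apply: leq_trans le _.
  apply: (@leq_trans ((M * 3 + 3) + (cost M main_prog + 1))).
    by rewrite leq_add2r leq_add2r leq_mul2r leq_addr orbT.
  apply: leq_trans (KD M) _; rewrite -mulnA -expnMn leq_mul2l; apply/orP; right.
  (* The sum of n and a function of q is bounded by a product, which separates the parameter from
     the size. *)
  have le' : M.+1 <= (3 ^ (q + 6)).+1 * n.+1 by rewrite /M; nia.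
  by case: (D) => // D'; rewrite leq_exp2r.
- exact: res.
- exact: outcome_strategy.
Qed.
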